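(* Let $\mu,\nu\in\mathcal{P}(\mathbb{R}^d)$ be absolutely continuous with respect to Lebesgue measure, let $c(x,y)=h(x-y)$ with $h:\mathbb{R}^d\to[0,+\infty)$ strictly convex, and let $\Lambda>0$. Then the constrained Entropy Transport problem $$\inf_{\gamma\in\mathcal{P}(\mathbb{R}^d\times\mathbb{R}^d)}\mathcal{E}_{\Lambda,\mathrm{KL}}(\gamma|\mu,\nu)$$ admits a unique optimal solution.
   Context: $\mathcal{P}(X)$ is the space of probability measures on $X$. $\pi_1,\pi_2:\mathbb{R}^d\times\mathbb{R}^d\to\mathbb{R}^d$ are the projections onto the first and second coordinates, and $\#$ denotes push-forward of measures. For finite positive measures $\alpha,\beta$ on $\mathbb{R}^d$, $$D_{\mathrm{KL}}(\alpha\|\beta)=\int_{\mathbb{R}^d}F\left(\frac{d\alpha}{d\beta}\right)d\beta \ \text{ if } \alpha\ll\beta,\qquad D_{\mathrm{KL}}(\alpha\|\beta)=+\infty\ \text{ otherwise},$$ with $F(s)=s\log s-s+1$ (and $F(0)=1$). For $\gamma\in\mathcal{P}(\mathbb{R}^d\times\mathbb{R}^d)$, $$\mathcal{E}_{\Lambda,\mathrm{KL}}(\gamma|\mu,\nu)=\iint_{\mathbb{R}^d\times\mathbb{R}^d}c(x,y)\,d\gamma(x,y)+\Lambda D_{\mathrm{KL}}(\pi_{1\#}\gamma\|\mu)+\Lambda D_{\mathrm{KL}}(\pi_{2\#}\gamma\|\nu).$$ An optimal solution is a $\gamma$ attaining the infimum. *)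

(* Defs.v *)
From HB Require Import structures.
From mathcomp Require Import all_boot all_order all_algebra.
From mathcomp Require Import all_classical all_reals all_analysis.
From mathcomp Require Import measurable_realfun.
Set Implicit Arguments.
Unset Strict Implicit.
Unset Printing Implicit Defensive.
Import Order.TTheory GRing.Theory Num.Theory.
Import numFieldNormedType.Exports.
Local Open Scope classical_set_scope.
Local Open Scope ring_scope.

(** R^d is 'rV[R]_d, with its Borel sigma-algebra. Since the topology is second
    countable, the library's product sigma-algebra on 'rV[R]_d * 'rV[R]_d is
    the Borel sigma-algebra of R^d x R^d. *)

Definition rV_display : measure_display.
Proof. exact: default_measure_display. Qed.

Section borel_rV.
Context {R : realType} (n : nat).

Definition borel_rV : set (set 'rV[R]_n) := <<s [set U | open U] >>.

HB.instance Definition _ := @isMeasurable.Build rV_display 'rV[R]_n borel_rV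
  (@sigma_algebra0 _ _ _) (@sigma_algebraC _ _) (@sigma_algebra_bigcup _ _ _).

End borel_rV.

Section measurable_rV.
Context {R : realType}.

Lemma open_measurable_rV n (U : set 'rV[R]_n) : open U -> measurable U.
Proof. exact: sub_sigma_algebra. Qed.

Lemma measurable_coord_rV n (i : 'I_n) :
  measurable_fun [set: 'rV[R]_n] (fun v : 'rV[R]_n => v 0 i).
Proof.
apply: (measurability _ (RGenOpens.measurableE R)) => _ [_ [a [b ->] <-]].
rewrite setTI; apply: open_measurable_rV; apply: open_comp => [v _|].
  exact: coord_continuous.
exact: interval_open.
Qed.

Let cube n (p : 'rV[rat]_n * nat) : set 'rV[R]_n :=
  [set v | forall i, `|ratr (p.1 0 i) - v 0 i| < p.2.+1%:R^-1].

Let open_bigcup_cube n (U : set 'rV[R]_n) : open U ->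
  U = \bigcup_(p in [set p | cube p `<=` U]) cube p.
Proof.
move=> oU; apply/seteqP; split => [v Uv|v [p /= pU] /pU//].
have /nbhs_ballP[e /= e0 veU] : nbhs v U by exact: open_nbhs_nbhs.
have e20 : 0 < e / 2 by rewrite divr_gt0.
have [k _ /(_ _ (leqnn k)) ke] := near_infty_natSinv_lt (PosNum e20).
have vq i : exists q : rat, `|ratr q - v 0 i| < k.+1%:R^-1.
  have /rat_in_itvoo[q] : v 0 i - k.+1%:R^-1 < v 0 i + k.+1%:R^-1.
    by rewrite ltrBlDr -addrA ltrDl addr_gt0// invr_gt0.
  by rewrite in_itv/= => vq; exists q; rewrite ltr_distl.
have [q qv] := choice vq.
exists (\row_i q i, k) => [w /= qw|i /=]; last by rewrite mxE; exact: qv.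
apply: veU; split => // i j; rewrite ord1 /ball/= (splitr e).
rewrite (le_lt_trans (ler_distD (ratr (q j)) _ _))// ltrD//.
  by rewrite distrC (lt_trans (qv j)).
by have := qw j; rewrite mxE => /lt_trans; apply.
Qed.

Lemma measurable_fun_rV d (T : measurableType d) n (f : T -> 'rV[R]_n) :
  (forall i, measurable_fun [set: T] (fun x => f x 0 i)) ->
  measurable_fun [set: T] f.
Proof.
move=> mf; apply: (measurability [set U : set 'rV[R]_n | open U]) => //.
move=> _ [U oU <-]; rewrite setTI (open_bigcup_cube oU) bigcup_mkcond.
rewrite preimage_bigcup; apply: countable_bigcupT_measurable => // p.
case: ifPn => _; last by rewrite preimage_set0.
have -> : f @^-1` cube p = \bigcap_(i in [set: 'I_n])
    (fun x => f x 0 i) @^-1` ball (ratr (p.1 0 i) : R) (p.2.+1%:R^-1).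
  by apply/seteqP; split => x /= fx i; [move=> _; exact: fx|exact: (fx i I)].
apply: fin_bigcap_measurable => // i _.
rewrite -[X in measurable X]setTI; apply: mf => //.
exact: measurable_ball.
Qed.

Definition cons_rV n (p : R * 'rV[R]_n) : 'rV[R]_n.+1 :=
  row_mx p.1%:M p.2.

Definition uncons_rV n (v : 'rV[R]_n.+1) : R * 'rV[R]_n :=
  (v 0 0, rsubmx (v : 'rV_(1 + n))).

Lemma cons_rVK n : cancel (@cons_rV n) (@uncons_rV n).
Proof.
move=> [x v]; rewrite /uncons_rV /cons_rV/= row_mxKr.
congr pair; transitivity ((row_mx x%:M v : 'rV_(1 + n)) 0 (lshift n 0)).
  by congr (fun_of_matrix _ _ _); exact/val_inj.
by rewrite row_mxEl mxE eqxx mulr1n.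
Qed.

Lemma uncons_rVK n : cancel (@uncons_rV n) (@cons_rV n).
Proof.
move=> v; rewrite /uncons_rV /cons_rV/=.
have -> : (v 0 0)%:M = lsubmx (v : 'rV_(1 + n)).
  apply/rowP => i; rewrite !ord1 !mxE mulr1n.
  by congr (fun_of_matrix v _ _); exact/val_inj.
exact: (@hsubmxK R 1 1 n v).
Qed.

Lemma measurable_cons_rV n : measurable_fun [set: R * 'rV[R]_n] (@cons_rV n).
Proof.
apply: measurable_fun_rV => i; rewrite /cons_rV.
case: (split_ordP (i : 'I_(1 + n))) => j ->.
  rewrite (_ : (fun _ => _) = fst) //.
  by apply/funext => p; rewrite (@row_mxEl _ 1 1 n) mxE ord1 mulr1n.
rewrite (_ : (fun _ => _) = (fun v : 'rV[R]_n => v 0 j) \o snd).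
  apply: measurableT_comp => //; exact: measurable_coord_rV.
by apply/funext => p; rewrite (@row_mxEr _ 1 1 n).
Qed.

Lemma measurable_uncons_rV n : measurable_fun [set: 'rV[R]_n.+1] (@uncons_rV n).
Proof.
apply: measurable_fun_pair; first exact: measurable_coord_rV.
apply: measurable_fun_rV => i.
rewrite (_ : (fun _ => _) = fun v : 'rV[R]_n.+1 => v 0 (rshift 1 i)).
  exact: measurable_coord_rV.
by apply/funext => v; rewrite mxE.
Qed.

End measurable_rV.

(** Lebesgue measure on R^n, by induction on n: the transport of the product of
    one-dimensional Lebesgue measure and Lebesgue measure on R^(n - 1). *)
Section lebesgue_rV.
Context {R : realType}.

Section step.
Variables (n : nat) (m : {sigma_finite_measure set 'rV[R]_n -> \bar R}).

Definition lebesgue_cons : set 'rV[R]_n.+1 -> \bar R :=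
  pushforward (@lebesgue_measure R \x m)%E (@cons_rV R n).

Let lebesgue_cons0 : lebesgue_cons set0 = 0%E.
Proof. by rewrite /lebesgue_cons /pushforward preimage_set0 measure0. Qed.

Let lebesgue_cons_ge0 A : (0 <= lebesgue_cons A)%E.
Proof. by rewrite /lebesgue_cons /pushforward measure_ge0. Qed.

Let lebesgue_cons_sigma_additive : semi_sigma_additive lebesgue_cons.
Proof.
by apply: measure_semi_sigma_additive; exact: measurable_cons_rV.
Qed.

HB.instance Definition _ := isMeasure.Build _ _ _ lebesgue_cons
  lebesgue_cons0 lebesgue_cons_ge0 lebesgue_cons_sigma_additive.

Let lebesgue_cons_sigma_finite : sigma_finite setT lebesgue_cons.
Proof.
have /sigma_finiteP[F [TF ndF Foo]] := sigma_finiteT (@lebesgue_measure R).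
have /sigma_finiteP[G [TG ndG Goo]] := sigma_finiteT m.
exists (fun k => @uncons_rV R n @^-1` (F k `*` G k)).
  apply/esym; rewrite -subTset => v _; rewrite -preimage_bigcup /=.
  have [i _ Fi] : (\bigcup_i F i) (uncons_rV v).1 by rewrite -TF.
  have [j _ Gj] : (\bigcup_j G j) (uncons_rV v).2 by rewrite -TG.
  exists (maxn i j) => //; split.
    by move: Fi; exact/subsetPset/ndF/leq_maxl.
  by move: Gj; exact/subsetPset/ndG/leq_maxr.
move=> k; have [mF Fk] := Foo k; have [mG Gk] := Goo k; split.
  rewrite -[X in measurable X]setTI; apply: measurable_uncons_rV => //.
  exact: measurableX.
rewrite /lebesgue_cons /pushforward -comp_preimage.
rewrite (_ : _ \o _ = id); last by apply/funext => p; rewrite /= cons_rVK.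
by rewrite preimage_id product_measure1E// lte_mul_pinfty// ge0_fin_numE.
Qed.

HB.instance Definition _ := Measure_isSigmaFinite.Build _ _ _ lebesgue_cons
  lebesgue_cons_sigma_finite.

End step.

Fixpoint lebesgue_rV n : {sigma_finite_measure set 'rV[R]_n -> \bar R} :=
  if n is n'.+1 then lebesgue_cons (lebesgue_rV n') else \d_(0 : 'rV[R]_0).

Lemma lebesgue_rV_box n (a b : 'I_n -> R) : (forall i, a i <= b i) ->
  lebesgue_rV n [set v : 'rV[R]_n | forall i, v 0 i \in `]a i, b i]] =
  (\prod_(i < n) (b i - a i))%:E.
Proof.
elim: n a b => [|n IH] a b ab.
  by rewrite big_ord0 /= diracE mem_set//= => -[].
rewrite big_ord_recl -[LHS]/((@lebesgue_measure R \x lebesgue_rV n)%E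
  (@cons_rV R n @^-1` [set v | forall i, v 0 i \in `]a i, b i]])).
have c0 x (v : 'rV[R]_n) : cons_rV (x, v) 0 0 = x.
  by have /(congr1 fst) := cons_rVK (x, v).
have cS x (v : 'rV[R]_n) i : cons_rV (x, v) 0 (lift ord0 i) = v 0 i.
  have /(congr1 snd)/rowP/(_ i) := cons_rVK (x, v).
  by rewrite mxE => <-; congr (fun_of_matrix _ _ _); exact/val_inj.
have -> : @cons_rV R n @^-1` [set v : 'rV[R]_n.+1 | forall i, v 0 i \in `]a i, b i]] =
    `]a ord0, b ord0] `*`
    [set v : 'rV[R]_n | forall i : 'I_n, v 0 i \in `]a (lift ord0 i), b (lift ord0 i)]].
  apply/seteqP; split => -[x v] /= => [xv|[xab vab] i].
    split; first by have := xv ord0; rewrite c0.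
    by move=> i; have := xv (lift ord0 i); rewrite cS.
  case: (unliftP ord0 i) => [j ->|->]; first by rewrite cS.
  by rewrite c0.
rewrite product_measure1E//=.
  rewrite lebesgue_measure_itv/= IH// lte_fin EFinM.
  have [//|ab0] := ltP (a ord0) (b ord0).
  by rewrite (@le_anti _ _ (a ord0) (b ord0)) ?ab// subrr.
rewrite (_ : mkset _ = \bigcap_(i in [set: 'I_n])
  (fun v : 'rV[R]_n => v 0 i) @^-1` `]a (lift ord0 i), b (lift ord0 i)]).
  apply: fin_bigcap_measurable => // i _.
  by rewrite -[X in measurable X]setTI; apply: measurable_coord_rV.
by apply/seteqP; split => v /= vab i; [move=> _; exact: vab|exact: (vab i I)].
Qed.

End lebesgue_rV.

Section entropy_transport.
Local Open Scope ereal_scope.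
Local Open Scope charge_scope.

HB.instance Definition _ d1 d2 (T1 : measurableType d1)
    (T2 : measurableType d2) :=
  isMeasurableFun.Build _ _ (T1 * T2)%type T1 fst measurable_fst.

HB.instance Definition _ d1 d2 (T1 : measurableType d1)
    (T2 : measurableType d2) :=
  isMeasurableFun.Build _ _ (T1 * T2)%type T2 snd measurable_snd.

(** As [0 * ln 0 = 0], this also gives F(0) = 1. *)
Definition entropy_fun {R : realType} (s : R) : R := (s * ln s - s + 1)%R.

(** The library's derivative is defined for charges, hence the coercion of
    alpha; it is finite everywhere when [alpha `<< beta], so [fine] is harmless,
    and nonnegative beta-almost everywhere. *)
Definition DKL d (T : measurableType d) (R : realType)
    (alpha beta : {finite_measure set T -> \bar R}) : \bar R :=
  if `[< alpha `<< beta >] then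
    \int[beta]_x
      (entropy_fun (fine (('d (charge_of_finite_measure alpha) '/d beta) x)))%:E
  else +oo.

Definition entropy_transport d (T : measurableType d) (R : realType)
    (c : T -> T -> R) (Lambda : R) (mu nu : probability T R)
    (gamma : probability (T * T)%type R) : \bar R :=
  \int[gamma]_z (c z.1 z.2)%:E
  + Lambda%:E * DKL (distribution gamma fst) mu
  + Lambda%:E * DKL (distribution gamma snd) nu.

Definition optimal_solution d (T : measurableType d) (R : realType)
    (c : T -> T -> R) (Lambda : R) (mu nu : probability T R)
    (gamma : probability (T * T)%type R) : Prop :=
  entropy_transport c Lambda mu nu gamma =
  ereal_inf (range (entropy_transport c Lambda mu nu)).

End entropy_transport.

Definition strictly_convex (R : numDomainType) (V : lmodType R) (h : V -> R) :=
  forall (x y : V) (t : R), x != y -> 0 < t < 1 ->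
    h (t *: x + (1 - t) *: y) < t * h x + (1 - t) * h y.

(* Main.v *)
Require Import Defs.
From HB Require Import structures.
From mathcomp Require Import all_boot all_order all_algebra.
From mathcomp Require Import all_classical all_reals all_analysis.
From mathcomp Require Import measurable_realfun lra.
Set Implicit Arguments.
Unset Strict Implicit.
Unset Printing Implicit Defensive.
Import Order.TTheory GRing.Theory Num.Theory.
Import numFieldNormedType.Exports.
Local Open Scope classical_set_scope.
Local Open Scope ring_scope.

(** Existence. Along an ultrafilter, the masses of a minimizing sequence converge
    on every measurable set. The bound on the entropies makes the marginals
    uniformly small on the sets of small mu- or nu-mass, so the limits of the
    marginals are measures. The limit of the couplings is then countably additive
    on rectangles, because the mass of a rectangle can be approximated using
    compact and open rectangles up to errors that the marginals control. The
    entropy is lower semicontinuous for setwise convergence by Young's inequality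
    s p <= F(s) + e^p - 1, and so is the cost, since its superlevel sets are
    open, hence countable unions of rectangles.

    Uniqueness. The average of two minimizers is a minimizer, and strict convexity
    of F forces their first marginals to agree. This marginal is absolutely
    continuous. If the average charged distinct targets y0 and y1 from a common set S
    of sources of positive Lebesgue measure, S would meet a translate S + t (y1 - y0)
    with t > 0 small, and exchanging the targets of mass sent from p to y0 and from
    p - t (y1 - y0) to y1 would keep the marginals and decrease the cost, as
    h(a - t w) + h(b + t w) < h(a) + h(b) for w close to a - b != 0. So the average
    is carried by a graph over the first coordinate, and so are the two minimizers,
    which are therefore determined by their common first marginal. *)

(** * Relative entropy *)

(** Ultrafilter limits exist on every set without any compactness theorem, so the only question is
    countable additivity. Couplings with uniformly absolutely continuous marginals need not be
    uniformly absolutely continuous themselves, which is why their limit is identified on rectangles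
    only. For uniqueness, strict convexity of F says nothing about couplings with the same
    marginals, among which the cost is linear. As the entropies see marginals only, a minimizer is
    also optimal for transport between its own marginals; exchanges of targets then suffice, and
    neither duality nor a potential is used. The obstacle is the order of the choices. The
    neighbourhoods of the two targets are fixed before the pigeonhole principle supplies t, so the
    gain must hold for all t at once: it is obtained at t = 1/2, where a - t w and b + t w both lie
    near the midpoint of a and b, and convexity carries it down to every smaller t. Paired sources
    differ only approximately by t (y1 - y0), so w is taken as their exact difference divided by
    t. *)

Section entropy_fun.
Context {R : realType}.
Implicit Types s t p : R.

(** The convex conjugate of F is e^p - 1. For s > 0 this is the tangent inequality 1 + q <= e^q at q
    = p - ln s, multiplied by s. *)
Lemma entropy_fun_young s p : 0 <= s -> s * p <= entropy_fun s + (expR p - 1).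
Proof.
rewrite le_eqVlt => /predU1P[<-|s0].
  by rewrite /entropy_fun !mul0r; have := expR_gt0 p; lra.
have : s * (1 + (p - ln s)) <= expR p.
  rewrite -[in leRHS](subrK (ln s) p) expRD lnK ?posrE// mulrC.
  by rewrite ler_pM2r// expR_ge1Dx.
rewrite /entropy_fun; lra.
Qed.

Lemma entropy_fun_ge0 s : 0 <= s -> 0 <= entropy_fun s.
Proof. by move=> /(entropy_fun_young 0); rewrite expR0; lra. Qed.

Lemma entropy_fun_young_lt s t : 0 <= s -> 0 < t -> s != t ->
  s * ln t < entropy_fun s + (t - 1).
Proof.
rewrite le_eqVlt => /predU1P[<-|s0] t0 st.
  by rewrite /entropy_fun !mul0r; lra.
have : s * (1 + (ln t - ln s)) < t.
  have /expR_gt1Dx : ln t - ln s != 0.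
    by rewrite subr_eq0; apply: contra st => /eqP/ln_inj ->.
  rewrite expRD expRN !lnK ?posrE// -(ltr_pM2l s0).
  by rewrite mulrCA divff ?mulr1// gt_eqF.
rewrite /entropy_fun; lra.
Qed.

Lemma entropy_fun_eq_young t : t * ln t = entropy_fun t + (t - 1).
Proof. by rewrite /entropy_fun; lra. Qed.

(** Young's inequality with slope ln m, where m is the midpoint, is strict at s and at t and an
    equality at m; adding the two strict ones gives the claim without derivatives. *)
Lemma entropy_fun_midpoint_lt s t : 0 <= s -> 0 <= t -> s != t ->
  2 * entropy_fun ((s + t) / 2) < entropy_fun s + entropy_fun t.
Proof.
move=> s0 t0 st; have m0 : 0 < (s + t) / 2.
  move: st; rewrite neq_lt => /orP[|]; lra.
have /(entropy_fun_young_lt s0 m0) : s != (s + t) / 2.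
  by apply: contra st => /eqP; lra.
have /(entropy_fun_young_lt t0 m0) : t != (s + t) / 2.
  by apply: contra st => /eqP; lra.
have := entropy_fun_eq_young ((s + t) / 2); lra.
Qed.

Lemma entropy_fun_midpoint s t : 0 <= s -> 0 <= t ->
  2 * entropy_fun ((s + t) / 2) <= entropy_fun s + entropy_fun t.
Proof.
move=> s0 t0; have [->|/(entropy_fun_midpoint_lt s0 t0)/ltW//] := eqVneq s t.
rewrite (_ : (t + t) / 2 = t); lra.
Qed.

Lemma measurable_entropy_fun : measurable_fun [set: R] (@entropy_fun R).
Proof.
apply: measurable_funD => //; apply: measurable_funB => //.
by apply: measurable_funM.
Qed.

End entropy_fun.

Section DKL.
Local Open Scope ereal_scope.
Context d (T : measurableType d) (R : realType).
Implicit Types alpha beta gamma : {finite_measure set T -> \bar R}.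

(** A version of the Radon-Nikodym derivative that is real and nonnegative at every point, so that
    the bounds on [entropy_fun] apply pointwise. *)
Definition density beta alpha (g : T -> R) :=
  [/\ measurable_fun [set: T] g, forall x, (0 <= g x)%R &
      forall A, measurable A -> alpha A = \int[beta]_(x in A) (g x)%:E].

(** Here [beta] may be sigma-finite, beyond what [density] allows, because the lemma is also applied
    to Lebesgue measure. *)
Lemma density_ex (beta : {sigma_finite_measure set T -> \bar R}) alpha :
  alpha `<< beta -> exists g : T -> R,
  [/\ measurable_fun [set: T] g, forall x, (0 <= g x)%R &
      forall A, measurable A -> alpha A = \int[beta]_(x in A) (g x)%:E].
Proof.
move=> /radon_nikodym_sigma_finite[f [f0 ffin /integrableP[mf _] fE]].
exists (fine \o f); split => [|x|A mA].
- exact: measurableT_comp.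
- by rewrite /= fine_ge0.
- by rewrite fE//; apply: eq_integral => x _; rewrite /= fineK.
Qed.

Lemma density_dominates beta alpha g : density beta alpha g -> alpha `<< beta.
Proof.
move=> [mg g0 gE]; apply/null_content_dominatesP => A mA A0.
rewrite gE//; apply: null_set_integral => //.
by apply: measurable_funTS; exact/measurable_EFinP.
Qed.

(** Densities are unique almost everywhere, so any of them computes the entropy; later proofs never
    return to the derivative of charges. *)
Lemma DKL_density beta alpha g : density beta alpha g ->
  DKL alpha beta = \int[beta]_x (entropy_fun (g x))%:E.
Proof.
move=> dg; have ab := density_dominates dg; have [mg g0 gE] := dg.
rewrite /DKL; case: asboolP => // _.
have abc : charge_of_finite_measure alpha `<< beta by [].
have : ae_eq beta setT (Radon_Nikodym (charge_of_finite_measure alpha) beta)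
    (EFin \o g).
  apply: integral_ae_eq => //.
  - exact: Radon_Nikodym_integrable.
  - exact/measurable_EFinP.
  - by move=> E _ mE; rewrite -Radon_Nikodym_integral// -gE.
move=> fg; apply: ae_eq_integral => //.
- apply/measurable_EFinP; apply: measurableT_comp measurable_entropy_fun _.
  exact: measurableT_comp.
- by apply/measurable_EFinP; exact: measurableT_comp measurable_entropy_fun _.
- by apply: filterS fg => x /(_ I) /= -> _.
Qed.

Lemma DKL_dominates beta alpha : DKL alpha beta < +oo -> alpha `<< beta.
Proof. by rewrite /DKL; case: asboolP. Qed.

Lemma DKL_lty_density beta alpha : DKL alpha beta < +oo ->
  exists g, density beta alpha g.
Proof. by move=> /DKL_dominates/density_ex. Qed.

Lemma DKL_ge0 alpha beta : 0 <= DKL alpha beta.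
Proof.
have [/DKL_lty_density[g dg]|] := ltP (DKL alpha beta) +oo.
  rewrite (DKL_density dg); apply: integral_ge0 => x _.
  by rewrite lee_fin entropy_fun_ge0//; case: dg.
by rewrite leye_eq => /eqP ->.
Qed.

Lemma measurable_entropy_density beta alpha g : density beta alpha g ->
  measurable_fun [set: T] (fun x => (entropy_fun (g x))%:E).
Proof.
move=> [mg _ _]; apply/measurable_EFinP.
exact: measurableT_comp measurable_entropy_fun _.
Qed.

(** Young's inequality with constant slope p, integrated over A; the entropy outside A is
    nonnegative and is added for free. A large p makes a bounded entropy force small mass on sets of
    small [beta]-mass. *)
Lemma DKL_young beta alpha A (p : R) : measurable A -> (0 <= p)%R ->
  p%:E * alpha A <= DKL alpha beta + (expR p - 1)%:E * beta A.
Proof.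
move=> mA p0; have p1 : (0 <= expR p - 1)%R by rewrite subr_ge0 -expR0 ler_expR.
have [/DKL_lty_density[g dg]|] := ltP (DKL alpha beta) +oo; last first.
  rewrite leye_eq => /eqP ->; rewrite addye ?leey// gt_eqF//.
  by rewrite (lt_le_trans (ltNyr 0))// mule_ge0// lee_fin.
have mF := measurable_entropy_density dg.
rewrite (DKL_density dg); have [mg g0 gE] := dg; rewrite gE//.
have mEg : measurable_fun [set: T] (EFin \o g) by exact/measurable_EFinP.
have F0 x : 0 <= (entropy_fun (g x))%:E by rewrite lee_fin entropy_fun_ge0.
rewrite -ge0_integralZl//=; last 2 first.
- exact: measurable_funTS.
- by move=> x _; rewrite lee_fin.
apply: (@le_trans _ _ (\int[beta]_(x in A) (entropy_fun (g x))%:E +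
    \int[beta]_(x in A) (expR p - 1)%:E)); last first.
  rewrite integral_cst// leeD2r//.
  by apply: ge0_subset_integral.
rewrite -ge0_integralD//; last exact: measurable_funTS.
apply: ge0_le_integral => //.
- by move=> x _; rewrite mule_ge0// lee_fin.
- apply: emeasurable_funM => //; exact: measurable_funTS.
- by apply: emeasurable_funD => //; exact: measurable_funTS.
- by move=> x _; rewrite -EFinM -EFinD lee_fin mulrC entropy_fun_young.
Qed.

Lemma density_midpoint beta alpha alpha' gamma g g' :
  density beta alpha g -> density beta alpha' g' ->
  (forall A, measurable A -> 2%:E * gamma A = alpha A + alpha' A) ->
  density beta gamma (fun x => (g x + g' x) / 2)%R.
Proof.
move=> [mg g0 gE] [mg' g0' gE'] gamE; split => [|x|A mA].
- by apply: measurable_funM => //; exact: measurable_funD.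
- by rewrite divr_ge0// addr_ge0.
- have : 2%:E * gamma A =
      2%:E * \int[beta]_(x in A) ((g x + g' x) / 2)%:E.
    rewrite gamE// gE// gE'// -ge0_integralD//; last 4 first.
    + by move=> x _; rewrite lee_fin.
    + by apply: measurable_funTS; exact/measurable_EFinP.
    + by move=> x _; rewrite lee_fin.
    + by apply: measurable_funTS; exact/measurable_EFinP.
    rewrite -ge0_integralZl//; last 2 first.
    + apply: measurable_funTS; apply/measurable_EFinP.
      by apply: measurable_funM => //; exact: measurable_funD.
    + by move=> x _; rewrite lee_fin divr_ge0// addr_ge0.
    apply: eq_integral => x _; rewrite -EFinM -EFinD; congr EFin.
    by rewrite mulrCA divff ?mulr1.
  move=> /(congr1 (fun u => (2^-1)%:E * u)).
  by rewrite !muleA -EFinM mulVf// !mul1e.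
Qed.

Lemma DKL_midpoint beta alpha alpha' gamma :
  (forall A, measurable A -> 2%:E * gamma A = alpha A + alpha' A) ->
  2%:E * DKL gamma beta <= DKL alpha beta + DKL alpha' beta.
Proof.
move=> gamE.
have [/DKL_lty_density[g dg]|] := ltP (DKL alpha beta) +oo; last first.
  by rewrite leye_eq => /eqP ->; rewrite addye ?leey// gt_eqF//
    (lt_le_trans (ltNyr 0))// DKL_ge0.
have [/DKL_lty_density[g' dg']|] := ltP (DKL alpha' beta) +oo; last first.
  by rewrite leye_eq => /eqP ->; rewrite addey ?leey// gt_eqF//
    (lt_le_trans (ltNyr 0))// DKL_ge0.
have dm := density_midpoint dg dg' gamE.
have mF := measurable_entropy_density dg.
have mF' := measurable_entropy_density dg'.
have mFm := measurable_entropy_density dm.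
rewrite (DKL_density dg) (DKL_density dg') (DKL_density dm).
have [_ g0 _] := dg; have [_ g0' _] := dg'; have [_ gm0 _] := dm.
rewrite -ge0_integralZl//; last by move=> x _; rewrite lee_fin entropy_fun_ge0.
rewrite -ge0_integralD//; last 2 first.
- by move=> x _; rewrite lee_fin entropy_fun_ge0.
- by move=> x _; rewrite lee_fin entropy_fun_ge0.
apply: ge0_le_integral => //.
- by move=> x _; rewrite -EFinM lee_fin mulr_ge0// entropy_fun_ge0.
- exact: emeasurable_funM.
- exact: emeasurable_funD.
- by move=> x _; rewrite -EFinM -EFinD lee_fin entropy_fun_midpoint.
Qed.

(** The midpoint defect [D] of F along the two densities is nonnegative and has integral 0, so it
    vanishes almost everywhere, and strict convexity makes the densities agree there. *)
Lemma DKL_midpoint_eq beta alpha alpha' gamma :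
  (forall A, measurable A -> 2%:E * gamma A = alpha A + alpha' A) ->
  DKL alpha beta < +oo -> DKL alpha' beta < +oo ->
  DKL alpha beta + DKL alpha' beta <= 2%:E * DKL gamma beta ->
  forall A, measurable A -> alpha A = alpha' A.
Proof.
move=> gamE fin fin' le2.
have [g dg] := DKL_lty_density fin; have [g' dg'] := DKL_lty_density fin'.
have dm := density_midpoint dg dg' gamE.
have mF := measurable_entropy_density dg.
have mF' := measurable_entropy_density dg'.
have mFm := measurable_entropy_density dm.
have [mg g0 gE] := dg; have [mg' g0' gE'] := dg'; have [_ gm0 _] := dm.
pose D x := (entropy_fun (g x) + entropy_fun (g' x) -
  2 * entropy_fun ((g x + g' x) / 2))%R.
have D0 x : (0 <= D x)%R by rewrite subr_ge0 entropy_fun_midpoint.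
have mD : measurable_fun [set: T] (EFin \o D).
  apply/measurable_EFinP; apply: measurable_funB.
    by apply: measurable_funD; exact/measurable_EFinP.
  by apply: measurable_funM => //; exact/measurable_EFinP.
have sumE : DKL alpha beta + DKL alpha' beta =
    2%:E * DKL gamma beta + \int[beta]_x (D x)%:E.
  rewrite (DKL_density dg) (DKL_density dg') (DKL_density dm).
  rewrite -ge0_integralZl//; last by move=> x _; rewrite lee_fin entropy_fun_ge0.
  rewrite -!ge0_integralD//.
  - by apply: eq_integral => x _; rewrite -EFinM -!EFinD /D; congr EFin; lra.
  - by move=> x _; rewrite -EFinM lee_fin mulr_ge0// entropy_fun_ge0.
  - exact: emeasurable_funM.
  - by move=> x _; rewrite lee_fin.
  - by move=> x _; rewrite lee_fin entropy_fun_ge0.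
  - by move=> x _; rewrite lee_fin entropy_fun_ge0.
have D_int0 : \int[beta]_x (D x)%:E = 0.
  have Dge0 : 0 <= \int[beta]_x (D x)%:E.
    by apply: integral_ge0 => x _; rewrite lee_fin.
  (* Finiteness of the entropy of the average, inherited from the other two, is what allows it to be
     cancelled in [sumE]. *)
  have gfin : 2%:E * DKL gamma beta \is a fin_num.
    rewrite ge0_fin_numE ?mule_ge0 ?DKL_ge0//.
    by rewrite (le_lt_trans (DKL_midpoint _ gamE))// lte_add_pinfty.
  apply/eqP; rewrite eq_le Dge0 andbT.
  by rewrite -(leeD2lE _ _ gfin) adde0 -sumE.
have : ae_eq beta setT (EFin \o D) (cst 0).
  apply/ae_eq_integral_abs => //; rewrite -[RHS]D_int0.
  by apply: eq_integral => x _; rewrite /= ger0_norm.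
move=> D_ae A mA; rewrite gE// gE'//; apply: ae_eq_integral => //.
- by apply: measurable_funTS; exact/measurable_EFinP.
- by apply: measurable_funTS; exact/measurable_EFinP.
- apply: filterS D_ae => x /(_ I) [Dx] _; congr EFin; apply/eqP.
  apply: contraPP Dx => /negP gg' /eqP; rewrite gt_eqF// subr_gt0.
  exact: entropy_fun_midpoint_lt.
Qed.

End DKL.

(** * Lower semicontinuity of the entropy under setwise convergence *)

Section DKL_lsc.
Local Open Scope ereal_scope.
Context d (T : measurableType d) (R : realType).
Implicit Types alpha beta gamma : {finite_measure set T -> \bar R}.

Lemma integrable_entropy_density beta alpha g A : density beta alpha g ->
  measurable A -> DKL alpha beta < +oo ->
  beta.-integrable A (fun x => (entropy_fun (g x))%:E).
Proof.
move=> dg mA fin; apply: (@integrableS _ _ _ _ setT) => //.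
apply/integrableP; split; first exact: measurable_entropy_density dg.
rewrite (DKL_density dg) in fin; apply: le_lt_trans fin.
have [_ g0 _] := dg; under eq_integral.
  move=> x _; rewrite gee0_abs; last by rewrite lee_fin entropy_fun_ge0.
  over.
exact: lexx.
Qed.

Lemma integrable_density beta alpha g A : density beta alpha g ->
  measurable A -> beta.-integrable A (EFin \o g).
Proof.
move=> [mg g0 gE] mA; apply: (@integrableS _ _ _ _ setT) => //.
apply/integrableP; split; first exact/measurable_EFinP.
rewrite (_ : \int[beta]_x _ = alpha setT) ?ltey_eq ?fin_num_measure//.
by rewrite gE//; apply: eq_integral => x _ /=; rewrite ger0_norm.
Qed.

Lemma integrable_density_affine beta alpha g A (a b : R) :
  density beta alpha g -> measurable A ->
  beta.-integrable A (fun x => (a * g x + b)%:E).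
Proof.
move=> dg mA; under eq_fun do rewrite EFinD EFinM.
apply: integrableD => //.
  by apply: integrableZl => //; exact: integrable_density dg mA.
by apply: finite_measure_integrable_cst.
Qed.

Lemma integral_density_affine beta alpha g A (a b : R) :
  density beta alpha g -> measurable A ->
  \int[beta]_(x in A) (a * g x + b)%:E =
    (a * fine (alpha A) + b * fine (beta A))%:E.
Proof.
move=> dg mA; have ig := integrable_density dg mA; have [mg g0 gE] := dg.
under eq_integral do rewrite EFinD EFinM.
rewrite integralD//; last 2 first.
- exact: integrableZl.
- exact: finite_measure_integrable_cst.
rewrite integralZl// integral_cst// -gE//.
by rewrite EFinD !EFinM !fineK ?fin_num_measure.
Qed.

(** The slope p may be negative, so the argument relies on integrability, not on nonnegative
    integrands as in [DKL_young]. *)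
Lemma density_young beta alpha g A (p : R) : density beta alpha g ->
  measurable A -> DKL alpha beta < +oo ->
  (p * fine (alpha A) <= fine (\int[beta]_(x in A) (entropy_fun (g x))%:E) +
    (expR p - 1) * fine (beta A))%R.
Proof.
move=> dg mA fin; have iF := integrable_entropy_density dg mA fin.
suff : \int[beta]_(x in A) (p * g x + (1 - expR p))%:E <=
    \int[beta]_(x in A) (entropy_fun (g x))%:E.
  rewrite (integral_density_affine _ _ dg)// -(fineK (integrable_fin_num _ iF))//.
  rewrite lee_fin; lra.
apply: le_integral => //; first exact: integrable_density_affine dg mA.
move=> x _; have [_ g0 _] := dg.
by rewrite lee_fin; have := entropy_fun_young p (g0 x); lra.
Qed.

Lemma cvg_sum_nat (I : Type) (F : set_system I) (FF : Filter F)
    (u : nat -> I -> R) (l : nat -> R) n : (forall k, u k i @[i --> F] --> l k) ->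
  (\sum_(0 <= k < n) u k i)%R @[i --> F] --> (\sum_(0 <= k < n) l k)%R.
Proof.
move=> ul; elim: n => [|n IH].
  by under eq_fun do rewrite big_geq//; rewrite big_geq//; exact: cvg_cst.
under eq_fun do rewrite big_nat_recr//=.
by rewrite big_nat_recr//=; exact: cvgD.
Qed.

(** Each piece has its own slope. For fixed slopes only finitely many masses of [alpha] occur, and
    they occur linearly, so the inequality survives setwise limits. *)
Lemma DKL_young_sum beta alpha (P : nat -> set T) (c : nat -> R) n :
  (forall k, measurable (P k)) -> trivIset setT P -> DKL alpha beta < +oo ->
  (\sum_(0 <= k < n) c k * fine (alpha (P k)) <= fine (DKL alpha beta) +
    \sum_(0 <= k < n) (expR (c k) - 1) * fine (beta (P k)))%R.
Proof.
move=> mP tP fin; have [g dg] := DKL_lty_density fin.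
have mF := measurable_entropy_density dg; have [mg g0 gE] := dg.
have F0 x : 0 <= (entropy_fun (g x))%:E by rewrite lee_fin entropy_fun_ge0.
apply: (@le_trans _ _ (\sum_(0 <= k < n) (fine (\int[beta]_(x in P k)
    (entropy_fun (g x))%:E) + (expR (c k) - 1) * fine (beta (P k))))%R).
  by apply: ler_sum => k _; exact: density_young.
rewrite big_split/= lerD2r -lee_fin fineK; last first.
  by rewrite ge0_fin_numE// DKL_ge0.
rewrite -sumEFin (eq_bigr (fun k => \int[beta]_(x in P k)
    (entropy_fun (g x))%:E)); last first.
  by move=> k _; rewrite fineK// integrable_fin_num//;
    exact: integrable_entropy_density dg _ fin.
rewrite -(@ge0_integral_bigsetU _ _ _ beta _ P (fun x => (entropy_fun (g x))%:E)
    (index_iota 0 n))//.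
- rewrite (DKL_density dg); apply: ge0_subset_integral => //.
  exact: bigsetU_measurable.
- exact: iota_uniq.
- exact: sub_trivIset tP.
- exact: measurable_funTS.
Qed.

Lemma DKL_lsc (I : Type) (F : set_system I) (FF : ProperFilter F)
    (alpha_ : I -> {finite_measure set T -> \bar R}) alpha beta (b : R) :
  (forall A, measurable A -> fine (alpha_ i A) @[i --> F] --> fine (alpha A)) ->
  (\forall i \near F, DKL (alpha_ i) beta <= b%:E) ->
  DKL alpha beta <= b%:E.
Proof.
move=> aE ab.
(* Eventually [alpha_ i] has finite entropy and so vanishes on the null sets of [beta]; the setwise
   limit inherits this. *)
have /density_ex[g dg] : alpha `<< beta.
  apply/null_content_dominatesP => A mA bA0.
  have : fine (alpha_ i A) @[i --> F] --> (0%R : R).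
    apply: cvg_near_cst; near=> i.
    have /DKL_dominates/null_content_dominatesP -> // : DKL (alpha_ i) beta < +oo.
    by rewrite (@le_lt_trans _ _ b%:E) ?ltry//; near: i.
  move/(cvg_unique _ (aE _ mA)) => a0.
  by rewrite -[LHS]fineK ?a0// fin_num_measure.
have {}dg : density beta alpha g by [].
have mF := measurable_entropy_density dg; have [mg g0 gE] := dg.
have F0 x : 0 <= (entropy_fun (g x))%:E by rewrite lee_fin entropy_fun_ge0.
rewrite (DKL_density dg); apply/lee_addgt0Pr => e e0.
(* The total loss will be at most r times the masses of [alpha] and [beta]; the summand 1 only keeps
   the divisor positive. *)
pose M := (fine (beta setT) + fine (alpha setT) + 1)%R.
have M0 : (0 < M)%R by rewrite ltr_wpDl// addr_ge0// fine_ge0.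
pose r := (e / M)%R; have r0 : (0 < r)%R by rewrite divr_gt0.
(* T is cut into the countably many pieces on which g = 0 or ln g varies by at
   most r; on each of them the slope c makes Young's inequality almost sharp. *)
pose kappa x := if g x == 0%R then 0%N else (pickle (Num.floor (ln (g x) / r))).+1.
pose P k := kappa @^-1` [set k].
have mP k : measurable (P k).
  case: k => [|k].
    rewrite (_ : P 0%N = g @^-1` [set 0%R]).
      by rewrite -[X in measurable X]setTI; exact: mg.
    by apply/seteqP; split => x; rewrite /P /kappa /=; case: eqP.
  have [[z zk]|nz] := pselect (exists z : int, pickle z = k); last first.
    rewrite (_ : P k.+1 = set0)//; apply/seteqP; split => x //.
    rewrite /P /kappa /=; case: eqP => // _ [] xk; apply: nz.
    by exists (Num.floor (ln (g x) / r)).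
  rewrite (_ : P k.+1 = ~` (g @^-1` [set 0%R]) `&`
     (fun x => ln (g x) / r)%R @^-1` `[z%:~R, (z + 1)%:~R[%classic).
    apply: measurableI.
      by apply: measurableC; rewrite -[X in measurable X]setTI; exact: mg.
    rewrite -[X in measurable X]setTI.
    suff mf : measurable_fun setT (fun x => ln (g x) / r)%R by exact: mf.
    by apply: measurable_funM => //; exact: measurableT_comp.
  apply/seteqP; split => x; rewrite /P /kappa /=.
    case: eqP => // gx0 [] kE; split => //.
    have -> : z = Num.floor (ln (g x) / r).
      by apply: (pcan_inj pickleK); rewrite zk kE.
    by rewrite in_itv/= floor_itv.
  move=> [/eqP/negbTE -> zx]; have -> : Num.floor (ln (g x) / r) = z.
    by apply: floor_def; move: zx; rewrite in_itv.
  by rewrite zk.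
have tP : trivIset setT P by exact: trivIset_preimage1.
(* Where g = 0 the slope ln r loses exactly r in Young's inequality; elsewhere r times the floor of
   ln g / r loses at most r g. The default 0 of [odflt] is met only for codes of no integer, where
   the piece [P k] is empty. *)
pose c k := if k is k'.+1 then (r * (odflt 0 (unpickle k'))%:~R)%R else ln r.
have cE x : (entropy_fun (g x) <=
    g x * c (kappa x) - (expR (c (kappa x)) - 1) + r * (1 + g x))%R.
  rewrite /kappa /c; case: eqP => [->|/eqP gx0].
    by rewrite /entropy_fun lnK ?posrE//; lra.
  rewrite pickleK/=; have gx : (0 < g x)%R by rewrite lt_neqAle eq_sym gx0 g0.
  have /andP[] := floor_itv (ln (g x) / r)%R.
  rewrite ler_pdivlMr// intrD ltr_pdivrMr//; set z := _%:~R => zl lz.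
  have : (expR (r * z) <= g x)%R.
    by rewrite -[leRHS]lnK ?posrE// ler_expR mulrC.
  have : (g x * ln (g x) <= g x * (r * z + r))%R.
    by rewrite ler_pM2l//; move: lz; lra.
  by rewrite /entropy_fun; move: r0; nra.
have sum_le n : (\sum_(0 <= k < n) c k * fine (alpha (P k)) <=
    b + \sum_(0 <= k < n) (expR (c k) - 1) * fine (beta (P k)))%R.
  apply: (@cvgr_to_le _ F _ _
    (fun i => \sum_(0 <= k < n) c k * fine (alpha_ i (P k)))%R).
    by apply: cvg_sum_nat => k; apply: cvgZr; exact: aE.
  near=> i; have Db : DKL (alpha_ i) beta <= b%:E by near: i.
  have fin : DKL (alpha_ i) beta < +oo by rewrite (le_lt_trans Db)// ltry.
  rewrite (le_trans (DKL_young_sum c n mP tP fin))// lerD2r -lee_fin fineK//.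
  by rewrite ge0_fin_numE// DKL_ge0.
have TE : [set: T] = \bigcup_k P k.
  by apply/seteqP; split => // x _; exists (kappa x).
rewrite [X in \int[_]_(_ in X) _]TE ge0_integral_bigcup//; last first.
  by rewrite -TE.
apply: lime_le.
  by apply: is_cvg_nneseries => k _ _; exact: integral_ge0.
apply: nearW => n.
have Pk k : \int[beta]_(x in P k) (entropy_fun (g x))%:E <=
    (c k * fine (alpha (P k)) - (expR (c k) - 1) * fine (beta (P k)) +
      r * (fine (beta (P k)) + fine (alpha (P k))))%:E.
  rewrite [leRHS](_ : _ = \int[beta]_(x in P k)
      ((c k + r) * g x + (1 - expR (c k) + r))%:E); last first.
    rewrite (integral_density_affine _ _ dg)//; congr EFin; lra.
  have iP := integrable_density_affine (c k + r) (1 - expR (c k) + r) dg (mP k).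
  apply: ge0_le_integral => //.
  - exact: measurable_funTS.
  - exact: measurable_int iP.
  - by move=> x Px; rewrite lee_fin (le_trans (cE x))// Px; lra.
apply: (le_trans (lee_sum _ (fun k _ => Pk k))).
rewrite sumEFin -EFinD lee_fin big_split/= sumrB -mulr_sumr big_split/=.
have sumT (m : {finite_measure set T -> \bar R}) :
    (\sum_(0 <= k < n) fine (m (P k)) <= fine (m setT))%R.
  rewrite -lee_fin -sumEFin fineK ?fin_num_measure//.
  rewrite (eq_bigr (fun k => m (P k))); last first.
    by move=> k _; rewrite fineK ?fin_num_measure.
  rewrite big_mkord -measure_bigsetU//; apply: le_measure; rewrite ?inE//.
  exact: bigsetU_measurable.
have := sum_le n.
have : (r * (\sum_(0 <= k < n) fine (beta (P k)) +
    \sum_(0 <= k < n) fine (alpha (P k))) <= e)%R.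
  rewrite /r mulrAC ler_pdivrMr// ler_pM2l// /M.
  by have := sumT beta; have := sumT alpha; lra.
lra.
Unshelve. all: by end_near. Qed.

End DKL_lsc.

(** * Continuity of convex functions *)

Section convex_continuous.
Context {R : realType} {n : nat}.
Variable h : 'rV[R]_n -> R.
Hypothesis hconv : strictly_convex h.
Implicit Types (x y e : 'rV[R]_n) (t r : R).

Lemma strictly_convexW x y t : 0 <= t <= 1 ->
  h (t *: x + (1 - t) *: y) <= t * h x + (1 - t) * h y.
Proof.
move=> /andP[]; rewrite le_eqVlt => /predU1P[<- _|t0].
  by rewrite scale0r subr0 scale1r mul0r mul1r !add0r.
rewrite le_eqVlt => /predU1P[->|t1].
  by rewrite subrr scale0r scale1r mul0r mul1r !addr0.
have [->|xy] := eqVneq x y; last by rewrite ltW// hconv// t0.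
by rewrite -scalerDl -mulrDl addrC subrK scale1r mul1r.
Qed.

(** Separates two displacements of a point at the price of doubling them, so that coordinates can be
    treated one at a time. *)
Lemma convex_half x y : h (x + y) <= (h (2 *: x) + h (2 *: y)) / 2.
Proof.
have := @strictly_convexW (2 *: x) (2 *: y) 2^-1.
rewrite (_ : 1 - 2^-1 = 2^-1 :> R); last by lra.
rewrite !scalerA mulVf ?pnatr_eq0// !scale1r => /(_ _)/le_trans; apply; last by lra.
by apply/andP; split; lra.
Qed.

Lemma convex_line x e t : `|t| <= 1 ->
  h (x + t *: e) <= h x + `|t| * (`|h (x + e) - h x| + `|h (x - e) - h x|).
Proof.
have pos f s : 0 <= s <= 1 -> h (x + s *: f) <= h x + s * (h (x + f) - h x).
  move=> s01; have := strictly_convexW (x + f) x s01.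
  rewrite scalerDr addrAC -scalerDl addrC (addrC s) subrK scale1r addrC.
  by move=> /le_trans; apply; lra.
move=> t1; have [t0|t0] := leP 0 t.
  rewrite ger0_norm// in t1 *; rewrite (le_trans (pos _ _ _)) ?t0// lerD2l.
  by rewrite ler_wpM2l// ler_wpDr// ler_norm.
rewrite ltr0_norm// in t1 *; have := pos (- e) (- t).
rewrite scalerN scaleNr opprK => /(_ _)/le_trans; apply; first by lra.
by rewrite lerD2l ler_wpM2l ?oppr_ge0 ?(ltW t0)// ler_wpDl// ler_norm.
Qed.

(** A one-sided Lipschitz bound near x, by induction on the coordinates that move. Halving x splits
    off one coordinate; [convex_half] then doubles all displacements, which halves the admissible
    radius, while its factor 1/2 absorbs the doubling in the bound. *)
Lemma convex_sum_delta x (s : seq 'I_n) : exists K d : R, [/\ 0 <= K, 0 < d &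
  forall r (u : 'I_n -> R), r <= d -> (forall i, `|u i| <= r) ->
    h (x + \sum_(i <- s) u i *: delta_mx 0 i) <= h x + K * r].
Proof.
elim: s => [|i s [K [d [K0 d0 IH]]]].
  by exists 0, 1; split=> // r u _ _; rewrite big_nil addr0 mul0r addr0.
pose e : 'rV[R]_n := delta_mx 0 i.
pose M := `|h (x + e) - h x| + `|h (x - e) - h x|.
have M0 : 0 <= M by rewrite addr_ge0.
exists (M + K), (Num.min 2^-1 (d / 2)); split; first exact: addr_ge0.
  by rewrite lt_min invr_gt0 divr_gt0 ?ltr0n.
move=> r u; rewrite le_min => /andP[r2 rd] ur.
have r0 : 0 <= r by rewrite (le_trans _ (ur i)).
rewrite big_cons -/e (_ : x + _ = (2^-1 *: x + u i *: e) +
    (2^-1 *: x + \sum_(j <- s) u j *: delta_mx 0 j)); last first.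
  rewrite addrACA -scalerDl (_ : 2^-1 + 2^-1 = 1 :> R) ?scale1r//; lra.
apply: le_trans (convex_half _ _) _.
rewrite !(scalerDr 2) !scalerA mulfV ?pnatr_eq0// !scale1r.
rewrite scaler_sumr; under eq_bigr do rewrite scalerA.
have h2 : h (x + \sum_(j <- s) (2 * u j) *: delta_mx 0 j) <= h x + K * (2 * r).
  apply: (IH _ (fun j => 2 * u j)); first by lra.
  by move=> j; rewrite normrM ger0_norm// ler_pM2l.
have := @convex_line x e (2 * u i); rewrite normrM ger0_norm// => /(_ _)h1.
have {}h1 := h1 _; have : h (x + (2 * u i) *: e) <= h x + 2 * r * M.
  rewrite (le_trans (h1 _)) ?lerD2l ?ler_wpM2r ?ler_pM2l//.
  by have := ur i; lra.
move: h2; lra.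
Qed.

(** The upper bound at the reflected point 2 x - v turns into a lower bound at v, because x is the
    midpoint of the two. *)
Lemma strictly_convex_continuous : continuous h.
Proof.
move=> x; have [K [d [K0 d0 hK]]] := convex_sum_delta x (index_enum 'I_n).
have {}hK r (u : 'rV[R]_n) : r <= d -> (forall i, `|u 0 i| <= r) ->
    h (x + u) <= h x + K * r.
  by move=> rd ur; rewrite [u]row_sum_delta hK.
apply/(@cvgrPdist_le _ _ _ (nbhs x)) => e e0.
pose r := Num.min d (e / (K + 1)).
have K1 : 0 < K + 1 by rewrite ltr_wpDl.
have r0 : 0 < r by rewrite lt_min d0 divr_gt0.
have Kr : K * r <= e.
  have : r <= e / (K + 1) by rewrite ge_min lexx orbT.
  rewrite ler_pdivlMr//; lra.
have rd : r <= d by rewrite ge_min lexx.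
apply/nbhs_ballP; exists r => //= v [_ xv].
have ur i : `|(v - x) 0 i| <= r.
  by have := xv 0 i; rewrite /ball/= !mxE distrC => /ltW.
have := hK _ (v - x) rd ur; rewrite addrC subrK => h1.
have nur i : `|(x - v) 0 i| <= r by rewrite -opprB mxE normrN.
have := hK _ (x - v) rd nur => h2.
have := @strictly_convexW v (x + (x - v)) 2^-1.
rewrite (_ : 1 - 2^-1 = 2^-1 :> R); last by lra.
rewrite -scalerDr (_ : v + (x + (x - v)) = 2 *: x); last first.
  by rewrite addrCA (addrC v) subrK scaler_nat mulr2n.
rewrite scalerA mulVf ?pnatr_eq0// scale1r.
move=> /(_ _)h3; have {}h3 := h3 _; rewrite ler_norml.
have : h x <= 2^-1 * h v + 2^-1 * h (x + (x - v)).
  by apply: h3; apply/andP; split; lra.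
move=> h4; apply/andP; split; lra.
Qed.

End convex_continuous.

(** * Topology and regularity of measures on R^n *)

Section cubes.
Context {R : realType} {n : nat}.
Implicit Types (U V : set 'rV[R]_n).

(** Closed cubes, hence compact, with rational centres, hence indexed by a countable type: they
    serve as neighbourhoods, for exhaustions and for fine covers alike. *)
Definition rat_cube (p : 'rV[rat]_n * nat) : set 'rV[R]_n :=
  [set v | forall i, `|ratr (p.1 0 i) - v 0 i| <= p.2.+1%:R^-1].

Lemma compact_rat_cube p : compact (rat_cube p).
Proof.
pose A (i : 'I_n) : set R := `[ratr (p.1 ord0 i) - p.2.+1%:R^-1,
  ratr (p.1 ord0 i) + p.2.+1%:R^-1]%classic.
have cA i : compact (A i) by exact: segment_compact.
rewrite (_ : rat_cube p = [set v : 'rV[R]_n | forall i, A i (v ord0 i)]).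
  exact: (rV_compact cA).
by apply/seteqP; split => v /= + i => /(_ i); rewrite /A /= in_itv/= ler_distlC.
Qed.

Lemma rat_cube_nbhs (v : 'rV[R]_n) U : nbhs v U ->
  exists p, nbhs v (rat_cube p) /\ rat_cube p `<=` U.
Proof.
move=> /(@nbhs_ballP R 'rV[R]_n)[e /= e0 veU].
have e20 : 0 < e / 2 by rewrite divr_gt0.
have [k _ /(_ _ (leqnn k)) /= ke] := near_infty_natSinv_lt (PosNum e20).
pose r : R := k.+1%:R^-1; have r0 : 0 < r by rewrite invr_gt0.
have {}ke : r < e / 2 := ke.
(* The centre is within half the radius of v, so the cube contains a whole ball around v. *)
have vq i : exists q : rat, `|ratr q - v 0 i| < r / 2.
  have /rat_in_itvoo[q] : v 0 i - r / 2 < v 0 i + r / 2.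
    by rewrite ltrBlDr -addrA ltrDl addr_gt0// divr_gt0.
  by rewrite in_itv/= => vq; exists q; rewrite ltr_distl.
have [q qv] := choice vq.
exists (\row_i q i, k); split.
  apply/nbhs_ballP; exists (r / 2); first by rewrite /= divr_gt0.
  move=> w [_ vw] i /=; rewrite mxE -/r (splitr r).
  by rewrite (le_trans (ler_distD (v 0 i) _ _))// lerD// ltW//; exact: vw.
move=> w /= qw; apply: veU; split => // i j; rewrite ord1 /ball/= (splitr e).
rewrite (le_lt_trans (ler_distD (ratr (q j)) _ _))// ltr_leD//.
  by rewrite distrC (lt_trans (qv j))//; lra.
by have := qw j; rewrite mxE -/r => /le_trans; apply; exact: ltW.
Qed.

Lemma open_sigma_compact U : open U -> exists K : nat -> set 'rV[R]_n,
  [/\ forall k, compact (K k), {homo K : i j / (i <= j)%N >-> i `<=` j} &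
      U = \bigcup_k K k].
Proof.
move=> oU; pose C k : set 'rV[R]_n :=
  if unpickle k is Some p then
    (if `[< rat_cube p `<=` U >] then rat_cube p else set0) else set0.
have cC k : compact (C k).
  rewrite /C; case: unpickle => [p|]; last exact: compact0.
  by case: asboolP => _; [exact: compact_rat_cube|exact: compact0].
exists (fun k => \big[setU/set0]_(i < k) C i); split.
- move=> k; elim/big_ind : _ => //; [exact: compact0|exact: compactU].
- by move=> i j ij; exact: subset_bigsetU.
- apply/seteqP; split => [v Uv|v [k _]].
    have [p [/nbhs_singleton vp pU]] := rat_cube_nbhs (open_nbhs_nbhs (conj oU Uv)).
    exists (pickle p).+1 => //; rewrite -bigcup_mkord; exists (pickle p) => /=.
      exact: ltnSn.
    by rewrite /C pickleK asboolT.
  rewrite -bigcup_mkord => -[i _]; rewrite /C; case: unpickle => [p|//].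
  by case: asboolP => // pU /pU.
Qed.

Lemma closed_measurable_rV U : closed U -> measurable U.
Proof.
move=> cU; rewrite -(setCK U); apply: measurableC.
by apply: open_measurable_rV; exact: closed_openC.
Qed.

Lemma compact_measurable_rV U : compact U -> measurable U.
Proof.
move=> cU; apply: closed_measurable_rV; apply: compact_closed => //.
Qed.

End cubes.

Lemma open_rectangles {R : realType} {m n : nat}
    (O : set ('rV[R]_m * 'rV[R]_n)) : open O ->
  exists A : nat -> set 'rV[R]_m, exists B : nat -> set 'rV[R]_n,
    [/\ forall k, compact (A k), forall k, compact (B k) &
        O = \bigcup_k (A k `*` B k)].
Proof.
move=> oO.
pose I := (('rV[rat]_m * nat) * ('rV[rat]_n * nat))%type.
(* A code k determines at most one pair of cubes, so [A k] and [B k] are a cube or empty, hence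
   compact in both cases. *)
pose P (k : nat) (pq : I) := unpickle k = Some pq /\
  @rat_cube R _ pq.1 `*` rat_cube pq.2 `<=` O.
pose A k := [set x | exists2 pq, P k pq & @rat_cube R _ pq.1 x].
pose B k := [set x | exists2 pq, P k pq & @rat_cube R _ pq.2 x].
have AE k pq : P k pq -> A k = rat_cube pq.1.
  move=> Pk; apply/seteqP; split => [x [pq' [k' _]]|x]; last by exists pq.
  by move: Pk => [] + _; rewrite k' => -[->].
have BE k pq : P k pq -> B k = rat_cube pq.2.
  move=> Pk; apply/seteqP; split => [x [pq' [k' _]]|x]; last by exists pq.
  by move: Pk => [] + _; rewrite k' => -[->].
exists A, B; split.
- move=> k; have [[pq /AE->]|nP] := pselect (exists pq, P k pq).
    exact: compact_rat_cube.
  rewrite (_ : A k = set0); first exact: compact0.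
  by apply/seteqP; split => // x [pq Pk _]; apply: nP; exists pq.
- move=> k; have [[pq /BE->]|nP] := pselect (exists pq, P k pq).
    exact: compact_rat_cube.
  rewrite (_ : B k = set0); first exact: compact0.
  by apply/seteqP; split => // x [pq Pk _]; apply: nP; exists pq.
- apply/seteqP; split => [[x y] Oxy|[x y] [k _ [/= [pq Pk xp] yp]]]; last first.
    by move: yp; rewrite (BE _ _ Pk) => yp; case: Pk => _; apply; split.
  have [[U V] [/= xU yV] UVO] : nbhs (x, y) O by exact: open_nbhs_nbhs.
  have [p [/nbhs_singleton xp pU]] := rat_cube_nbhs xU.
  have [q [/nbhs_singleton yq qV]] := rat_cube_nbhs yV.
  have Ppq : P (pickle (p, q)) (p, q).
    by split; [rewrite pickleK|move=> [a b] /= [/pU Ua /qV Vb]; apply: UVO].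
  by exists (pickle (p, q)) => //; split; exists (p, q).
Qed.

Lemma open_measurable_rVX {R : realType} {m n : nat}
    (O : set ('rV[R]_m * 'rV[R]_n)) : open O -> measurable O.
Proof.
move=> /open_rectangles[A [B [cA cB ->]]]; apply: bigcupT_measurable => k.
by apply: measurableX; exact: compact_measurable_rV.
Qed.

Section small_sets.
Local Open Scope ereal_scope.
Context d (T : measurableType d) (R : realType).
Variable m : {finite_measure set T -> \bar R}.

Lemma nonincreasing_small (A : nat -> set T) (e : R) :
  (forall k, measurable (A k)) -> {homo A : i j / (i <= j)%N >-> j `<=` i} ->
  \bigcap_k A k = set0 -> (0 < e)%R -> exists k, m (A k) < e%:E.
Proof.
move=> mA nA A0 e0.
have : m \o A @ \oo --> 0%R%:E.
  rewrite -[X in _ --> X](measure0 m) -A0; apply: nonincreasing_cvg_mu => //.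
  - by rewrite ltey_eq fin_num_measure.
  - by rewrite A0.
  - by move=> i j ij; apply/subsetPset; exact: nA.
move=> /fine_cvgP[_] /cvgrPdist_lt/(_ _ e0)[k _ /(_ _ (leqnn k))] /=.
rewrite sub0r normrN => ke; exists k.
by rewrite -(@fineK _ (m (A k))) ?fin_num_measure// lte_fin (le_lt_trans (ler_norm _)).
Qed.

Lemma nondecreasing_small (A : nat -> set T) (U : set T) (e : R) :
  (forall k, measurable (A k)) -> measurable U ->
  {homo A : i j / (i <= j)%N >-> i `<=` j} ->
  U `<=` \bigcup_k A k -> (0 < e)%R -> exists k, m (U `\` A k) < e%:E.
Proof.
move=> mA mU nA UA e0; apply: (@nonincreasing_small (fun k => U `\` A k)) => //.
- by move=> k; exact: measurableD.
- by move=> i j ij; apply: setDS; exact: nA.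
- apply/seteqP; split => // x Ux; have [Ux' _] := Ux 0%N I.
  by have [k _ Akx] := UA x Ux'; have [_] := Ux k I.
Qed.

End small_sets.

Section regularity.
Local Open Scope ereal_scope.
Context (R : realType) (n : nat).
Variable m : {finite_measure set 'rV[R]_n -> \bar R}.
Implicit Types A U K : set 'rV[R]_n.

Let outer A := measurable A /\ forall e : R, (0 < e)%R ->
  exists U, [/\ open U, A `<=` U & m (U `\` A) < e%:E].

Let outer_bigcup (A : nat -> set 'rV[R]_n) : (forall k, outer (A k)) ->
  outer (\bigcup_k A k).
Proof.
move=> oA; have mA k : measurable (A k) by have [] := oA k.
split=> [|e e0]; first exact: bigcupT_measurable.
(* Summing infinitely many strict bounds gives only a weak one; the half restores strictness. *)
have e2 : (0 < e / 2)%R by rewrite divr_gt0.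
have /choice[U oU] k : exists U, [/\ open U, A k `<=` U &
    m (U `\` A k) < (e / 2 / (2 ^ k.+1)%:R)%:E].
  have [_] := oA k; apply; rewrite divr_gt0// ltr0n expn_gt0//.
have mU k : measurable (U k) by apply: open_measurable_rV; have [] := oU k.
exists (\bigcup_k U k); split.
- by apply: bigcup_open => k _; have [] := oU k.
- by apply: subset_bigcup => k _; have [] := oU k.
apply: (@le_lt_trans _ _ (\sum_(k <oo) m (U k `\` A k))).
  apply: measure_sigma_subadditive.
  - by move=> k; exact: measurableD.
  - by apply: measurableD; exact: bigcupT_measurable.
  - move=> x [[k _ Ukx] nA]; exists k => //; split => // Akx.
    by apply: nA; exists k.
apply: (@le_lt_trans _ _ (\sum_(k <oo) (e / 2 / (2 ^ k.+1)%:R)%:E)).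
  by apply: lee_nneseries => // k _; apply: ltW; have [] := oU k.
by rewrite (le_lt_trans (epsilon_trick0 _ (ltW e2)))// lte_fin ltr_pdivrMr//; lra.
Qed.

Let outerI A B : outer A -> outer B -> outer (A `&` B).
Proof.
move=> [mA oA] [mB oB]; split=> [|e e0]; first exact: measurableI.
have e2 : (0 < e / 2)%R by rewrite divr_gt0.
have [U [oU AU UAe]] := oA _ e2; have [V [oV BV VBe]] := oB _ e2.
have mU := open_measurable_rV oU; have mV := open_measurable_rV oV.
exists (U `&` V); split; [exact: openI|exact: setISS|].
rewrite (splitr e) EFinD (le_lt_trans _ (lteD UAe VBe))//.
apply: (le_trans _ (measureU2 _ _ _)); try exact: measurableD.
apply: le_measure; rewrite ?inE//.
- by apply: measurableD; exact: measurableI.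
- by apply: measurableU; exact: measurableD.
- move=> x [[Ux Vx] /not_andP[nA|nB]]; [by left|by right].
Qed.

(** The finite intersections decrease to the full one, and since m is finite some of them exceeds it
    by a small mass only; an open set around that one is enough. *)
Let outer_bigcap (A : nat -> set 'rV[R]_n) : (forall k, outer (A k)) ->
  outer (\bigcap_k A k).
Proof.
move=> oA; have mA k : measurable (A k) by have [] := oA k.
have mcA : measurable (\bigcap_k A k) by exact: bigcapT_measurable.
split=> // e e0.
have e2 : (0 < e / 2)%R by rewrite divr_gt0.
pose B k := \big[setI/setT]_(i < k) A i.
have oB k : outer (B k).
  rewrite /B; elim/big_ind : _ => [|C D|//]; last exact: outerI.
  split=> // r r0.
  by exists setT; split => //; [exact: openT|rewrite setDv measure0 lte_fin].
have mB k : measurable (B k) by have [] := oB k.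
have BE k : B k = \bigcap_(i < k) A i by rewrite /B -bigcap_mkord.
have [k Bk] : exists k, m (B k `\` \bigcap_k A k) < (e / 2)%:E.
  apply: (nonincreasing_small _ _ _ _ e2).
  - by move=> k; exact: measurableD.
  - move=> i j ij; apply: setSD; rewrite !BE => x Bx l /= li; apply: Bx => /=.
    exact: leq_trans ij.
  - apply/seteqP; split => // x Bx; have [_ nA] := Bx 0%N I; apply: nA => i _.
    by have [+ _] := Bx i.+1 I; rewrite BE; apply => /=.
have [U [oU BU UBe]] := (oB k).2 _ e2; have mU := open_measurable_rV oU.
exists U; split => //.
  by apply: subset_trans BU; rewrite BE => x Ax i _; exact: Ax.
rewrite (splitr e) EFinD (le_lt_trans _ (lteD UBe Bk))//.
apply: (le_trans _ (measureU2 _ _ _)); try exact: measurableD.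
apply: le_measure; rewrite ?inE//.
- exact: measurableD.
- by apply: measurableU; exact: measurableD.
- by move=> x [Ux nA]; have [Bx|nB] := pselect (B k x); [right|left].
Qed.

Let outer_open U : open U -> outer U.
Proof.
move=> oU; split=> [|e e0]; first exact: open_measurable_rV.
by exists U; split => //; rewrite setDv measure0 lte_fin.
Qed.

(** An open set is a countable union of compact sets, so its complement is a countable intersection
    of open sets. *)
Let outer_closed U : open U -> outer (~` U).
Proof.
move=> oU; have [K [cK nK UE]] := open_sigma_compact oU.
rewrite UE setC_bigcup; apply: outer_bigcap => k; apply: outer_open.
by apply: closed_openC; apply: compact_closed => //; exact: norm_hausdorff.
Qed.

(** The class [outer] is stable under countable unions and intersections, but complements are not
    immediate; asking for A and its complement together gives a sigma-algebra. *)
Let outer_measurable A : measurable A -> outer A /\ outer (~` A).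
Proof.
move=> mA; suff : <<s [set U | open U] >> `<=`
    [set A : set 'rV[R]_n | outer A /\ outer (~` A)] by exact.
apply: smallest_sub => [|U oU /=]; last by split; [exact: outer_open|exact: outer_closed].
split=> [|B [oB oCB]|B oB] /=.
- by rewrite setC0; split; apply: outer_open; [exact: open0|exact: openT].
- by rewrite setTD setCK.
- split; first by apply: outer_bigcup => k; have [] := oB k.
  by rewrite setC_bigcup; apply: outer_bigcap => k; have [] := oB k.
Qed.

Lemma outer_regular A (e : R) : measurable A -> (0 < e)%R ->
  exists U, [/\ open U, A `<=` U & m (U `\` A) < e%:E].
Proof. by move=> /outer_measurable[[_ +] _]; exact. Qed.

(** An open set tightly around the complement leaves a closed set inside A, which is cut down by one
    member of a compact exhaustion. *)
Lemma inner_regular A (e : R) : measurable A -> (0 < e)%R ->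
  exists K, [/\ compact K, K `<=` A & m (A `\` K) < e%:E].
Proof.
move=> mA e0; have e2 : (0 < e / 2)%R by rewrite divr_gt0.
have [_ [_ /(_ _ e2)[U [oU CAU Ue]]]] := outer_measurable mA.
have [K [cK nK TK]] := @open_sigma_compact R n setT openT.
have mK k : measurable (K k) by exact: compact_measurable_rV.
have mU := open_measurable_rV oU.
have [k Ke] : exists k, m (A `\` K k) < (e / 2)%:E.
  by apply: nondecreasing_small => //; rewrite -TK.
exists (K k `&` ~` U); split.
- apply: (subclosed_compact _ (cK k)); last by move=> x [].
  apply: closedI; last exact: open_closedC.
  by apply: compact_closed => //; exact: norm_hausdorff.
- by move=> x [_ nU]; apply: contrapT => nA; apply: nU; exact: CAU.
rewrite (splitr e) EFinD (le_lt_trans _ (lteD Ke Ue))//.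
have mCA : measurable (~` A) by exact: measurableC.
apply: (le_trans _ (measureU2 _ _ _)); try exact: measurableD.
apply: le_measure; rewrite ?inE//.
- by apply: measurableD => //; apply: measurableI => //; exact: measurableC.
- by apply: measurableU; exact: measurableD.
- move=> x [Ax /not_andP[nK'|/contrapT Ux]]; first by left.
  by right; split => //; rewrite setCK.
Qed.

End regularity.

(** * Limits of couplings along an ultrafilter *)

(** The image filter has a cluster point in the compact interval, and an ultrafilter converges to
    its cluster points. *)
Lemma ultra_cvg (R : realType) (I : Type) (U : set_system I)
    (UU : UltraFilter U) (u : I -> R) (a b : R) :
  (forall i, a <= u i <= b) -> exists l : R, u i @[i --> U] --> l.
Proof.
move=> uab; have FF : ProperFilter (u @ U) by exact: fmap_proper_filter.
have /(segment_compact FF)[l [_ lu]] : (u @ U) `[a, b]%classic.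
  by apply: nearW => i; rewrite /= in_itv/=.
exists l => V lV; have [//|UV] := in_ultra_setVsetC (u @^-1` V) UU.
by have [x [nVx Vx]] := lu (~` V) V UV lV; exfalso; exact: (nVx Vx).
Qed.

Section limit_mass.
Context d (T : measurableType d) (R : realType) (I : Type).
Context (U : set_system I) {UU : UltraFilter U}.
Variable m_ : I -> probability T R.
Implicit Types A B : set T.

(** In general only finitely additive: countable additivity has to be won from bounds that are
    uniform in i. *)
Definition limit_mass A : R := lim (fine (m_ i A) @[i --> U]).

Let prob_itv A i : measurable A -> 0 <= fine (m_ i A) <= 1.
Proof.
move=> mA; rewrite fine_ge0//= -lee_fin fineK ?fin_num_measure//.
exact: probability_le1.
Qed.

Lemma limit_mass_cvg A : measurable A ->
  fine (m_ i A) @[i --> U] --> limit_mass A.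
Proof.
move=> mA; have [l ul] := ultra_cvg UU (fun i => prob_itv i mA).
by rewrite /limit_mass (cvg_lim _ ul).
Qed.

Lemma limit_mass_ge0 A : measurable A -> 0 <= limit_mass A.
Proof.
move=> /[dup] mA /limit_mass_cvg/cvgr_to_ge; apply; apply: nearW => i.
exact: fine_ge0.
Qed.

Lemma limit_massT : limit_mass setT = 1.
Proof.
apply/esym; apply: (cvg_unique _ _ (limit_mass_cvg measurableT)) => //.
rewrite (_ : (fun i => _) = cst 1); first exact: cvg_cst.
by apply/funext => i; rewrite probability_setT.
Qed.

Lemma limit_mass0 : limit_mass set0 = 0.
Proof.
apply/esym; apply: (cvg_unique _ _ (limit_mass_cvg measurable0)) => //.
rewrite (_ : (fun i => _) = cst 0); first exact: cvg_cst.
by apply/funext => i; rewrite measure0.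
Qed.

Lemma limit_massU A B : measurable A -> measurable B -> A `&` B = set0 ->
  limit_mass (A `|` B) = limit_mass A + limit_mass B.
Proof.
move=> mA mB AB0; have mAB := measurableU _ _ mA mB.
apply: (cvg_unique _ (limit_mass_cvg mAB)) => //.
have -> : (fun i => fine (m_ i (A `|` B))) =
    (fun i => fine (m_ i A) + fine (m_ i B)).
  by apply/funext => i; rewrite measureU// fineD ?fin_num_measure.
by apply: cvgD; exact: limit_mass_cvg.
Qed.

Lemma limit_mass_bigsetU (F : nat -> set T) n : (forall k, measurable (F k)) ->
  trivIset setT F ->
  limit_mass (\big[setU/set0]_(k < n) F k) = \sum_(k < n) limit_mass (F k).
Proof.
move=> mF tF; elim: n => [|n IH]; first by rewrite !big_ord0 limit_mass0.
rewrite !big_ord_recr/= limit_massU//.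
- by rewrite IH.
- exact: bigsetU_measurable.
- by apply: (@trivIset_bigsetUI _ predT) => //; rewrite /predT /= trueE.
Qed.

Lemma limit_mass_sub_bigsetU (F : nat -> set T) A n :
  (forall k, measurable (F k)) -> measurable A ->
  A `<=` \big[setU/set0]_(k < n) F k ->
  limit_mass A <= \sum_(k < n) limit_mass (F k).
Proof.
move=> mF mA AF.
have cF : (\sum_(0 <= k < n) fine (m_ i (F k))) @[i --> U] -->
    (\sum_(0 <= k < n) limit_mass (F k)).
  by apply: cvg_sum_nat => k; exact: limit_mass_cvg.
rewrite -(big_mkord xpredT (fun k => limit_mass (F k))).
rewrite -subr_ge0; apply: (cvgr_to_ge (cvgB cF (limit_mass_cvg mA))).
apply: nearW => i; rewrite /= subr_ge0 -lee_fin fineK ?fin_num_measure//.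
rewrite big_mkord -sumEFin (eq_bigr (fun k : 'I_n => m_ i (F k))); last first.
  by move=> k _; rewrite fineK ?fin_num_measure.
exact: content_subadditive.
Qed.

End limit_mass.

Lemma measure_of_content d (T : semiRingOfSetsType d) (R : realType)
    (f : set T -> \bar R) : (forall A, 0 <= f A)%E -> measure_function.semi_additive f ->
  measurable_subset_sigma_subadditive f ->
  exists m : {measure set T -> \bar R}, forall A, m A = f A.
Proof.
move=> f0 fadd fsub.
pose c : {content set T -> \bar R} := HB.pack f (isContent.Build d T R f f0 fadd).
have fsig : semi_sigma_additive f by exact: (@semiring_sigma_additive _ _ _ c).
pose m : {measure set T -> \bar R} :=
  HB.pack f (isMeasure.Build d T R f (measure0 c) f0 fsig).
by exists m.
Qed.

Lemma probability_of_measure d (T : measurableType d) (R : realType)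
    (m : {measure set T -> \bar R}) : m setT = 1%E ->
  exists P : probability T R, forall A, P A = m A.
Proof.
(* Normalising a measure of mass 1 changes nothing; the [dirac] fallback concerns mass 0 or infinite
   mass. *)
move=> mT; pose P : probability T R := mnormalize m (dirac point).
by exists P => A; rewrite /P /= /mnormalize mT onee_eq0/= invr1 mule1.
Qed.

(** * Setwise limits of uniformly absolutely continuous probabilities *)

Section marginal_limit.
Context d (T : measurableType d) (R : realType) (I : Type).
Context (U : set_system I) {UU : UltraFilter U}.
Variable (m_ : I -> probability T R) (mu : {finite_measure set T -> \bar R}).
Hypothesis uac : forall e : R, 0 < e -> exists2 r : R, 0 < r &
  forall i A, measurable A -> (mu A < r%:E)%E -> fine (m_ i A) <= e.

(** In a countable cover of A, the part missed by the first n sets has small [mu]-mass for n large,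
    hence small mass for all i at once and in the limit. So finite subadditivity improves to
    countable subadditivity. *)
Lemma marginal_limit : exists m : probability T R, forall A, measurable A ->
  fine (m_ i A) @[i --> U] --> fine (m A).
Proof.
(* The content axioms ask for nonnegativity on every set, while [limit_mass] is under control on
   measurable sets only; hence the value 0 elsewhere. *)
pose f A := if `[< measurable A >] then (limit_mass U m_ A)%:E else 0%E.
have fE A : measurable A -> f A = (limit_mass U m_ A)%:E.
  by move=> mA; rewrite /f asboolT.
have f0 A : (0 <= f A)%E.
  by rewrite /f; case: asboolP => // mA; rewrite lee_fin limit_mass_ge0.
have fadd : measure_function.semi_additive f.
  move=> F n mF tF mUF; rewrite fE// limit_mass_bigsetU// -sumEFin.
  by apply: eq_bigr => k _; rewrite fE.
have fsub : measurable_subset_sigma_subadditive f.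
  move=> A F mF mA AF; apply/lee_addgt0Pr => e e0.
  have [r r0 mr] := uac e0.
  pose B n := \big[setU/set0]_(k < n) F k.
  have mB n : measurable (B n) by exact: bigsetU_measurable.
  have [n An] : exists n, (mu (A `\` B n) < r%:E)%E.
    apply: nondecreasing_small => //.
    - by move=> i j ij; exact: subset_bigsetU.
    - move=> x /AF[k _ Fkx]; exists k.+1 => //.
      by rewrite /B big_ord_recr; right.
  have mAB : measurable (A `\` B n) by exact: measurableD.
  have fAB : limit_mass U m_ (A `\` B n) <= e.
    apply: (cvgr_to_le (@limit_mass_cvg _ _ _ _ U UU m_ _ mAB)).
    by apply: nearW => i; exact: mr.
  have : limit_mass U m_ A <= \sum_(k < n) limit_mass U m_ (F k) + e.
    have -> : A = A `&` B n `|` A `\` B n by rewrite setUIDK.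
    rewrite limit_massU//; last 2 first.
    - exact: measurableI.
    - by apply/seteqP; split => // x [[_ Bx] [_]].
    rewrite lerD//; apply: limit_mass_sub_bigsetU => //; exact: measurableI.
  rewrite fE// -lee_fin EFinD => /le_trans; apply; rewrite leeD2r//.
  rewrite -sumEFin -(big_mkord xpredT (fun k => (limit_mass U m_ (F k))%:E)).
  rewrite (eq_bigr (fun k => f (F k))); last by move=> k _; rewrite fE.
  exact: nneseries_lim_ge.
have [m mE] := measure_of_content f0 fadd fsub.
have mT : m setT = 1%E by rewrite mE fE// limit_massT.
have [P PE] := probability_of_measure mT; exists P => A mA.
by rewrite PE mE fE//; exact: limit_mass_cvg.
Qed.

End marginal_limit.

(* An alias of the product, to carry the semiring of rectangles without
   clashing with the product sigma-algebra. *)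
Definition rect_type (T1 T2 : Type) : Type := (T1 * T2)%type.

Definition rect_display : measure_display -> measure_display -> measure_display.
Proof. by move=> _ _; exact: default_measure_display. Qed.

Section rect_semiring.
Context d1 d2 (T1 : measurableType d1) (T2 : measurableType d2).

Definition rect : set (set (rect_type T1 T2)) :=
  [set A `*` B | A in measurable & B in measurable].

Let rect0 : rect set0.
Proof. by exists set0 => //; exists set0 => //; rewrite setX0. Qed.

Let rectI : setI_closed rect.
Proof.
move=> _ _ [A mA [B mB <-]] [C mC [D mD <-]].
exists (A `&` C); first exact: measurableI.
by exists (B `&` D); [exact: measurableI|rewrite setXI].
Qed.

Let rectD : semi_setD_closed rect.
Proof.
move=> _ _ [A mA [B mB <-]] [C mC [D mD <-]].
exists [set (A `\` C) `*` B; (A `&` C) `*` (B `\` D)]; split.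
- exact: finite_set2.
- move=> _ [->|->].
    by exists (A `\` C); [exact: measurableD|exists B].
  exists (A `&` C); first exact: measurableI.
  by exists (B `\` D); [exact: measurableD|].
- rewrite bigcup_setU !bigcup_set1; apply/seteqP; split => [[x y] [[Ax By] /not_andP /= nCD]|].
    have [Cx|nCx] := pselect (C x); last by left.
    by right; split => //; split => //; case: nCD.
  by move=> [x y] [[[Ax nCx] By]|[[Ax Cx] [By nDy]]]; split => // -[].
- move=> X Y [->|->] [->|->] // [[x y]] [].
    by move=> [[_ nCx] _] [[_ Cx] _]; exfalso; exact: (nCx Cx).
  by move=> [[_ Cx] _] [[_ nCx] _]; exfalso; exact: (nCx Cx).
Qed.

HB.instance Definition _ := Pointed.on (rect_type T1 T2).
HB.instance Definition _ := @isSemiRingOfSets.Build (rect_display d1 d2)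
  (rect_type T1 T2) rect rect0 rectI rectD.

End rect_semiring.

(** The Caratheodory extension from the semiring of rectangles, transported along the fact that
    rectangles generate the product sigma-algebra. *)
Lemma measure_of_rect d1 d2 (T1 : measurableType d1) (T2 : measurableType d2)
    (R : realType) (f : {measure set (rect_type T1 T2) -> \bar R}) :
  exists m : {measure set (T1 * T2) -> \bar R}, forall A B,
    measurable A -> measurable B -> m (A `*` B) = f (A `*` B).
Proof.
have mE : @measurable _ (T1 * T2)%type =
    @measurable _ (g_sigma_algebraType (@measurable _ (rect_type T1 T2))).
  by rewrite measurable_prod_measurableType.
pose g : set (T1 * T2) -> \bar R := measure_extension f.
have g0 : g set0 = 0%E by exact: measure0.
have gge0 A : (0 <= g A)%E by exact: measure_ge0.
have gsig : semi_sigma_additive g.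
  move=> F mF tF mUF; apply: (@measure_semi_sigma_additive _ _ _
    (measure_extension f)) => //.
    by move=> k; rewrite -mE.
  by rewrite -mE.
pose m : {measure set (T1 * T2) -> \bar R} :=
  HB.pack g (isMeasure.Build _ (T1 * T2)%type R g g0 gge0 gsig).
exists m => A B mA mB.
rewrite /m /= /g /measure_extension measurable_mu_extE//.
by exists A => //; exists B.
Qed.

(** * Setwise limits of couplings on rectangles *)

Section coupling_limit.
Context (R : realType) (m n : nat) (I : Type).
Context (U : set_system I) {UU : UltraFilter U}.
Notation X := 'rV[R]_m.
Notation Y := 'rV[R]_n.
Variable g_ : I -> probability (X * Y)%type R.
Variables (alpha : {finite_measure set X -> \bar R})
  (beta : {finite_measure set Y -> \bar R}).
Hypothesis alphaE : forall A, measurable A ->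
  fine (g_ i (A `*` setT)) @[i --> U] --> fine (alpha A).
Hypothesis betaE : forall B, measurable B ->
  fine (g_ i (setT `*` B)) @[i --> U] --> fine (beta B).

Let g := limit_mass U g_.

Let gA A : measurable A -> g (A `*` setT) = fine (alpha A).
Proof.
move=> mA; apply: (cvg_unique _ _ (alphaE mA)) => //.
by apply: limit_mass_cvg; exact: measurableX.
Qed.

Let gB B : measurable B -> g (setT `*` B) = fine (beta B).
Proof.
move=> mB; apply: (cvg_unique _ _ (betaE mB)) => //.
by apply: limit_mass_cvg; exact: measurableX.
Qed.

(** Replacing A by C and B by D costs at most two strips of the form [(A \ C) x Y] and
    [X x (B \ D)], and the mass of a strip is a marginal mass. *)
Let g_split A B C D : measurable A -> measurable B -> measurable C ->
  measurable D -> g (A `*` B) <=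
    g (C `*` D) + fine (alpha (A `\` C)) + fine (beta (B `\` D)).
Proof.
move=> mA mB mC mD.
have mAC : measurable (A `\` C) by exact: measurableD.
have mBD : measurable (B `\` D) by exact: measurableD.
rewrite -(gA mAC) -(gB mBD).
pose F k := match k with 0 => C `*` D | 1 => (A `\` C) `*` setT
  | _ => [set: X] `*` (B `\` D) end.
have := @limit_mass_sub_bigsetU _ _ _ _ U UU g_ F (A `*` B) 3.
rewrite !big_ord_recr !big_ord0/= set0U add0r; apply.
- by case=> [|[|k]]; exact: measurableX.
- exact: measurableX.
- move=> [x y] [/= Ax By]; have [Cx|nCx] := pselect (C x); last by left; right.
  by have [Dy|nDy] := pselect (D y); [left; left|right].
Qed.

Lemma coupling_limit : exists gamma : probability (X * Y)%type R,
  forall A B, measurable A -> measurable B ->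
    fine (g_ i (A `*` B)) @[i --> U] --> fine (gamma (A `*` B)).
Proof.
pose f (Q : set (rect_type X Y)) :=
  if `[< @measurable _ (X * Y)%type Q >] then (g Q)%:E else 0%E.
have fE (Q : set (X * Y)) : measurable Q -> f Q = (g Q)%:E.
  by move=> mQ; rewrite /f asboolT.
have f0 Q : (0 <= f Q)%E.
  by rewrite /f; case: asboolP => // mA; rewrite lee_fin limit_mass_ge0.
have rectM (Q : set (rect_type X Y)) : measurable Q -> @measurable _ (X * Y)%type Q.
  by move=> [A mA [B mB <-]]; exact: measurableX.
have fadd : measure_function.semi_additive f.
  move=> F k mF tF mUF; rewrite fE; last exact: rectM.
  have -> : g (\big[setU/set0]_(i < k) F i) = \sum_(i < k) g (F i).
    by apply: limit_mass_bigsetU => // i; exact: rectM (mF _).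
  rewrite -sumEFin.
  by apply: eq_bigr => i _; rewrite fE//; exact: rectM (mF _).
have fsub : measurable_subset_sigma_subadditive f.
  move=> _ F mF [A mA [B mB <-]] ABF; apply/lee_addgt0Pr => e e0.
  have /choice[A_ /choice[B_ ABE]] k : exists A B,
      [/\ measurable A, measurable B & F k = A `*` B].
    by have [A' mA' [B' mB' ABE]] := mF k; exists A', B'.
  (* Four errors: the passages from A to K and from B to L, and the two series of errors, with terms
     [r k], for the enlargements to [V k] and [W k]. *)
  have e4 : 0 < e / 4 by rewrite divr_gt0.
  have [K [cK KA AK]] := inner_regular alpha mA e4.
  have [L [cL LB BL]] := inner_regular beta mB e4.
  pose r k : R := e / 4 / (2 ^ k.+1)%:R.
  have r0 k : 0 < r k by rewrite divr_gt0// ltr0n expn_gt0.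
  have /choice[V AV] k : exists V, [/\ open V, A_ k `<=` V &
      (alpha (V `\` A_ k) < (r k)%:E)%E].
    by apply: outer_regular => //; have [] := ABE k.
  have /choice[W BW] k : exists W, [/\ open W, B_ k `<=` W &
      (beta (W `\` B_ k) < (r k)%:E)%E].
    by apply: outer_regular => //; have [] := ABE k.
  have mV k : measurable (V k) by apply: open_measurable_rV; have [] := AV k.
  have mW k : measurable (W k) by apply: open_measurable_rV; have [] := BW k.
  have mA_ k : measurable (A_ k) by have [] := ABE k.
  have mB_ k : measurable (B_ k) by have [] := ABE k.
  have mK := compact_measurable_rV cK; have mL := compact_measurable_rV cL.
  have [N KLN] : exists N, K `*` L `<=` \bigcup_(k in `I_N) (V k `*` W k).
    (* A point in the k-th open rectangle lies, with a neighbourhood, in the union of the first N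
       for every N > k; compactness makes one N serve all of [K x L]. The cover being finite, finite
       additivity of the limit suffices. *)
    have := compact_setX cK cL => /compact_near_coveringP.
    move=> /(_ _ \oo (fun N xy => (\bigcup_(k in `I_N) (V k `*` W k)) xy)).
    case=> [[x y] [Kx Ly]|N _ /(_ _ (leqnn N)) h]; last by exists N.
    have [k _] : (\bigcup_k F k) (x, y) by apply: ABF; split; [exact: KA|exact: LB].
    have [_ _ ->] := ABE k => -[/= Ax By].
    have [oV AVk _] := AV k; have [oW BWk _] := BW k.
    exists (V k `*` W k, [set i | (k < i)%N]) => /=.
      split; last by exists k.+1.
      exists (V k, W k) => //=; split; apply: open_nbhs_nbhs; split => //.
        exact: AVk.
      exact: BWk.
    move=> [[a b] i] /= [[Va Wb] ki]; by exists k.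
  have h1 : g (A `*` B) <= g (K `*` L) + e / 4 + e / 4.
    rewrite (le_trans (g_split mA mB mK mL))// lerD//.
      by rewrite lerD2l -lee_fin fineK ?fin_num_measure ?ltW//; exact: measurableD.
    by rewrite -lee_fin fineK ?fin_num_measure ?ltW//; exact: measurableD.
  have h2 : g (K `*` L) <= \sum_(k < N) g (V k `*` W k).
    apply: (@limit_mass_sub_bigsetU _ _ _ _ U UU g_ (fun k => V k `*` W k)) => //.
    - by move=> k; exact: measurableX.
    - exact: measurableX.
    - by move=> xy /KLN; rewrite (bigcup_mkord N (fun k => V k `*` W k)).
  have h3 k : g (V k `*` W k) <= g (F k) + (r k + r k).
    have [_ _ ->] := ABE k.
    rewrite (le_trans (g_split (mV k) (mW k) (mA_ k) (mB_ k)))// -addrA lerD2l.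
    rewrite lerD//.
      rewrite -lee_fin fineK ?fin_num_measure ?ltW//; last exact: measurableD.
      by have [] := AV k.
    rewrite -lee_fin fineK ?fin_num_measure ?ltW//; last exact: measurableD.
    by have [] := BW k.
  have h4 : \sum_(k < N) (r k + r k) <= e / 4 + e / 4.
    rewrite big_split/=.
    have : ((\sum_(k < N) r k)%:E <= (e / 4)%:E)%E.
      rewrite -sumEFin -(big_mkord xpredT (fun k => (r k)%:E)).
      apply: le_trans (epsilon_trick0 xpredT (ltW e4)).
      by apply: nneseries_lim_ge => k _ _; rewrite lee_fin ltW.
    by rewrite lee_fin => h; rewrite lerD.
  have h5 : g (A `*` B) <= \sum_(k < N) g (F k) + e.
    have : \sum_(k < N) g (V k `*` W k) <= \sum_(k < N) (g (F k) + (r k + r k)).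
      by apply: ler_sum => k _; exact: h3.
    rewrite [X in _ <= X]big_split/=; move: h1 h2 h4; lra.
  rewrite fE; last exact: measurableX.
  move: h5; rewrite -lee_fin EFinD => /le_trans; apply; rewrite leeD2r//.
  rewrite -sumEFin -(big_mkord xpredT (fun k => (g (F k))%:E)).
  rewrite (eq_bigr (fun k => f (F k))); last first.
    by move=> k _; rewrite fE//; exact: rectM (mF _).
  exact: nneseries_lim_ge.
have [mr mrE] := measure_of_content f0 fadd fsub.
have [mm mmE] := measure_of_rect mr.
have mT : mm setT = 1%E.
  by rewrite -setXTT mmE// mrE fE ?setXTT// /g limit_massT.
have [P PE] := probability_of_measure mT.
exists P => A B mA mB; have mAB := measurableX mA mB.
by rewrite PE mmE// mrE fE//; exact: limit_mass_cvg.
Qed.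

End coupling_limit.

(** * Lower semicontinuity of the cost *)

Section layer_cake.
Context {R : realType}.
Implicit Types v e : R.

(** A lower sum with step e. The induction also carries the bound e N: a level that counts satisfies
    e (N + 1) < v, so this second bound yields the first. *)
Lemma layers_le v e N : 0 <= v -> 0 <= e ->
  \sum_(0 <= j < N) e * (e * j.+1%:R < v)%R%:R <= v.
Proof.
move=> v0 e0; suff : \sum_(0 <= j < N) e * (e * j.+1%:R < v)%R%:R <= v /\
    \sum_(0 <= j < N) e * (e * j.+1%:R < v)%R%:R <= e * N%:R by case.
elim: N => [|N [IH1 IH2]]; first by rewrite big_geq// mulr0.
rewrite big_nat_recr//=; case: ltP => [/ltW Nv|_].
  rewrite mulr1; have -> : e * N.+1%:R = e * N%:R + e by rewrite -natr1; lra.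
  split; last by rewrite lerD2r.
  by apply: le_trans Nv; rewrite -natr1; lra.
rewrite mulr0 addr0; split => //; rewrite (le_trans IH2)// ler_wpM2l//.
by rewrite ler_nat.
Qed.

Lemma le_layers v e : 0 <= v -> 0 < e -> exists N,
  v <= 2 * e + \sum_(0 <= j < N) e * (e * j.+1%:R < v)%R%:R.
Proof.
move=> v0 e0; have /truncn_itv : 0 <= v / e by rewrite divr_ge0// ltW.
set n := Num.truncn _; rewrite ler_pdivlMr// ltr_pdivrMr// => /andP[nv vn].
(* One level fewer than the integer part of v / e: v may equal e n, where the strict test fails.
   This costs one e, and truncation another. *)
exists n.-1; rewrite (eq_big_nat _ _ (F2 := fun=> e)); last first.
  move=> j /andP[_ jn]; rewrite (_ : _ < v) ?mulr1//.
  apply: lt_le_trans nv; rewrite mulrC ltr_pM2r// ltr_nat.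
  by rewrite -ltn_predRL in jn *.
rewrite sumr_const_nat subn0.
case: n {nv} vn => [|n] /=.
  by rewrite mul1r mulr0n addr0 => /ltW ve; lra.
by rewrite -(natr1 n.+1) -(natr1 n) -[e *+ n]mulr_natr => /ltW; lra.
Qed.

End layer_cake.

Local Open Scope ereal_scope.
Lemma integral_layers d (T : measurableType d) (R : realType)
    (q : {finite_measure set T -> \bar R}) (W : nat -> set T) (e : R) N : (0 <= e)%R ->
  (forall k, measurable (W k)) ->
  \int[q]_z (\sum_(0 <= j < N) (e * \1_(W j) z)%:E) =
  (\sum_(0 <= j < N) e * fine (q (W j)))%:E.
Proof.
move=> e0 mW; rewrite ge0_integral_sum//; last 2 first.
- move=> j; apply/measurable_EFinP; apply: measurable_funM => //.
- by move=> j z _; rewrite lee_fin mulr_ge0.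
rewrite -sumEFin; apply: eq_bigr => j _.
under eq_integral do rewrite EFinM.
rewrite ge0_integralZl//; last exact/measurable_EFinP.
by rewrite integral_indic// setIT EFinM fineK ?fin_num_measure.
Qed.

Local Close Scope ereal_scope.

Section cost_lsc.
Local Open Scope ereal_scope.
Context (R : realType) (m n : nat) (I : Type).
Context (U : set_system I) {UU : ProperFilter U}.
Notation X := 'rV[R]_m.
Notation Y := 'rV[R]_n.
Variables (g_ : I -> probability (X * Y)%type R) (g : probability (X * Y)%type R).
Hypothesis gE : forall A B, measurable A -> measurable B ->
    fine (g_ i (A `*` B)) @[i --> U] --> fine (g (A `*` B)).

(** Inclusion-exclusion for one more rectangle. The overlap is again a union of N rectangles, so the
    induction hypothesis must range over all A and B. *)
Lemma cvg_rect_union (A : nat -> set X) (B : nat -> set Y) N :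
  (forall k, measurable (A k)) -> (forall k, measurable (B k)) ->
  fine (g_ i (\big[setU/set0]_(k < N) (A k `*` B k))) @[i --> U] -->
  fine (g (\big[setU/set0]_(k < N) (A k `*` B k))).
Proof.
elim: N A B => [|N IH] A B mA mB.
  rewrite big_ord0 measure0 (_ : (fun i => _) = cst 0%R); first exact: cvg_cst.
  by apply/funext => i; rewrite measure0.
have mAB k : measurable (A k `*` B k) by exact: measurableX.
have mS : measurable (\big[setU/set0]_(k < N) (A k `*` B k)).
  exact: bigsetU_measurable.
have UE (q : probability (X * Y)%type R) :
    fine (q (\big[setU/set0]_(k < N.+1) (A k `*` B k))) =
    (fine (q (\big[setU/set0]_(k < N) (A k `*` B k))) + fine (q (A N `*` B N)) -
     fine (q (\big[setU/set0]_(k < N) ((A k `&` A N) `*` (B k `&` B N)))))%R.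
  rewrite big_ord_recr/= measureUfinl//; last by rewrite ltey_eq fin_num_measure.
  have -> : \big[setU/set0]_(k < N) ((A k `&` A N) `*` (B k `&` B N)) =
      \big[setU/set0]_(k < N) (A k `*` B k) `&` A N `*` B N.
    by rewrite big_distrl/=; apply: eq_bigr => k _; rewrite setXI.
  rewrite fineB ?fineD ?fin_num_measure//.
    by rewrite fin_numD !fin_num_measure.
  exact: measurableI.
rewrite UE (_ : (fun i => _) = fun i => (
    fine (g_ i (\big[setU/set0]_(k < N) (A k `*` B k))) + fine (g_ i (A N `*` B N)) -
    fine (g_ i (\big[setU/set0]_(k < N) ((A k `&` A N) `*` (B k `&` B N)))))%R).
  apply: cvgB; first by apply: cvgD; [exact: IH|exact: gE].
  by apply: (IH (fun k => A k `&` A N) (fun k => B k `&` B N)) => k;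
    exact: measurableI.
by apply/funext => i; rewrite UE.
Qed.

Lemma open_inner_cvg (O : set (X * Y)) (e : R) : open O -> (0 < e)%R ->
  exists W : set (X * Y),
  [/\ measurable W, W `<=` O, g O <= g W + e%:E &
      fine (g_ i W) @[i --> U] --> fine (g W)].
Proof.
move=> oO e0; have mO := open_measurable_rVX oO.
have [A [B [cA cB OE]]] := open_rectangles oO.
have mA k := compact_measurable_rV (cA k).
have mB k := compact_measurable_rV (cB k).
pose W N := \big[setU/set0]_(k < N) (A k `*` B k).
have mW N : measurable (W N).
  by apply: bigsetU_measurable => k _; exact: measurableX.
have WE N : W N = \bigcup_(k in `I_N) (A k `*` B k).
  by rewrite /W -(bigcup_mkord N (fun k => A k `*` B k)).
have WO N : W N `<=` O by rewrite WE OE => z [k _ ?]; exists k.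
have [N gN] : exists N, g (O `\` W N) < e%:E.
  apply: nondecreasing_small => //.
  - move=> i j ij; rewrite !WE => z [k /= ki ?]; exists k => //=.
    exact: leq_trans ij.
  - by rewrite {1}OE => z [k _ zk]; exists k.+1 => //; rewrite WE; exists k => /=.
exists (W N); split => //; last exact: cvg_rect_union.
rewrite -[X in g X <= _](setDUK (WO N)) measureU//.
- by rewrite leeD2l// ltW.
- exact: measurableD.
- by rewrite setDIK.
Qed.

Variable c : X * Y -> R.
Hypotheses (c0 : forall z, (0 <= c z)%R) (cc : continuous c).

Let mc : measurable_fun setT (EFin \o c).
Proof.
apply/measurable_EFinP; apply: (measurability _ (RGenOpens.measurableE R)).
move=> _ [_ [a [b ->] <-]]; rewrite setTI; apply: open_measurable_rVX.
by apply: open_comp => [z _|]; [exact: cc|exact: interval_open].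
Qed.

Lemma cost_lsc (b : R) :
  (\forall i \near U, \int[g_ i]_z (c z)%:E <= b%:E) ->
  \int[g]_z (c z)%:E <= b%:E.
Proof.
move=> gb; apply/lee_addgt0Pr => e e0.
(* The discretisation of c costs 2 r, and the passage from the layers [O j] to convergent inner
   approximations costs r. *)
pose r := (e / 3)%R; have r0 : (0 < r)%R by rewrite divr_gt0.
pose O j := [set z | (r * j.+1%:R < c z)%R].
have oO j : open (O j).
  rewrite (_ : O j = c @^-1` `](r * j.+1%:R)%R, +oo[%classic).
    by apply: open_comp => [z _|]; [exact: cc|exact: interval_open].
  by apply/seteqP; split => z; rewrite /O /= in_itv/= andbT.
have mO j := open_measurable_rVX (oO j).
have rOE j z : (r * \1_(O j) z = r * (r * j.+1%:R < c z)%R%:R)%R.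
  rewrite indicE; congr (_ * (nat_of_bool _)%:R)%R.
  by apply/idP/idP => [/set_mem//|cz]; apply/mem_set.
have part N : (\sum_(0 <= j < N) r * fine (g (O j)) <= b + r)%R.
  (* Each of N layers of height r loses mass at most 1 / (N + 1), so the total loss stays below r
     uniformly in N. *)
  have rN0 : (0 < (N.+1%:R : R)^-1)%R by rewrite invr_gt0.
  have /choice[W OW] j := open_inner_cvg (oO j) rN0.
  have mW j : measurable (W j) by have [] := OW j.
  have WO j : W j `<=` O j by have [] := OW j.
  have Wb : (\sum_(0 <= j < N) r * fine (g (W j)) <= b)%R.
    apply: (@cvgr_to_le _ U _ _
      (fun i => \sum_(0 <= j < N) r * fine (g_ i (W j)))%R).
      by apply: cvg_sum_nat => j; apply: cvgZr; have [] := OW j.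
    near=> i; rewrite -lee_fin -integral_layers ?(ltW r0)//.
    apply: (@le_trans _ _ (\int[g_ i]_z (c z)%:E)); last by near: i.
    apply: ge0_le_integral => //.
    - by move=> z _; apply: sume_ge0 => j _; rewrite lee_fin mulr_ge0// ltW.
    - apply: emeasurable_sum => j; apply/measurable_EFinP.
      exact: measurable_funM.
    - move=> z _; rewrite sumEFin lee_fin.
      apply: le_trans (layers_le N (c0 z) (ltW r0)).
      apply: ler_sum => j _; rewrite -rOE ler_pM2l// !indicE ler_nat.
      by case: (boolP (z \in W j)) => // /set_mem/WO/mem_set ->.
  have : (\sum_(0 <= j < N) r * fine (g (O j)) <=
      \sum_(0 <= j < N) (r * fine (g (W j)) + r * (N.+1%:R)^-1))%R.
    apply: ler_sum => j _; rewrite -mulrDr ler_pM2l// -lee_fin EFinD.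
    by rewrite !fineK ?fin_num_measure//; have [] := OW j.
  move=> /le_trans; apply; rewrite big_split/= lerD// sumr_const_nat subn0.
  rewrite -[(_ *+ N)%R]mulr_natr -mulrA ler_piMr ?(ltW r0)// mulrC ler_pdivrMr// mul1r.
  by rewrite ler_nat.
apply: (@le_trans _ _ (\int[g]_z ((2 * r)%:E +
    \sum_(0 <= j <oo) (r * \1_(O j) z)%:E))).
  apply: ge0_le_integral => //.
  - by move=> z _; rewrite lee_fin.
  - apply: emeasurable_funD => //; apply: ge0_emeasurable_sum => j.
      by move=> z _ _; rewrite lee_fin mulr_ge0// ltW.
    by move=> _; apply/measurable_EFinP; exact: measurable_funM.
  - move=> z _; have [N cN] := le_layers (c0 z) r0.
    apply: (@le_trans _ _ ((2 * r)%:E + \sum_(0 <= j < N) (r * \1_(O j) z)%:E)).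
      rewrite sumEFin -EFinD lee_fin (le_trans cN)// lerD2l.
      by apply: ler_sum => j _; rewrite rOE.
    rewrite leeD2l//; apply: nneseries_lim_ge => j _ _.
    by rewrite lee_fin mulr_ge0// ltW.
rewrite ge0_integralD//; last 3 first.
- by move=> z _; rewrite lee_fin mulr_ge0// ltW.
- by move=> z _; apply: nneseries_ge0 => j _ _; rewrite lee_fin mulr_ge0// ltW.
- apply: ge0_emeasurable_sum => j.
    by move=> z _ _; rewrite lee_fin mulr_ge0// ltW.
  by move=> _; apply/measurable_EFinP; exact: measurable_funM.
have -> : \int[g]__ (2 * r)%:E = (2 * r)%:E.
  by rewrite integral_cst// [X in _ * X]probability_setT mule1.
rewrite integral_nneseries//; last 2 first.
- by move=> j; apply/measurable_EFinP; exact: measurable_funM.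
- by move=> j z _; rewrite lee_fin mulr_ge0// ltW.
have : \sum_(0 <= j <oo) \int[g]_z (r * \1_(O j) z)%:E <= (b + r)%:E.
  apply: lime_le.
    apply: is_cvg_nneseries => j _ _; apply: integral_ge0 => z _.
    by rewrite lee_fin mulr_ge0// ltW.
  apply: nearW => N; rewrite -ge0_integral_sum//; last 2 first.
  - by move=> j; apply/measurable_EFinP; exact: measurable_funM.
  - by move=> j z _; rewrite lee_fin mulr_ge0// ltW.
  by rewrite integral_layers ?(ltW r0)// lee_fin.
move=> /(leeD2l (2 * r)%:E)/le_trans; apply.
by rewrite -!EFinD lee_fin /r; lra.
Unshelve. all: by end_near. Qed.

End cost_lsc.

(** * Existence *)

Lemma DKL_uniform_dominated d (T : measurableType d) (R : realType) (I : Type)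
    (alpha_ : I -> probability T R) (beta : {finite_measure set T -> \bar R})
    (C : R) : (forall i, DKL (alpha_ i) beta <= C%:E)%E ->
  forall e : R, 0 < e -> exists2 r : R, 0 < r &
    forall i A, measurable A -> (beta A < r%:E)%E -> fine (alpha_ i A) <= e.
Proof.
(* With [beta]-mass below e^(-p), Young's inequality gives p times the mass <= C + 1, and p >= (C +
   1) / e concludes. *)
move=> DC e e0; pose p := Num.max 1 ((C + 1) / e); exists (expR (- p)).
  exact: expR_gt0.
move=> i A mA; rewrite -(@fineK _ (beta A)) ?fin_num_measure// lte_fin => bA.
have p0 : 0 < p by rewrite lt_max ltr01.
have := DKL_young beta (alpha_ i) mA (ltW p0).
move=> /le_trans/(_ (leeD2r ((expR p - 1)%:E * beta A)%E (DC i))).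
move=> h0; have h : p * fine (alpha_ i A) <= C + (expR p - 1) * fine (beta A).
  by rewrite -lee_fin EFinD !EFinM !fineK ?fin_num_measure.
have b0 : 0 <= fine (beta A) by exact: fine_ge0.
have : (expR p - 1) * fine (beta A) <= 1.
  have : expR p * fine (beta A) <= 1.
    by rewrite mulrC -ler_pdivlMr ?expR_gt0// mul1r -expRN ltW.
  by rewrite mulrBl mul1r; lra.
move=> h2; rewrite -(ler_pM2l p0); apply: le_trans h _.
apply: (@le_trans _ _ (C + 1)); first by lra.
by rewrite -ler_pdivrMr// le_max lexx orbT.
Qed.

Section marginals.
Context d1 d2 (T1 : measurableType d1) (T2 : measurableType d2) (R : realType).
Variable gamma : probability (T1 * T2)%type R.

Lemma distribution_fstE A : distribution gamma fst A = gamma (A `*` setT).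
Proof. by congr (gamma _); apply/seteqP; split => -[x y] //= []. Qed.

Lemma distribution_sndE A : distribution gamma snd A = gamma (setT `*` A).
Proof. by congr (gamma _); apply/seteqP; split => -[x y] //= []. Qed.

End marginals.

Section existence.
Local Open Scope ereal_scope.
Context (R : realType) (n : nat).
Notation X := 'rV[R]_n.
Variables (mu nu : probability X R) (c : X -> X -> R) (Lambda : R).
Hypotheses (c0 : forall x y, (0 <= c x y)%R).
Hypotheses (cc : continuous (fun z : X * X => c z.1 z.2)).
Hypothesis (Lambda_gt0 : (0 < Lambda)%R).
Let J := entropy_transport c Lambda mu nu.

Lemma measurable_cost : measurable_fun setT (fun z : X * X => (c z.1 z.2)%:E).
Proof.
apply/measurable_EFinP; apply: (measurability _ (RGenOpens.measurableE R)).
move=> _ [_ [a [b ->] <-]]; rewrite setTI; apply: open_measurable_rVX.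
by apply: open_comp => [z _|]; [exact: cc|exact: interval_open].
Qed.

(** Conditioning q on a compact set of positive mass: the density is a constant times an indicator,
    so its entropy is bounded. *)
Lemma compact_truncation (q : probability X R) :
  exists K : set X, exists a : probability X R,
  [/\ compact K, a (~` K) = 0 & DKL a q < +oo].
Proof.
have [K [cK nK TK]] := @open_sigma_compact R n setT openT.
have mK k := compact_measurable_rV (cK k).
have [k Kk] : exists k, q (setT `\` K k) < 1%:E.
  by apply: nondecreasing_small => //; rewrite -TK.
have qKfin : q (K k) \is a fin_num by exact: fin_num_measure.
pose r := fine (q (K k)).
have r0 : (0 < r)%R.
  rewrite fine_gt0// ltey_eq qKfin andbT lt_neqAle measure_ge0 andbT.
  apply/eqP => q0; move: Kk; rewrite setTD probability_setC// -q0 sube0.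
  by rewrite ltxx.
have ri0 : (0 <= r^-1)%R by rewrite invr_ge0 ltW.
have [a aE] : exists a : probability X R, forall A, a A = (r^-1)%:E * q (A `&` K k).
  pose b : {measure set X -> \bar R} := mscale (NngNum ri0) (mrestr q (mK k)).
  have [a aE] : exists a : probability X R, forall A, a A = b A.
    apply: probability_of_measure; transitivity ((r^-1)%:E * q (setT `&` K k)) => //.
    by rewrite setTI -(fineK qKfin) -EFinM mulVf// gt_eqF.
  by exists a => A; rewrite aE.
exists (K k), a; split => //; first by rewrite aE setICl measure0 mule0.
have mind : measurable_fun [set: X] (\1_(K k) : X -> R) by exact: measurable_indic.
have da : density q a (fun x => r^-1 * \1_(K k) x)%R.
  split => [|x|A mA]; first exact: measurable_funM.
    by rewrite mulr_ge0.
  under eq_integral do rewrite EFinM.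
  rewrite ge0_integralZl//; last first.
    by apply: measurable_funTS; exact/measurable_EFinP.
  by rewrite integral_indic// setIC; exact: aE.
rewrite (DKL_density da); have mF := measurable_entropy_density da.
apply: (@le_lt_trans _ _ (\int[q]_x (entropy_fun r^-1 + 1)%:E)); last first.
  by rewrite integral_cst// [X in _ * X]probability_setT mule1 ltry.
apply: ge0_le_integral => //.
- by move=> x _; rewrite lee_fin entropy_fun_ge0 ?mulr_ge0.
- move=> x _; rewrite lee_fin indicE; case: (x \in K k).
    by rewrite mulr1 lerDl.
  by rewrite mulr0 {1}/entropy_fun mul0r subr0 add0r lerDr entropy_fun_ge0.
Qed.

(** The product of [mu] and [nu] may have infinite cost, as h has no growth bound; the product of
    their compact truncations does not, since a continuous cost is bounded on [K x L]. *)
Lemma entropy_transport_finite : exists gamma, J gamma < +oo.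
Proof.
have [K [a [cK aK Da]]] := compact_truncation mu.
have [L [b [cL bL Db]]] := compact_truncation nu.
have mK := compact_measurable_rV cK; have mL := compact_measurable_rV cL.
have [gamma gE] : exists gamma : probability (X * X)%type R,
    forall A, gamma A = (a \x b) A.
  apply: probability_of_measure; transitivity (a setT * b setT).
    by rewrite -product_measure1E// setXTT.
  by rewrite !probability_setT mule1.
have gX (A B : set X) : measurable A -> measurable B -> gamma (A `*` B) = a A * b B.
  by move=> mA mB; rewrite gE product_measure1E.
have Dfst : DKL (distribution gamma fst) mu < +oo.
  have [g [mg g0 ga]] := DKL_lty_density Da.
  rewrite (_ : DKL _ mu = DKL a mu)// !(@DKL_density _ _ _ _ _ g)//.
  split => // A mA; rewrite -ga//; apply: etrans (distribution_fstE _ _) _.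
  by rewrite gX// probability_setT mule1.
have Dsnd : DKL (distribution gamma snd) nu < +oo.
  have [g [mg g0 gb]] := DKL_lty_density Db.
  rewrite (_ : DKL _ nu = DKL b nu)// !(@DKL_density _ _ _ _ _ g)//.
  split => // A mA; rewrite -gb//; apply: etrans (distribution_sndE _ _) _.
  by rewrite gX// probability_setT mul1e.
exists gamma; rewrite /J /entropy_transport.
apply: lte_add_pinfty; last by rewrite lte_mul_pinfty ?lee_fin// ltW.
apply: lte_add_pinfty; last by rewrite lte_mul_pinfty ?lee_fin// ltW.
have [M cM] : exists M : R, forall z, (K `*` L) z -> (c z.1 z.2 <= M)%R.
  have : compact ((fun z : X * X => c z.1 z.2) @` (K `*` L)).
    apply: continuous_compact; last exact: compact_setX.
    exact: continuous_subspaceT.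
  move=> /compact_bounded[M [_ cM]]; exists (M + 1)%R => z KLz.
  rewrite (le_trans (ler_norm _))//; apply: (cM (M + 1)%R); last by exists z.
  by rewrite ltrDl.
have mKL : measurable (K `*` L) by exact: measurableX.
rewrite (@ge0_negligible_integral _ _ _ gamma _ (~` (K `*` L)))//; last 4 first.
- exact: measurableC.
- exact: measurable_cost.
- by move=> z _; rewrite lee_fin.
- apply/eqP; rewrite eq_le measure_ge0 andbT.
  apply: (@le_trans _ _ (gamma (((~` K) `*` setT) `|` (setT `*` (~` L))))).
    apply: le_measure; rewrite ?inE//.
    - exact: measurableC.
    - by apply: measurableU; apply: measurableX => //; exact: measurableC.
    - move=> [x y] /= /not_andP[nK|nL]; [left|right] => //=.
  rewrite (le_trans (measureU2 _ _ _))//.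
  - by apply: measurableX => //; exact: measurableC.
  - by apply: measurableX => //; exact: measurableC.
  have g1 : gamma (~` K `*` setT) = 0.
    by rewrite gX//; [rewrite aK mul0e|exact: measurableC].
  have g2 : gamma (setT `*` ~` L) = 0.
    by rewrite gX//; [rewrite bL mule0|exact: measurableC].
  by rewrite [X in X + _]g1 [X in _ + X]g2 adde0.
rewrite setTD setCK.
apply: (@le_lt_trans _ _ (\int[gamma]_(z in K `*` L) M%:E)).
  apply: ge0_le_integral => //.
  - by move=> z _; rewrite lee_fin.
  - by apply: measurable_funTS; exact: measurable_cost.
rewrite integral_cst// -[X in _ * X]fineK; first by rewrite -EFinM ltry.
exact: fin_num_measure.
Qed.

Lemma cost_ge0 (gamma : probability (X * X)%type R) : 0 <= \int[gamma]_z (c z.1 z.2)%:E.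
Proof. by apply: integral_ge0 => z _; rewrite lee_fin. Qed.

Lemma entropy_transport_ge0 gamma : 0 <= J gamma.
Proof.
rewrite /J /entropy_transport.
apply: adde_ge0; last by rewrite mule_ge0 ?DKL_ge0// lee_fin ltW.
apply: adde_ge0; last by rewrite mule_ge0 ?DKL_ge0// lee_fin ltW.
exact: cost_ge0.
Qed.

Let I0 := ereal_inf (range J).

Lemma entropy_transport_inf_fin : I0 \is a fin_num.
Proof.
have [g0 Jg0] := entropy_transport_finite.
rewrite ge0_fin_numE; last first.
  by apply: le_ereal_inf_tmp => _ [gamma _ <-]; exact: entropy_transport_ge0.
by apply: le_lt_trans Jg0; apply: ereal_inf_lbound; exists g0.
Qed.

Lemma entropy_transport_parts gamma (C : R) : J gamma <= C%:E ->
  [/\ \int[gamma]_z (c z.1 z.2)%:E <= C%:E,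
      DKL (distribution gamma fst) mu <= (C / Lambda)%:E &
      DKL (distribution gamma snd) nu <= (C / Lambda)%:E].
Proof.
have LL (x : \bar R) : Lambda%:E * x <= C%:E -> x <= (C / Lambda)%:E.
  by rewrite -lee_pdivlMl// -EFinM mulrC.
have a0 := cost_ge0 gamma.
have kL0 : 0 <= Lambda%:E * DKL (distribution gamma fst) mu.
  by rewrite mule_ge0 ?DKL_ge0// lee_fin ltW.
have lL0 : 0 <= Lambda%:E * DKL (distribution gamma snd) nu.
  by rewrite mule_ge0 ?DKL_ge0// lee_fin ltW.
rewrite /J /entropy_transport => JC; split.
- by apply: le_trans JC; rewrite -addeA leeDl// adde_ge0.
- by apply: LL; apply: le_trans JC; rewrite addeAC leeDr// adde_ge0.
- by apply: LL; apply: le_trans JC; rewrite leeDr// adde_ge0.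
Qed.

Lemma optimal_exists : exists gamma, J gamma = I0.
Proof.
have Ifin := entropy_transport_inf_fin.
have /choice[g_ Jg] (i : nat) : exists gamma, J gamma <= I0 + (i.+1%:R^-1)%:E.
  have i0 : (0 < (i.+1%:R^-1 : R))%R by rewrite invr_gt0.
  have [_ [gamma _ <-] /ltW ?] := lb_ereal_inf_adherent i0 Ifin.
  by exists gamma.
have [U [UU oU]] := @ultraFilterLemma _ (nbhs \oo) _.
pose C := (fine I0 + 1)%R.
have JC i : J (g_ i) <= C%:E.
  rewrite (le_trans (Jg i))// EFinD fineK// leeD2l// lee_fin invf_le1//.
  by rewrite ler1n.
have parts i := entropy_transport_parts (JC i).
pose a i := fine (\int[g_ i]_z (c z.1 z.2)%:E).
pose k i := fine (DKL (distribution (g_ i) fst) mu).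
pose l i := fine (DKL (distribution (g_ i) snd) nu).
have aE i : \int[g_ i]_z (c z.1 z.2)%:E = (a i)%:E.
  rewrite fineK// ge0_fin_numE ?cost_ge0//.
  by have [+ _ _] := parts i => /le_lt_trans; apply; exact: ltry.
have kE i : DKL (distribution (g_ i) fst) mu = (k i)%:E.
  rewrite fineK// ge0_fin_numE ?DKL_ge0//.
  by have [_ + _] := parts i => /le_lt_trans; apply; exact: ltry.
have lE i : DKL (distribution (g_ i) snd) nu = (l i)%:E.
  rewrite fineK// ge0_fin_numE ?DKL_ge0//.
  by have [_ _ +] := parts i => /le_lt_trans; apply; exact: ltry.
(* The three terms converge separately along U, so each one is compared with its own limit and no
   lower limit of a sum is needed. *)
have [a' ca] : exists a', a i @[i --> U] --> (a' : R).
  apply: (@ultra_cvg R _ U UU a 0 C) => i.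
  by have [+ _ _] := parts i; rewrite aE lee_fin => ->; rewrite -lee_fin -aE cost_ge0.
have [k' ck] : exists k', k i @[i --> U] --> (k' : R).
  apply: (@ultra_cvg R _ U UU k 0 (C / Lambda)) => i.
  by have [_ + _] := parts i; rewrite kE lee_fin => ->; rewrite -lee_fin -kE DKL_ge0.
have [l' cl] : exists l', l i @[i --> U] --> (l' : R).
  apply: (@ultra_cvg R _ U UU l 0 (C / Lambda)) => i.
  by have [_ _ +] := parts i; rewrite lE lee_fin => ->; rewrite -lee_fin -lE DKL_ge0.
have aklI : (a' + Lambda * k' + Lambda * l' <= fine I0)%R.
  apply/ler_addgt0Pr => e e0.
  have cs : (a i + Lambda * k i + Lambda * l i)%R @[i --> U] -->
      (a' + Lambda * k' + Lambda * l')%R.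
    by apply: cvgD; [apply: cvgD => //; exact: cvgZr|exact: cvgZr].
  apply: (cvgr_to_le cs); apply: oU.
  have [N _ Ne] := near_infty_natSinv_lt (PosNum e0).
  exists N => // i Ni /=; rewrite -lee_fin !EFinD !EFinM -aE -kE -lE fineK//.
  by rewrite (le_trans (Jg i))// leeD2l// lee_fin ltW//; exact: Ne.
have fk i : DKL (distribution (g_ i) fst) mu <= (C / Lambda)%:E by have [] := parts i.
have fl i : DKL (distribution (g_ i) snd) nu <= (C / Lambda)%:E by have [] := parts i.
have [alpha alphaE] := @marginal_limit _ _ _ _ U UU _ _ (DKL_uniform_dominated fk).
have [beta betaE] := @marginal_limit _ _ _ _ U UU _ _ (DKL_uniform_dominated fl).
have alphaE' (A : set X) : measurable A ->
    fine (g_ i (A `*` setT)) @[i --> U] --> fine (alpha A).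
  by move=> mA; under eq_fun do rewrite -distribution_fstE; exact: alphaE.
have betaE' (A : set X) : measurable A ->
    fine (g_ i (setT `*` A)) @[i --> U] --> fine (beta A).
  by move=> mA; under eq_fun do rewrite -distribution_sndE; exact: betaE.
have [gamma gE] := @coupling_limit _ _ _ _ U UU _ _ _ alphaE' betaE'.
have ca' : \int[gamma]_z (c z.1 z.2)%:E <= a'%:E.
  apply/lee_addgt0Pr => e e0; rewrite -EFinD.
  apply: (cost_lsc gE).
  - by move=> z; exact: c0.
  - exact: cc.
  near=> i; rewrite aE lee_fin; near: i.
  by apply: (cvgr_le _ ca); rewrite ltrDl.
have ck' : DKL (distribution gamma fst) mu <= k'%:E.
  apply/lee_addgt0Pr => e e0; rewrite -EFinD.
  apply: (@DKL_lsc _ _ _ _ U _ (fun i => distribution (g_ i) fst)).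
    move=> A mA; have := gE A setT mA measurableT.
    rewrite -distribution_fstE; under eq_fun do rewrite -distribution_fstE.
    exact.
  near=> i; rewrite kE lee_fin; near: i.
  by apply: (cvgr_le _ ck); rewrite ltrDl.
have cl' : DKL (distribution gamma snd) nu <= l'%:E.
  apply/lee_addgt0Pr => e e0; rewrite -EFinD.
  apply: (@DKL_lsc _ _ _ _ U _ (fun i => distribution (g_ i) snd)).
    move=> A mA; have := gE setT A measurableT mA.
    rewrite -distribution_sndE; under eq_fun do rewrite -distribution_sndE.
    exact.
  near=> i; rewrite lE lee_fin; near: i.
  by apply: (cvgr_le _ cl); rewrite ltrDl.
exists gamma; apply/eqP; rewrite eq_le; apply/andP; split; last first.
  by apply: ereal_inf_lbound; exists gamma.
rewrite -(fineK Ifin); move: aklI; rewrite -lee_fin; apply: le_trans.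
rewrite !EFinD !EFinM /J /entropy_transport.
apply: leeD; last by rewrite lee_pmul2l// ?lte_fin.
by apply: leeD => //; rewrite lee_pmul2l// ?lte_fin.
Unshelve. all: by end_near. Qed.

End existence.

(** * Overlap of a set with its small translates *)

Lemma measure_pushforward d1 d2 (T1 : measurableType d1) (T2 : measurableType d2)
    (R : realType) (m : {measure set T1 -> \bar R}) (f : T1 -> T2) :
  measurable_fun setT f ->
  exists p : {measure set T2 -> \bar R}, forall A, p A = m (f @^-1` A).
Proof.
by move=> mf; unshelve (exists (pushforward m f)).
Qed.

Section translation.
Context {R : realType}.

Lemma lebesgue_measure_translation (a : R) (A : set R) : measurable A ->
  lebesgue_measure ((fun x => x + a) @^-1` A) = lebesgue_measure A.
Proof.
move=> mA.
have mf : measurable_fun (setT : set (measurableTypeR R))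
    ((fun x => x + a) : measurableTypeR R -> measurableTypeR R).
  by apply: measurable_funD.
have [p pE] := measure_pushforward (@lebesgue_measure R) mf.
transitivity (p A); first by rewrite pE.
apply/esym; apply: lebesgue_measure_unique => // _ [[x y] _ <-].
rewrite pE (_ : _ @^-1` _ = `]x - a, y - a]%classic).
  rewrite lebesgue_measure_itv [RHS]lebesgue_measure_itv/= !lte_fin ltrD2r.
  by case: ifP => // _; rewrite -!EFinB; congr EFin; lra.
by apply/seteqP; split => z /=; rewrite !in_itv/= ltrBlDr lerBrDr.
Qed.

Lemma translate_cons n (v : 'rV[R]_n.+1) (p : R * 'rV[R]_n) :
  cons_rV p + v = cons_rV (p.1 + (uncons_rV v).1, p.2 + (uncons_rV v).2).
Proof.
rewrite -[X in _ + X](uncons_rVK v); case: p => a w; case: (uncons_rV v) => b u.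
transitivity (row_mx (a%:M + b%:M) (w + u) : 'rV[R]_(1 + n)).
  exact: (@add_row_mx R 1 1 n).
by rewrite /cons_rV/= raddfD.
Qed.

Lemma measurable_translation n (v : 'rV[R]_n) :
  measurable_fun [set: 'rV[R]_n] (fun x => x + v).
Proof.
apply: measurable_fun_rV => i.
under eq_fun do rewrite mxE.
by apply: measurable_funD => //; exact: measurable_coord_rV.
Qed.

(** Induction on the dimension: translation splits into one coordinate and the rest, and uniqueness
    of product measures reduces the claim to measurable rectangles. In dimension 0 every translation
    is the identity. *)
Lemma lebesgue_rV_translation n (v : 'rV[R]_n) (A : set 'rV[R]_n) :
  measurable A ->
  lebesgue_rV n ((fun x => x + v) @^-1` A) = lebesgue_rV n A.
Proof.
elim: n v A => [|n IH] v A mA.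
  congr (lebesgue_rV 0 _); apply/seteqP; split => x /=;
    by rewrite (_ : x + v = x)//; apply/rowP => -[].
have mcA : measurable (@cons_rV R n @^-1` A).
  by rewrite -[X in measurable X]setTI; exact: measurable_cons_rV.
pose tau (p : R * 'rV[R]_n) : R * 'rV[R]_n := (p.1 + (uncons_rV v).1, p.2 + (uncons_rV v).2).
have mtau : measurable_fun setT tau.
  apply: measurable_fun_pair.
    by apply: measurable_funD => //; exact: measurable_fst.
  exact: (measurableT_comp (measurable_translation (uncons_rV v).2)
    (@measurable_snd _ _ _ _)).
pose T := (measurableTypeR R * 'rV[R]_n)%type.
have mtauT : measurable_fun [set: T] (tau : T -> T) by exact: mtau.
have [q qE] := measure_pushforward (@lebesgue_measure R \x lebesgue_rV n)%E mtauT.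
transitivity (q (@cons_rV R n @^-1` A)).
  rewrite qE; congr ((@lebesgue_measure R \x lebesgue_rV n)%E _).
  by apply/seteqP; split => p; rewrite /= translate_cons.
apply/esym; rewrite -[LHS]/((@lebesgue_measure R \x lebesgue_rV n)%E
  (@cons_rV R n @^-1` A)).
apply: product_measure_unique => // B C mB mC.
rewrite qE (_ : tau @^-1` _ = ((fun x => x + (uncons_rV v).1) @^-1` B) `*`
    ((fun x => x + (uncons_rV v).2) @^-1` C))//.
have mB' : measurable ((fun x : R => x + (uncons_rV v).1) @^-1` B).
  by rewrite -[X in measurable X]setTI; exact: measurable_funD.
have mC' : measurable ((fun x => x + (uncons_rV v).2) @^-1` C).
  by rewrite -[X in measurable X]setTI; exact: measurable_translation.
apply: etrans (product_measure1E _ _ _ _) _ => //.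
by congr (_ * _)%E; [exact: lebesgue_measure_translation|exact: IH].
Qed.

Lemma lebesgue_rV_bounded n (M : R) : 0 <= M ->
  (lebesgue_rV n [set x : 'rV[R]_n | (forall i, `|x 0%R i| <= M)%R] < +oo)%E.
Proof.
move=> M0; apply: (@le_lt_trans _ _
    (lebesgue_rV n [set v : 'rV[R]_n | forall i, v 0 i \in `](- (M + 1)), M]])).
  apply: le_measure; rewrite ?inE.
  - rewrite (_ : mkset _ = \bigcap_(i in [set: 'I_n])
      (fun v : 'rV[R]_n => v 0 i) @^-1` `[- M, M]).
      apply: fin_bigcap_measurable => // i _.
      by rewrite -[X in measurable X]setTI; apply: measurable_coord_rV.
    apply/seteqP; split => x /= h i; first by move=> _; rewrite /= in_itv/= -ler_norml.
    by have := h i I; rewrite /= in_itv/= -ler_norml.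
  - rewrite (_ : mkset _ = \bigcap_(i in [set: 'I_n])
      (fun v : 'rV[R]_n => v 0 i) @^-1` `](- (M + 1)), M]).
      apply: fin_bigcap_measurable => // i _.
      by rewrite -[X in measurable X]setTI; apply: measurable_coord_rV.
    by apply/seteqP; split => x /= h i; [move=> _; exact: h|exact: h].
  - move=> x /= xM i; have := xM i; rewrite ler_norml in_itv/= => /andP[h1 ->].
    by rewrite andbT; lra.
by rewrite (@lebesgue_rV_box R n (fun=> - (M + 1)) (fun=> M)) ?ltry// => i; lra.
Qed.

End translation.

Section pigeonhole.
Local Open Scope ereal_scope.

(** If all overlaps were null, the first N sets would have a union of mass at least s N, more than B
    can hold for N large. *)
Lemma measure_pigeonhole d (T : measurableType d) (R : realType)
    (m : {measure set T -> \bar R}) (S : nat -> set T) (B : set T) (s : R) :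
  (forall k, measurable (S k)) -> measurable B -> (forall k, S k `<=` B) ->
  m B < +oo -> (forall k, m (S k) = s%:E) -> (0 < s)%R ->
  exists i j, (i < j)%N /\ 0 < m (S i `&` S j).
Proof.
move=> mS mB SB Boo Ss s0; apply: contrapT => none.
have I0 i j : (i < j)%N -> m (S i `&` S j) = 0.
  move=> ij; apply/eqP; rewrite eq_le measure_ge0 andbT leNgt; apply/negP => h.
  by apply: none; exists i, j.
pose V N := \big[setU/set0]_(k < N) S k.
have mV N : measurable (V N) by exact: bigsetU_measurable.
have VE N : V N = \bigcup_(k in `I_N) S k by rewrite /V bigcup_mkord.
have sV N : (s * N%:R)%:E <= m (V N).
  elim: N => [|N IH]; first by rewrite mulr0.
  have -> : V N.+1 = V N `|` (S N `\` V N).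
    by rewrite /V big_ord_recr/= -/(V N) setDE setUIr setUv setIT.
  rewrite measureU//; last 2 first.
  - exact: measurableD.
  - by rewrite setDIK.
  rewrite -natr1 mulrDr mulr1 EFinD leeD// -[leLHS](Ss N) (measureDI m (mS N) (mV N)).
  suff z : m (S N `&` V N) = 0 by rewrite [X in _ + X]z adde0.
  apply/eqP; rewrite eq_le measure_ge0 andbT.
  apply: (le_trans (@content_subadditive _ _ _ m _ (fun k => S N `&` S k) N _ _ _)).
  - by move=> k _; exact: measurableI.
  - exact: measurableI.
  - move=> x [SNx]; rewrite VE => -[k kN Skx].
    by rewrite -(bigcup_mkord N (fun k => S N `&` S k)); exists k.
  - by rewrite big1// => k _; rewrite setIC; exact: I0.
have VB N : m (V N) <= m B.
  by apply: le_measure; rewrite ?inE// VE => x [k _ /SB].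
have Bfin : m B \is a fin_num by rewrite ge0_fin_numE.
have := le_trans (sV (Num.bound (fine (m B) / s))) (VB _).
rewrite -(fineK Bfin) lee_fin; apply/negP; rewrite -ltNge mulrC -ltr_pdivrMr//.
by rewrite archi_boundP// divr_ge0 ?fine_ge0// ltW.
Qed.

End pigeonhole.

(** * Exchanging mass between two rectangles *)

Lemma finite_restriction d (T : measurableType d) (R : realType)
    (m : {finite_measure set T -> \bar R}) (Q : set T) : measurable Q ->
  exists r : {finite_measure set T -> \bar R}, forall A, r A = m (A `&` Q).
Proof.
move=> mQ; have Qoo : (m Q < +oo)%E by rewrite ltey_eq fin_num_measure.
by exists (mfrestr mQ Qoo).
Qed.

Lemma gt0_integral_eq0_null d (T : measurableType d) (R : realType)
    (m : {measure set T -> \bar R}) (E : set T) (f : T -> R) : measurable E ->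
  measurable_fun E (EFin \o f) -> (forall x, E x -> 0 < f x) ->
  (\int[m]_(x in E) (f x)%:E = 0)%E -> m E = 0%E.
Proof.
move=> mE mf f0 If; have /ae_eq_integral_abs : measurable E by [].
move=> /(_ _ m _ mf)[+ _] => /(_ _)[|N [mN N0 EN]].
  rewrite -[RHS]If; apply: eq_integral => x /set_mem Ex /=.
  by rewrite gtr0_norm// f0.
apply/eqP; rewrite eq_le measure_ge0 andbT -N0; apply: le_measure; rewrite ?inE//.
move=> x Ex; apply: EN => /= /(_ Ex) [fx0].
by have := f0 x Ex; rewrite fx0 ltxx.
Qed.

Section swap.
Local Open Scope ereal_scope.
Context d1 d2 (T1 : measurableType d1) (T2 : measurableType d2) (R : realType).
Variables (gamma : probability (T1 * T2)%type R) (c : T1 * T2 -> R).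
Hypotheses (mc : measurable_fun setT (fun z => (c z)%:E)) (c0 : forall z, (0 <= c z)%R).
Hypothesis c_fin : \int[gamma]_z (c z)%:E < +oo.
Hypothesis c_opt : forall g : probability (T1 * T2)%type R,
  (forall A, measurable A -> g (A `*` setT) = gamma (A `*` setT)) ->
  (forall B, measurable B -> g (setT `*` B) = gamma (setT `*` B)) ->
  \int[gamma]_z (c z)%:E <= \int[g]_z (c z)%:E.
Variables (A0 A1 : set T1) (B0 B1 : set T2).
Hypotheses (mA0 : measurable A0) (mA1 : measurable A1)
  (mB0 : measurable B0) (mB1 : measurable B1).
Hypothesis c_lt : forall x0 y0 x1 y1, A0 x0 -> B0 y0 -> A1 x1 -> B1 y1 ->
  (c (x0, y1) + c (x1, y0) < c (x0, y0) + c (x1, y1))%R.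
Notation Z := (T1 * T2)%type.

(** Every pair drawn from the two rectangles is improved by exchanging targets. Doing so along the
    product of the two restrictions moves mass [p0 * p1] without changing the marginals, so
    optimality forces this product to vanish. *)
Lemma swap_null : gamma (A0 `*` B0) = 0 \/ gamma (A1 `*` B1) = 0.
Proof.
pose Q0 := A0 `*` B0; pose Q1 := A1 `*` B1.
have mQ0 : measurable Q0 by exact: measurableX.
have mQ1 : measurable Q1 by exact: measurableX.
have Q01 : Q0 `&` Q1 = set0.
  apply/seteqP; split => // -[x y] [[/= A0x B0y] [/= A1x B1y]].
  by have := c_lt A0x B0y A1x B1y; rewrite ltxx.
have [r0 r0E] := finite_restriction gamma mQ0.
have [r1 r1E] := finite_restriction gamma mQ1.
have [rr rrE] := finite_restriction gamma (measurableC (measurableU _ _ mQ0 mQ1)).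
pose p0 := fine (gamma Q0); pose p1 := fine (gamma Q1).
have p0E : gamma Q0 = p0%:E by rewrite fineK ?fin_num_measure.
have p1E : gamma Q1 = p1%:E by rewrite fineK ?fin_num_measure.
have r0T : r0 setT = p0%:E by rewrite r0E setTI.
have r1T : r1 setT = p1%:E by rewrite r1E setTI.
have p00 : (0 <= p0)%R by exact: fine_ge0.
have p10 : (0 <= p1)%R by exact: fine_ge0.
have p01 : (0 <= 1 - p0)%R by rewrite subr_ge0 -lee_fin -p0E probability_le1.
have p11 : (0 <= 1 - p1)%R by rewrite subr_ge0 -lee_fin -p1E probability_le1.
have gammaE A : measurable A -> gamma A = rr A + r0 A + r1 A.
  move=> mA; rewrite rrE r0E r1E -addeA -measureU; last 3 first.
  - exact: measurableI.
  - exact: measurableI.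
  - by rewrite setIACA Q01 setI0.
  rewrite -measureU; last 3 first.
  - by apply: measurableI => //; apply: measurableC; exact: measurableU.
  - by apply: measurableU; exact: measurableI.
  - by rewrite -setIUr setIACA setICl setI0.
  by rewrite -!setIUr setUC setUv setIT.
(* [th] couples the restrictions of gamma to Q0 and Q1; [F] and [G] are its images
   under the two exchanges, [P] and [Q] the masses that they replace. *)
pose th := (r0 \x r1)%E.
have thX A B : measurable A -> measurable B -> th (A `*` B) = r0 A * r1 B.
  by move=> mA mB; rewrite /th product_measure1E.
have thT : th setT = (p0 * p1)%:E.
  by rewrite -setXTT thX// r0T r1T.
pose f (u : Z * Z) : Z := (u.1.1, u.2.2); pose g (u : Z * Z) : Z := (u.2.1, u.1.2).
have mf : measurable_fun setT f.
  apply: measurable_fun_pair; first exact: measurableT_comp measurable_fst measurable_fst.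
  exact: measurableT_comp measurable_snd measurable_snd.
have mg : measurable_fun setT g.
  apply: measurable_fun_pair; first exact: measurableT_comp measurable_fst measurable_snd.
  exact: measurableT_comp measurable_snd measurable_fst.
have [F FE] := measure_pushforward th mf.
have [G GE] := measure_pushforward th mg.
have [P PE] := measure_pushforward th (@measurable_fst _ _ Z Z).
have [Q QE] := measure_pushforward th (@measurable_snd _ _ Z Z).
have th_fin A : measurable A -> th A \is a fin_num.
  move=> mA; rewrite ge0_fin_numE//; apply: (@le_lt_trans _ _ (th setT)).
    by apply: le_measure; rewrite ?inE.
  by rewrite thT ltry.
have pre_meas (q : Z * Z -> Z) A : measurable_fun setT q -> measurable A ->
    measurable (q @^-1` A).
  by move=> mq mA; rewrite -[X in measurable X]setTI; exact: mq.
have Ffin A : measurable A -> F A \is a fin_num.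
  by move=> mA; rewrite FE th_fin//; exact: pre_meas.
have Gfin A : measurable A -> G A \is a fin_num.
  by move=> mA; rewrite GE th_fin//; exact: pre_meas.
have PA A : measurable A -> P A = r0 A * p1%:E.
  move=> mA; rewrite -r1T -thX// PE; congr (th _).
  by apply/seteqP; split => -[x y] //= [].
have QA A : measurable A -> Q A = p0%:E * r1 A.
  move=> mA; rewrite -r0T -thX// QE; congr (th _).
  by apply/seteqP; split => -[x y] //= [].
(* As [P] is p1 times [r0] and [Q] is p0 times [r1], the measure [m'] below is gamma - P - Q + F + G
   written with nonnegative weights, so no signed measure occurs. *)
pose m1 : {measure set Z -> \bar R} := mscale (NngNum p11) r0.
pose m2 : {measure set Z -> \bar R} := mscale (NngNum p01) r1.
pose m' : {measure set Z -> \bar R} :=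
  measure_add (measure_add rr (measure_add m1 m2)) (measure_add F G).
have m'E A : m' A = rr A + ((1 - p1)%:E * r0 A + (1 - p0)%:E * r1 A) + (F A + G A).
  apply: etrans (measure_addE _ _ _) _; congr (_ + _); last exact: measure_addE.
  by apply: etrans (measure_addE _ _ _) _; congr (_ + _); exact: measure_addE.
have balance A : measurable A ->
    gamma A + (F A + G A) = m' A + (P A + Q A).
  move=> mA; rewrite m'E gammaE// PA// QA//.
  rewrite -(fineK (Ffin _ mA)) -(fineK (Gfin _ mA)).
  rewrite -(@fineK _ (rr A)) ?fin_num_measure// -(@fineK _ (r0 A)) ?fin_num_measure//.
  rewrite -(@fineK _ (r1 A)) ?fin_num_measure// -!EFinM -!EFinD.
  by congr EFin; lra.
have cancel A : measurable A -> F A + G A = P A + Q A -> m' A = gamma A.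
  move=> mA FG; have FGfin : F A + G A \is a fin_num.
    by rewrite fin_numD Ffin ?Gfin.
  by have := balance A mA; rewrite -FG => /(congr1 (fun u => u - (F A + G A)));
    rewrite !addeK.
(* [F] shares its first marginal with [P] and [G] with [Q]; for the second marginals the partners
   are crossed. *)
have m'X A : measurable A -> m' (A `*` setT) = gamma (A `*` setT).
  move=> mA; apply: cancel; first exact: measurableX.
  by rewrite FE GE PE QE; congr (th _ + th _); apply/seteqP; split => -[].
have m'Y A : measurable A -> m' (setT `*` A) = gamma (setT `*` A).
  move=> mA; apply: cancel; first exact: measurableX.
  rewrite FE GE PE QE addeC; congr (th _ + th _); apply/seteqP; split => -[] //.
have m'T : m' setT = 1 by rewrite -setXTT m'X// setXTT probability_setT.
have [g' g'E] := probability_of_measure m'T.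
have opt : \int[gamma]_z (c z)%:E <= \int[m']_z (c z)%:E.
  have <- : \int[g']_z (c z)%:E = \int[m']_z (c z)%:E.
    by apply: eq_measure_integral => A mA _; exact: g'E.
  apply: c_opt => A mA.
  - by rewrite g'E m'X.
  - by rewrite g'E m'Y.
have I_ge0 (q : {measure set Z -> \bar R}) : 0 <= \int[q]_z (c z)%:E.
  by apply: integral_ge0 => z _; rewrite lee_fin.
(* Stated with sums on both sides, since nothing may be subtracted before finiteness is known. *)
have int_balance : \int[gamma]_z (c z)%:E +
    (\int[F]_z (c z)%:E + \int[G]_z (c z)%:E) =
    \int[m']_z (c z)%:E + (\int[P]_z (c z)%:E + \int[Q]_z (c z)%:E).
  rewrite -!ge0_integral_measure_add//; try by move=> z _; rewrite lee_fin.
  apply: eq_measure_integral => A mA _.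
  apply: etrans (_ : gamma A + (F A + G A) = _).
    by apply: etrans (measure_addE _ _ _) _; congr (_ + _); exact: measure_addE.
  rewrite balance//; apply/esym; apply: etrans (measure_addE _ _ _) _.
  by congr (_ + _); exact: measure_addE.
have push (q : Z * Z -> Z) (M : {measure set Z -> \bar R}) : measurable_fun setT q ->
    (forall A, M A = th (q @^-1` A)) ->
    \int[M]_z (c z)%:E = \int[th]_u (c (q u))%:E.
  move=> mq ME; transitivity (\int[pushforward th q]_z (c z)%:E).
    by apply: eq_measure_integral => A mA _; exact: ME.
  by rewrite ge0_integral_pushforward// => z _; rewrite lee_fin.
pose E := Q0 `*` Q1; have mE : measurable E by exact: measurableX.
have thCE : th (~` E) = 0.
  have th1 : th (~` Q0 `*` setT) = 0.
    by rewrite thX//; [rewrite r0E setICl measure0 mul0e|exact: measurableC].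
  have th2 : th (setT `*` ~` Q1) = 0.
    by rewrite thX//; [rewrite r1E setICl measure0 mule0|exact: measurableC].
  apply/eqP; rewrite eq_le measure_ge0 andbT.
  apply: (@le_trans _ _ (th ((~` Q0 `*` setT) `|` (setT `*` ~` Q1)))).
    apply: le_measure; rewrite ?inE; first exact: measurableC.
      by apply: measurableU; apply: measurableX => //; exact: measurableC.
    by move=> u /not_andP[nQ|nQ]; [left|right].
  rewrite (le_trans (measureU2 _ _ _))//.
  - by apply: measurableX => //; exact: measurableC.
  - by apply: measurableX => //; exact: measurableC.
  by rewrite [X in X + _]th1 [X in _ + X]th2 adde0.
have mcq (q : Z * Z -> Z) : measurable_fun setT q ->
    measurable_fun setT (fun u => (c (q u))%:E).
  by move=> mq; exact: measurableT_comp mc mq.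
have mfst := @measurable_fst _ _ Z Z; have msnd := @measurable_snd _ _ Z Z.
have onE (q : Z * Z -> Z) : measurable_fun setT q ->
    \int[th]_u (c (q u))%:E = \int[th]_(u in E) (c (q u))%:E.
  move=> mq; rewrite (@ge0_negligible_integral _ _ _ th _ (~` E))//.
  - by rewrite setTD setCK.
  - exact: measurableC.
  - exact: mcq.
  - by move=> u _; rewrite lee_fin.
pose H1 u := (c (f u) + c (g u))%R; pose H2 (u : Z * Z) := (c u.1 + c u.2)%R.
have aE : \int[F]_z (c z)%:E + \int[G]_z (c z)%:E = \int[th]_(u in E) (H1 u)%:E.
  rewrite (push f F mf FE) (push g G mg GE) !onE// -ge0_integralD//.
  - by move=> u _; rewrite lee_fin.
  - by apply: measurable_funTS; exact: mcq.
  - by move=> u _; rewrite lee_fin.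
  - by apply: measurable_funTS; exact: mcq.
have bE : \int[P]_z (c z)%:E + \int[Q]_z (c z)%:E = \int[th]_(u in E) (H2 u)%:E.
  rewrite (push fst P mfst PE) (push snd Q msnd QE) !onE// -ge0_integralD//.
  - by move=> u _; rewrite lee_fin.
  - by apply: measurable_funTS; exact: mcq.
  - by move=> u _; rewrite lee_fin.
  - by apply: measurable_funTS; exact: mcq.
have bfin : \int[P]_z (c z)%:E + \int[Q]_z (c z)%:E < +oo.
  have gI : \int[gamma]_z (c z)%:E = \int[rr]_z (c z)%:E +
      \int[r0]_z (c z)%:E + \int[r1]_z (c z)%:E.
    rewrite -!ge0_integral_measure_add//; try by move=> z _; rewrite lee_fin.
    apply: eq_measure_integral => A mA _; apply: etrans (gammaE _ mA) _.
    apply/esym; apply: etrans (measure_addE _ _ _) _; congr (_ + _).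
    exact: measure_addE.
  have PI : \int[P]_z (c z)%:E = p1%:E * \int[r0]_z (c z)%:E.
    rewrite -[p1]/(NngNum p10)%:num -ge0_integral_mscale//; last first.
      by move=> z _; rewrite lee_fin.
    by apply: eq_measure_integral => A mA _; apply: etrans (PA _ mA) _; rewrite muleC.
  have QI : \int[Q]_z (c z)%:E = p0%:E * \int[r1]_z (c z)%:E.
    rewrite -[p0]/(NngNum p00)%:num -ge0_integral_mscale//; last first.
      by move=> z _; rewrite lee_fin.
    by apply: eq_measure_integral => A mA _; exact: QA.
  move: c_fin; rewrite gI => gfin; rewrite PI QI.
  have I0 : \int[r0]_z (c z)%:E < +oo.
    apply: le_lt_trans gfin; rewrite -addeA addeCA leeDl// adde_ge0//; exact: I_ge0.
  have I1 : \int[r1]_z (c z)%:E < +oo.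
    apply: le_lt_trans gfin; rewrite leeDr// adde_ge0//; exact: I_ge0.
  by apply: lte_add_pinfty; apply: lte_mul_pinfty => //; rewrite ?lee_fin.
pose D u := (H2 u - H1 u)%R.
have D0 u : E u -> (0 < D u)%R.
  move: u => [[x0 y0] [x1 y1]] [[/= A0x B0y] [/= A1x B1y]].
  by rewrite /D /H1 /H2 /f /g/= subr_gt0; exact: c_lt.
have mH1 : measurable_fun E (EFin \o H1).
  apply: measurable_funTS; apply/measurable_EFinP; apply: measurable_funD;
    by apply/measurable_EFinP; exact: mcq.
have mD : measurable_fun E (EFin \o D).
  apply: measurable_funTS; apply/measurable_EFinP; apply: measurable_funB;
    by apply: measurable_funD; apply/measurable_EFinP; exact: mcq.
have H10 u : E u -> 0 <= (H1 u)%:E by move=> _; rewrite lee_fin addr_ge0.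
have D_ge0 u : E u -> 0 <= (D u)%:E by move=> Eu; rewrite lee_fin ltW// D0.
have ba : \int[th]_(u in E) (H2 u)%:E =
    \int[th]_(u in E) (H1 u)%:E + \int[th]_(u in E) (D u)%:E.
  rewrite -ge0_integralD//; apply: eq_integral => u _.
  by rewrite -EFinD /D addrC subrK.
have ID0 : \int[th]_(u in E) (D u)%:E = 0.
  move: int_balance bfin; rewrite aE bE ba => int_balance bfin.
  have ID_ge0 : 0 <= \int[th]_(u in E) (D u)%:E by exact: integral_ge0.
  have IH_ge0 : 0 <= \int[th]_(u in E) (H1 u)%:E by exact: integral_ge0.
  have IHfin : \int[th]_(u in E) (H1 u)%:E \is a fin_num.
    by rewrite ge0_fin_numE// (le_lt_trans _ bfin)// leeDl.
  have Igfin : \int[gamma]_z (c z)%:E \is a fin_num by rewrite ge0_fin_numE.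
  apply/eqP; rewrite eq_le ID_ge0 andbT -(leeD2lE _ _ IHfin) adde0.
  by rewrite -(leeD2lE _ _ Igfin) int_balance leeD2r.
have : th E = 0 by apply: (gt0_integral_eq0_null mE mD D0 ID0).
rewrite thX//.
have -> : r0 Q0 = p0%:E by rewrite r0E setIid; exact: p0E.
have -> : r1 Q1 = p1%:E by rewrite r1E setIid; exact: p1E.
rewrite -EFinM => -[] /eqP; rewrite mulf_eq0 => /orP[] /eqP p_0; [left|right].
- exact: etrans p0E (congr1 EFin p_0).
- exact: etrans p1E (congr1 EFin p_0).
Qed.

End swap.

Section overlap.
Context {R : realType} {n : nat}.
Implicit Types (x v : 'rV[R]_n) (S : set 'rV[R]_n).

Lemma ler_rV_norm v i : `|v 0 i| <= `|v|.
Proof.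
rewrite [leRHS]/Num.norm /= mx_normrE; apply/bigmax_geP; right => /=.
by exists (0, i).
Qed.

Lemma translation_overlap S v (M : R) : measurable S -> 0 <= M ->
  (forall x, S x -> `|x| <= M) -> (0 < lebesgue_rV n S)%E ->
  exists t : R, 0 < t <= 2^-1 /\
    (0 < lebesgue_rV n (S `&` (fun x => (x - t *: v)%R) @^-1` S))%E.
Proof.
move=> mS M0 SM S0; pose s (k : nat) : R := k.+2%:R^-1.
(* The translates of S by s k *: v have the same measure and stay in a bounded
   set, so two of them overlap. *)
have s0 k : 0 < s k by rewrite invr_gt0.
have s2 k : s k <= 2^-1 by rewrite /s lef_pV2 ?posrE// ler_nat.
pose Sk k := (fun x => x + (- (s k *: v))) @^-1` S.
have mSk k : measurable (Sk k).
  by rewrite -[X in measurable X]setTI; exact: measurable_translation.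
pose M' := M + `|v|; have M'0 : 0 <= M' by exact: addr_ge0.
pose B := [set x : 'rV[R]_n | (forall i, `|x 0 i| <= M')].
have SkB k : Sk k `<=` B.
  move=> x /SM xM i; rewrite (le_trans (ler_rV_norm _ _))//.
  rewrite -[x](subrK (s k *: v)) (le_trans (ler_normD _ _))// lerD//.
  rewrite normrZ gtr0_norm// ler_piMl// (le_trans (s2 k))//; lra.
have mB : measurable B.
  rewrite (_ : B = \bigcap_(i in [set: 'I_n])
      (fun v : 'rV[R]_n => v 0 i) @^-1` `[- M', M']).
    apply: fin_bigcap_measurable => // i _.
    by rewrite -[X in measurable X]setTI; apply: measurable_coord_rV.
  apply/seteqP; split => x /= h i; first by move=> _; rewrite /= in_itv/= -ler_norml.
  by have := h i I; rewrite /= in_itv/= -ler_norml.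
have Boo := lebesgue_rV_bounded n M'0.
have SkE k : lebesgue_rV n (Sk k) = lebesgue_rV n S.
  exact: lebesgue_rV_translation.
have Sfin : lebesgue_rV n S \is a fin_num.
  rewrite ge0_fin_numE// -(SkE 0%N) (le_lt_trans _ Boo)//.
  by apply: le_measure; rewrite ?inE.
have SkE' k : lebesgue_rV n (Sk k) = (fine (lebesgue_rV n S))%:E.
  by rewrite SkE fineK.
have Sf0 : 0 < fine (lebesgue_rV n S) by rewrite -lte_fin fineK.
have [i [j [ij pos]]] := measure_pigeonhole mSk mB SkB Boo SkE' Sf0.
exists (s i - s j); split.
  apply/andP; split; last by rewrite (le_trans _ (s2 i))// gerBl ltW.
  by rewrite subr_gt0 /s ltf_pV2 ?posrE// ltr_nat.
(* Moving the overlap of the i-th and j-th translates back by [s j *: v] makes it an overlap of S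
   with its translate by [(s i - s j) *: v]; positivity comes from i < j. *)
rewrite -(lebesgue_rV_translation (- (s j *: v))); last first.
  apply: measurableI => //; rewrite -[X in measurable X]setTI.
  exact: (measurable_translation (- ((s i - s j) *: v))).
apply: lt_le_trans pos _; apply: le_measure; rewrite ?inE.
- exact: measurableI.
- rewrite -[X in measurable X]setTI; apply: measurable_translation => //.
  apply: measurableI => //; rewrite -[X in measurable X]setTI.
  exact: (measurable_translation (- ((s i - s j) *: v))).
- move=> x [Sx Sy]; split => //=.
  rewrite (_ : _ - _ = x - s i *: v)//.
  by rewrite scalerBl opprB addrA subrK.
Qed.

End overlap.

Section cover.
Context {R : realType} {n : nat}.

(** Cubes of a fixed size, possibly overlapping: a countable cover is enough for detecting null
    sets. *)
Definition grid (k j : nat) : set 'rV[R]_n :=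
  if unpickle j is Some q then rat_cube (q, k) else set0.

Lemma grid_cover k : \bigcup_j grid k j = setT.
Proof.
apply/seteqP; split => // v _; pose r : R := k.+1%:R^-1.
have r0 : 0 < r by rewrite invr_gt0.
have /choice[q qv] i : exists q : rat, `|ratr q - v 0 i| <= r.
  have /rat_in_itvoo[q] : v 0 i - r < v 0 i + r.
    by rewrite ltrBlDr -addrA ltrDl addr_gt0.
  by rewrite in_itv/= => vq; exists q; rewrite ltW// ltr_distl.
exists (pickle (\row_i q i)) => //; rewrite /grid pickleK => i /=.
by rewrite mxE; exact: qv.
Qed.

Lemma measurable_grid k j : measurable (grid k j).
Proof.
rewrite /grid; case: unpickle => // q.
by apply: compact_measurable_rV; exact: compact_rat_cube.
Qed.

Lemma grid_dist k j x z e : grid k j x -> grid k j z ->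
  2 * k.+1%:R^-1 < e -> `|x - z| < e.
Proof.
rewrite /grid; case: unpickle => // q qx qz ke.
have e0 : 0 < e by rewrite (le_lt_trans _ ke)// mulr_ge0.
suff : ball x e z by rewrite mx_norm_ball.
split=> // i l; rewrite ord1 /ball/=.
rewrite (le_lt_trans (ler_distD (ratr (q 0 l)) _ _))//.
have /= h1 := qx l; have /= h2 := qz l; rewrite distrC in h1.
by apply: le_lt_trans (lerD h1 h2) _; rewrite -mulr2n -[_ *+ 2]mulr_natl.
Qed.

End cover.

Lemma null_of_cover d (T : measurableType d) (R : realType)
    (m : {measure set T -> \bar R}) (A : set T) (C : nat -> set T) :
  measurable A -> (forall k, measurable (C k)) -> A `<=` \bigcup_k C k ->
  (forall k, m (A `&` C k) = 0%E) -> m A = 0%E.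
Proof.
move=> mA mC AC AC0; apply/eqP; rewrite eq_le measure_ge0 andbT.
apply: (@le_trans _ _ (\sum_(k <oo) m (A `&` C k))%E).
  apply: measure_sigma_subadditive => //.
  - by move=> k; exact: measurableI.
  - by move=> x Ax; have [k _ Ckx] := AC x Ax; exists k.
by rewrite eseries0// => k _ _; exact: AC0.
Qed.

(** * The gain of an exchange, uniformly in the step *)

Section gap.
Context {R : realType} {n : nat}.
Variable h : 'rV[R]_n -> R.
Hypothesis hconv : strictly_convex h.
Implicit Types a b w : 'rV[R]_n.

Lemma convex_secant a w t : 0 <= t <= 2^-1 ->
  h (a - t *: w) <= (1 - 2 * t) * h a + 2 * t * h (a - 2^-1 *: w).
Proof.
move=> /andP[t0 t2]; have := strictly_convexW hconv (a - 2^-1 *: w) a (t := 2 * t).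
rewrite (_ : _ *: _ + _ = a - t *: w); last by apply/rowP => i; rewrite !mxE; lra.
by move=> /(_ _)/le_trans; apply; [apply/andP; split; lra|lra].
Qed.

(** For t <= 1/2 the new points lie on the segments towards those for t = 1/2, so convexity keeps at
    least the fraction 2 t of the gain. *)
Lemma gap_exchange a b w t : 0 < t <= 2^-1 ->
  h (a - 2^-1 *: w) + h (b + 2^-1 *: w) < h a + h b ->
  h (a - t *: w) + h (b + t *: w) < h a + h b.
Proof.
move=> /andP[t0 t2] gap; have t02 : 0 <= t <= 2^-1 by rewrite ltW.
have := convex_secant a w t02; have := convex_secant b (- w) t02.
by rewrite !scalerN !opprK; move: gap t0; nra.
Qed.

Lemma gap_nbhd a0 b0 : a0 != b0 -> exists2 e : R, 0 < e & forall a b w,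
  `|a - a0| < e -> `|b - b0| < e -> `|w - (a0 - b0)| < e ->
  h (a - 2^-1 *: w) + h (b + 2^-1 *: w) < h a + h b.
Proof.
move=> ab; pose m0 := 2^-1 *: a0 + (1 - 2^-1) *: b0.
have gap : h m0 < 2^-1 * h a0 + (1 - 2^-1) * h b0.
  by apply: hconv => //; apply/andP; split; lra.
(* Twice the convexity gap is 4 r, and four values of h are each perturbed by less than r. *)
pose r := (2^-1 * h a0 + (1 - 2^-1) * h b0 - h m0) / 2.
have r0 : 0 < r by rewrite divr_gt0// subr_gt0.
have hc x : exists2 e, 0 < e & forall y, `|y - x| < e -> `|h y - h x| < r.
  have /(@cvgrPdist_lt _ _ _ (nbhs x))/(_ _ r0) := strictly_convex_continuous hconv (x := x).
  move=> /(@nbhs_ballP R)[e /= e0 xe]; exists e => // y yx.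
  by rewrite distrC; apply: xe; rewrite mx_norm_ball /ball_/= distrC.
have [ea ea0 ha] := hc a0; have [eb eb0 hb] := hc b0; have [em em0 hm] := hc m0.
pose e := Num.min (Num.min ea eb) (em / 2).
exists e; first by rewrite !lt_min ea0 eb0 divr_gt0.
move=> a b w; rewrite !lt_min => /andP[/andP[aa _] am] /andP[/andP[_ bb] bm].
move=> /andP[_ wm].
have m1 : a - 2^-1 *: w - m0 = (a - a0) - 2^-1 *: (w - (a0 - b0)).
  by apply/rowP => i; rewrite /m0 !mxE; lra.
have m2 : b + 2^-1 *: w - m0 = (b - b0) + 2^-1 *: (w - (a0 - b0)).
  by apply/rowP => i; rewrite /m0 !mxE; lra.
have w2 : `|2^-1 *: (w - (a0 - b0))| < em / 2.
  rewrite normrZ gtr0_norm//; move: wm (normr_ge0 (w - (a0 - b0))); lra.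
have h1 := ha _ aa; have h2 := hb _ bb.
have /hm h3 : `|a - 2^-1 *: w - m0| < em.
  by rewrite m1 (le_lt_trans (ler_normB _ _))//; lra.
have /hm h4 : `|b + 2^-1 *: w - m0| < em.
  by rewrite m2 (le_lt_trans (ler_normD _ _))//; lra.
move: h1 h2 h3 h4; rewrite !ltr_norml /r => /andP[? ?] /andP[? ?] /andP[? ?] /andP[? ?].
lra.
Qed.

End gap.

(** * Optimal couplings are carried by graphs *)

Lemma finite_of_measure d (T : measurableType d) (R : realType)
    (m : {measure set T -> \bar R}) : (m setT < +oo)%E ->
  exists r : {finite_measure set T -> \bar R}, forall A, r A = m A.
Proof.
move=> moo; exists (mfrestr measurableT moo) => A.
exact: (congr1 m (setIT A)).
Qed.

(** D is the set where the density does not vanish; there m and l have the same null sets, so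
    positive l-mass becomes positive m-mass. *)
Lemma dominated_carrier d (T : measurableType d) (R : realType)
    (l : {sigma_finite_measure set T -> \bar R})
    (m : {finite_measure set T -> \bar R}) :
  (forall A, measurable A -> l A = 0%E -> m A = 0%E) ->
  exists D, [/\ measurable D, m (~` D) = 0%E & forall A, measurable A ->
    A `<=` D -> m A = 0%E -> l A = 0%E].
Proof.
move=> ml; have /density_ex[f [mf f0 fE]] : m `<< l by exact/null_content_dominatesP.
pose D := ~` (f @^-1` [set 0]).
have mD : measurable D.
  by apply: measurableC; rewrite -[X in measurable X]setTI; exact: mf.
exists D; split => // [|A mA AD].
  rewrite fE; last exact: measurableC.
  by apply: integral0_eq => x; rewrite /D setCK => ->.
rewrite fE// => If; apply: gt0_integral_eq0_null If => //.
  by apply: measurable_funTS; exact/measurable_EFinP.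
by move=> x /AD /eqP fx; rewrite lt_neqAle eq_sym fx f0.
Qed.

Section mutual_singularity.
Local Open Scope ereal_scope.
Context d1 d2 (T1 : measurableType d1) (T2 : measurableType d2) (R : realType).
Variable gamma : {measure set (T1 * T2)%type -> \bar R}.
Implicit Types (A : set T1) (P Q : set T2).

(* The part of gamma over A that lands in P and the one that lands in Q have
   mutually singular first marginals. *)
Definition separated A P Q := exists2 N, measurable N &
  gamma ((A `&` N) `*` P) = 0 /\ gamma ((A `\` N) `*` Q) = 0.

Let gamma_sub (X Y : set (T1 * T2)) : measurable X -> measurable Y ->
  X `<=` Y -> gamma Y = 0 -> gamma X = 0.
Proof.
move=> mX mY XY Y0; apply/eqP; rewrite eq_le measure_ge0 andbT -Y0.
by apply: le_measure; rewrite ?inE.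
Qed.

Let gamma_cover (X : set (T1 * T2)) (Y : nat -> set (T1 * T2)) : measurable X ->
  (forall k, measurable (Y k)) -> X `<=` \bigcup_k Y k ->
  (forall k, gamma (Y k) = 0) -> gamma X = 0.
Proof.
move=> mX mY XY Y0; apply: (null_of_cover mX mY XY) => k.
by apply: gamma_sub (Y0 k); [exact: measurableI|exact: mY|exact: subIsetr].
Qed.

Lemma separatedC A P Q : measurable A -> separated A P Q -> separated A Q P.
Proof.
move=> mA [N mN [NP NQ]]; exists (~` N); first exact: measurableC.
by rewrite setDE setCK -setDE.
Qed.

Lemma separatedS A P Q A' P' Q' : measurable A -> measurable P -> measurable Q ->
  measurable A' -> measurable P' -> measurable Q' ->
  A' `<=` A -> P' `<=` P -> Q' `<=` Q -> separated A P Q -> separated A' P' Q'.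
Proof.
move=> mA mP mQ mA' mP' mQ' AA PP QQ [N mN [NP NQ]]; exists N => //; split.
  apply: gamma_sub NP.
  - by apply: measurableX => //; exact: measurableI.
  - by apply: measurableX => //; exact: measurableI.
  - by move=> [x y] [[/= /AA Ax Nx] /PP Py].
apply: gamma_sub NQ.
- by apply: measurableX => //; exact: measurableD.
- by apply: measurableX => //; exact: measurableD.
- by move=> [x y] [[/= /AA Ax Nx] /QQ Py].
Qed.

Lemma separated0A P Q : separated set0 P Q.
Proof. by exists setT => //; rewrite set0I set0D !set0X measure0. Qed.

Lemma separated0l A Q : separated A set0 Q.
Proof. by exists setT => //; rewrite setX0 setDT set0X measure0. Qed.

Lemma separated_bigcupA (A : nat -> set T1) P Q : (forall k, measurable (A k)) ->
  measurable P -> measurable Q ->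
  (forall k, separated (A k) P Q) -> separated (\bigcup_k A k) P Q.
Proof.
move=> mA mP mQ sA; have /choice[N NE] k : exists N, measurable N /\
    (gamma ((A k `&` N) `*` P) = 0 /\ gamma ((A k `\` N) `*` Q) = 0).
  by have [N mN ?] := sA k; exists N.
have mN k : measurable (N k) by have [] := NE k.
have mNA : measurable (\bigcup_k (A k `&` N k)).
  by apply: bigcupT_measurable => k; exact: measurableI.
have mAA : measurable (\bigcup_k A k) by exact: bigcupT_measurable.
(* Each [N k] is cut down to [A k], outside of which it carries no information. *)
exists (\bigcup_k (A k `&` N k)) => //; split.
  apply: (@gamma_cover _ (fun k => (A k `&` N k) `*` P)).
  - by apply: measurableX => //; exact: measurableI.
  - by move=> k; apply: measurableX => //; exact: measurableI.
  - by move=> [x y] [[/= _ [k _ ANx]] Py]; exists k.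
  - by move=> k; have [_ []] := NE k.
apply: (@gamma_cover _ (fun k => (A k `\` N k) `*` Q)).
- by apply: measurableX => //; exact: measurableD.
- by move=> k; apply: measurableX => //; exact: measurableD.
- move=> [x y] [[/= [k _ Akx] nN] Qy]; exists k => //; split => //; split => // Nx.
  by apply: nN; exists k.
- by move=> k; have [_ []] := NE k.
Qed.

Lemma separated_bigcupl A (P : nat -> set T2) Q : measurable A ->
  (forall k, measurable (P k)) -> measurable Q ->
  (forall k, separated A (P k) Q) -> separated A (\bigcup_k P k) Q.
Proof.
move=> mA mP mQ sA; have /choice[N NE] k : exists N, measurable N /\
    (gamma ((A `&` N) `*` P k) = 0 /\ gamma ((A `\` N) `*` Q) = 0).
  by have [N mN ?] := sA k; exists N.
have mN k : measurable (N k) by have [] := NE k.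
have mNA : measurable (\bigcap_k N k) by exact: bigcapT_measurable.
have mPP : measurable (\bigcup_k P k) by exact: bigcupT_measurable.
(* Over the intersection every [P k] is null; a point outside it misses some [N k], which alone
   makes Q null. *)
exists (\bigcap_k N k) => //; split.
  apply: (@gamma_cover _ (fun k => (A `&` N k) `*` P k)).
  - by apply: measurableX => //; exact: measurableI.
  - by move=> k; apply: measurableX => //; exact: measurableI.
  - by move=> [x y] [[/= Ax Nx] [k _ Py]]; exists k => //; split => //; split => //; exact: Nx.
  - by move=> k; have [_ []] := NE k.
apply: (@gamma_cover _ (fun k => (A `\` N k) `*` Q)).
- by apply: measurableX => //; exact: measurableD.
- by move=> k; apply: measurableX => //; exact: measurableD.
- move=> [x y] [[/= Ax nN] Qy]; apply: contrapT => none; apply: nN => k _.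
  by apply: contrapT => nNx; apply: none; exists k.
- by move=> k; have [_ []] := NE k.
Qed.

Lemma separated_bigcupr A P (Q : nat -> set T2) : measurable A ->
  measurable P -> (forall k, measurable (Q k)) ->
  (forall k, separated A P (Q k)) -> separated A P (\bigcup_k Q k).
Proof.
move=> mA mP mQ sA; apply: separatedC => //; apply: separated_bigcupl => // k.
exact: separatedC.
Qed.

End mutual_singularity.

Section graph.
Local Open Scope ereal_scope.
Context (R : realType) (n : nat).
Notation X := 'rV[R]_n.
Variables (gamma : probability (X * X)%type R) (h : X -> R).
Hypotheses (h0 : forall x, (0 <= h x)%R) (hconv : strictly_convex h).
Hypothesis gamma_ac : forall A, measurable A -> lebesgue_rV n A = 0 ->
  gamma (A `*` setT) = 0.
Hypothesis c_fin : \int[gamma]_z (h (z.1 - z.2))%:E < +oo.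
Hypothesis c_opt : forall g : probability (X * X)%type R,
  (forall A, measurable A -> g (A `*` setT) = gamma (A `*` setT)) ->
  (forall B, measurable B -> g (setT `*` B) = gamma (setT `*` B)) ->
  \int[gamma]_z (h (z.1 - z.2))%:E <= \int[g]_z (h (z.1 - z.2))%:E.

Lemma continuous_diff_cost : continuous (fun z : X * X => h (z.1 - z.2)).
Proof.
move=> z; apply: (@continuous_comp _ _ _ (fun z : X * X => z.1 - z.2)%R h).
  by apply: continuousB; [exact: cvg_fst|exact: cvg_snd].
exact: strictly_convex_continuous.
Qed.

Let mc : measurable_fun setT (fun z : X * X => (h (z.1 - z.2))%:E).
Proof. exact: (@measurable_cost R n (fun x y => h (x - y)) continuous_diff_cost). Qed.

Let mball (x : X) (r : R) : measurable (ball x r).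
Proof. by apply: open_measurable_rV; exact: ball_open. Qed.

Let fiber_measure A P : measurable A -> measurable P ->
  exists m : {finite_measure set X -> \bar R}, forall B, measurable B ->
    m B = gamma ((B `&` A) `*` P).
Proof.
move=> mA mP; have mAP : measurable (A `*` P) by exact: measurableX.
have [r rE] := finite_restriction gamma mAP.
have [p pE] := measure_pushforward r (@measurable_fst _ _ X X).
have pT : p setT < +oo by rewrite pE preimage_setT -ge0_fin_numE// fin_num_measure.
have [m mE] := finite_of_measure pT; exists m => B mB.
apply: etrans (mE B) _; apply: etrans (pE B) _; apply: etrans (rE _) _.
congr (gamma _).
by apply/seteqP; split => -[x y] /= => [[Bx [Ax Py]]|[[Bx Ax] Py]].
Qed.

(** If the first marginals of the masses sent to the two balls have carriers with Lebesgue-null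
    intersection, a carrier separates them. Otherwise that intersection overlaps a translate of
    itself, and an exchange between the overlap and its translate contradicts [swap_null]. *)
Lemma separated_local (x0 y0 y1 : X) : y0 != y1 -> exists2 r : R, (0 < r)%R &
  separated gamma (ball x0 r) (ball y0 r) (ball y1 r).
Proof.
move=> y01.
have ab : (x0 - y0 != x0 - y1)%R.
  by apply: contra y01 => /eqP/addrI/oppr_inj ->.
have [e e0 gap] := gap_nbhd hconv ab.
(* Each difference source minus target moves by less than 2 r = e when both ends stay in their
   balls. *)
pose r := (e / 2)%R; have r0 : (0 < r)%R by rewrite divr_gt0.
exists r => //; set Bx := ball x0 r; set B0 := ball y0 r; set B1 := ball y1 r.
have mBx : measurable Bx by exact: mball.
have mB0 : measurable B0 by exact: mball.
have mB1 : measurable B1 by exact: mball.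
have [m0 m0E] := fiber_measure mBx mB0.
have [m1 m1E] := fiber_measure mBx mB1.
have dom P (m : {finite_measure set X -> \bar R}) : measurable P ->
    (forall B, measurable B -> m B = gamma ((B `&` Bx) `*` P)) ->
    forall B, measurable B -> lebesgue_rV n B = 0 -> m B = 0.
  move=> mP mE B mB /(gamma_ac mB) B0'; rewrite mE//.
  apply/eqP; rewrite eq_le measure_ge0 andbT -B0'; apply: le_measure; rewrite ?inE.
  - by apply: measurableX => //; exact: measurableI.
  - exact: measurableX.
  - by move=> [x y] [[/= Bx' _] _].
have [D0 [mD0 cD0 D0A]] := dominated_carrier (dom _ _ mB0 m0E).
have [D1 [mD1 cD1 D1A]] := dominated_carrier (dom _ _ mB1 m1E).
pose S := Bx `&` (D0 `&` D1).
have mS : measurable S by apply: measurableI => //; exact: measurableI.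
have [S0|S0] := eqVneq (lebesgue_rV n S) 0.
  exists (~` D0); first exact: measurableC.
  split; first by rewrite setIC; apply: etrans (esym (m0E _ (measurableC mD0))) cD0.
  rewrite setDE setCK.
  have z1 : gamma (S `*` B1) = 0.
    have SB : S `&` Bx = S by rewrite /S setIAC setIid.
    by rewrite -SB; apply: etrans (esym (m1E S mS)) (dom _ _ mB1 m1E S mS S0).
  have z2 : gamma ((~` D1 `&` Bx) `*` B1) = 0.
    by apply: etrans (esym (m1E _ (measurableC mD1))) cD1.
  apply/eqP; rewrite eq_le measure_ge0 andbT.
  have mCD : measurable (~` D1 `&` Bx) by apply: measurableI => //; exact: measurableC.
  apply: (@le_trans _ _ (gamma ((S `*` B1) `|` ((~` D1 `&` Bx) `*` B1)))).
    apply: le_measure; rewrite ?inE.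
    - by apply: measurableX => //; exact: measurableI.
    - by apply: measurableU; exact: measurableX.
    - move=> [x y] [[/= xBx D0x] yB1]; have [D1x|nD1x] := pselect (D1 x).
        by left.
      by right.
  rewrite (le_trans (measureU2 _ _ _))//; try exact: measurableX.
  by rewrite [X in X + _]z1 [X in _ + X]z2 adde0.
exfalso.
have Spos : 0 < lebesgue_rV n S by rewrite lt_neqAle eq_sym S0 measure_ge0.
pose v := (y1 - y0)%R; pose M := (`|x0| + r)%R.
have nb (x y : X) : ball x r y -> (`|y - x| < r)%R.
  by rewrite mx_norm_ball /ball_/= distrC.
have M0 : (0 <= M)%R by rewrite addr_ge0// ltW.
have SM x : S x -> (`|x| <= M)%R.
  move=> [/nb xr _]; rewrite -[x](subrK x0) (le_trans (ler_normD _ _))//.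
  by rewrite addrC lerD2l ltW.
have [t [/andP[t0 t2] S'0]] := translation_overlap v mS M0 SM Spos.
set S' := S `&` _ in S'0.
have mS' : measurable S'.
  apply: measurableI => //; rewrite -[X in measurable X]setTI.
  exact: (measurable_translation (- (t *: v))).
(* Sources taken in one cell and its translate differ by t v up to the cell's diameter, which must
   stay below t e because the error is divided by t. *)
have te0 : (0 < t * e / 2)%R by rewrite divr_gt0// mulr_gt0.
have [k _ /(_ _ (leqnn k)) kt'] := near_infty_natSinv_lt (PosNum te0).
have kt : (k.+1%:R^-1 < t * e / 2)%R := kt'.
have [j Sj] : exists j, lebesgue_rV n (S' `&` grid k j) <> 0.
  apply: contrapT => none; suff : lebesgue_rV n S' = 0.
    by move=> S'E; move: S'0; rewrite S'E ltxx.
  apply: (null_of_cover mS' (@measurable_grid R n k)); first by rewrite grid_cover.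
  by move=> j; apply: contrapT => nz; apply: none; exists j.
pose A0 := S' `&` grid k j; pose A1 := (fun x => x + t *: v)%R @^-1` A0.
have mA0 : measurable A0 by apply: measurableI => //; exact: measurable_grid.
have mA1 : measurable A1.
  by rewrite -[X in measurable X]setTI; exact: measurable_translation.
have A1S x : A1 x -> S x by move=> [[_ /=]]; rewrite addrK.
have : gamma (A0 `*` B0) = 0 \/ gamma (A1 `*` B1) = 0.
  apply: (swap_null mc (fun z => h0 _) c_fin c_opt mA0 mA1 mB0 mB1).
  move=> p q0 x1 q1 A0p /nb q0y A1x /nb q1y /=.
  have px : (`|p - x0| < r)%R by apply: nb; case: A0p => -[[]].
  have xx : (`|x1 - x0| < r)%R by apply: nb; have [] := A1S _ A1x.
  pose w := (t^-1 *: (p - x1))%R.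
  have tw : (t *: w = p - x1)%R by rewrite /w scalerA mulfV ?gt_eqF// scale1r.
  have wv : (`|w - v| < e)%R.
    rewrite -(ltr_pM2l t0) -[X in (X * _ < _)%R](gtr0_norm t0) -normrZ.
    rewrite scalerBr tw -addrA -opprD.
    apply: (@grid_dist R n k j); [by case: A0p|by case: A1x|].
    by rewrite mulrC -ltr_pdivlMr.
  have := @gap_exchange R n h hconv (p - q0) (x1 - q1) w t.
  rewrite tw t0 t2 (_ : p - q0 - (p - x1) = x1 - q0)%R; last first.
    by apply/rowP => i; rewrite !mxE; lra.
  rewrite (_ : x1 - q1 + (p - x1) = p - q1)%R; last first.
    by apply/rowP => i; rewrite !mxE; lra.
  rewrite [(h (p - q1) + _)%R]addrC => ex; apply: ex => //; apply: gap.
  - rewrite (_ : _ - _ = (p - x0) - (q0 - y0))%R; last first.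
      by apply/rowP => i; rewrite !mxE; lra.
    by rewrite (le_lt_trans (ler_normB _ _))// (splitr e) ltrD.
  - rewrite (_ : _ - _ = (x1 - x0) - (q1 - y1))%R; last first.
      by apply/rowP => i; rewrite !mxE; lra.
    by rewrite (le_lt_trans (ler_normB _ _))// (splitr e) ltrD.
  - rewrite (_ : x0 - y0 - (x0 - y1) = v)%R//.
    by apply/rowP => i; rewrite !mxE; lra.
(* [A0] lies in [D0] and [A1] in [D1], so either alternative makes the cell null for Lebesgue
   measure, by translation invariance in the second case. *)
case=> z.
  apply: Sj; apply: D0A => //; first by move=> x [[[_ []]]].
  rewrite m0E// (_ : A0 `&` Bx = A0)//.
  by apply/seteqP; split => x // => [[]|] // A0x; split => //; case: A0x => -[[]].
suff : lebesgue_rV n A1 = 0 by rewrite lebesgue_rV_translation.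
apply: D1A => //; first by move=> x /A1S[_ []].
rewrite m1E// (_ : A1 `&` Bx = A1)//.
by apply/seteqP; split => x // => [[]|] // A1x; split => //; case: (A1S _ A1x).
Qed.

(** Compactness gives one radius for all triples of points; cells finer than this radius then cover
    K, P and Q, and separation is stable under countable unions. *)
Lemma separated_compact (K P Q : set X) : compact K -> compact P -> compact Q ->
  P `&` Q = set0 -> separated gamma K P Q.
Proof.
move=> cK cP cQ PQ.
have mK := compact_measurable_rV cK; have mP := compact_measurable_rV cP.
have mQ := compact_measurable_rV cQ.
have [k kE] : exists k : nat, forall x y0 y1, K x -> P y0 -> Q y1 ->
    separated gamma (ball x (k.+1%:R^-1)%R) (ball y0 (k.+1%:R^-1)%R)
      (ball y1 (k.+1%:R^-1)%R).
  have /compact_near_coveringP := compact_setX cK (compact_setX cP cQ).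
  move=> /(_ _ \oo (fun k z => separated gamma (ball z.1 (k.+1%:R^-1)%R)
      (ball z.2.1 (k.+1%:R^-1)%R) (ball z.2.2 (k.+1%:R^-1)%R))).
  case=> [[x [y0 y1]] [/= Kx [/= Py Qy]]|N _ /(_ _ (leqnn N)) NE]; last first.
    by exists N => x y0 y1 Kx Py Qy; apply: (NE (x, (y0, y1))).
  have y01 : y0 != y1.
    apply/eqP => yE; have : (P `&` Q) y0 by split => //; rewrite yE.
    by rewrite PQ.
  have [r r0 sr] := separated_local x y01.
  have r20 : (0 < r / 2)%R by rewrite divr_gt0.
  have [N _ Nr] := near_infty_natSinv_lt (PosNum r20).
  exists (ball x (r / 2)%R `*` (ball y0 (r / 2)%R `*` ball y1 (r / 2)%R),
    [set k | (N <= k)%N]) => /=.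
    split; last by exists N.
    exists (ball x (r / 2)%R, ball y0 (r / 2)%R `*` ball y1 (r / 2)%R) => //=.
    split; first exact: nbhsx_ballx.
    exists (ball y0 (r / 2)%R, ball y1 (r / 2)%R) => //=.
    by split; exact: nbhsx_ballx.
  move=> [[x' [y0' y1']] k] [/= [/= xx [/= yy0 yy1]] Nk].
  have sub (a b : X) : ball a (r / 2)%R b -> ball b (k.+1%:R^-1)%R `<=` ball a r.
    move=> ab z bz; apply: (@le_ball _ _ a (r / 2 + k.+1%:R^-1)%R).
      have kr : (k.+1%:R^-1 < r / 2)%R := Nr _ Nk.
      by rewrite [leRHS](splitr r) lerD2l ltW.
    exact: ball_triangle ab bz.
  by apply: separatedS sr => //; exact: sub.
(* Cells of mesh m have diameter at most 2 / (2 k + 3), below the radius 1 / (k + 1). *)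
pose m := k.*2.+2.
have mk : (2 * m.+1%:R^-1 < k.+1%:R^-1 :> R)%R.
  rewrite ltr_pdivrMr// mulrC ltr_pdivlMr// -natrM ltr_nat /m.
  by rewrite mul2n doubleS.
have gridI (W : set X) i : measurable W -> measurable (W `&` grid m i).
  by move=> mW; apply: measurableI => //; exact: measurable_grid.
have gridE (W : set X) : W = \bigcup_i (W `&` grid m i).
  by rewrite -setI_bigcupr grid_cover setIT.
have sub (W : set X) i x : (W `&` grid m i) x ->
    W `&` grid m i `<=` ball x (k.+1%:R^-1)%R.
  move=> [_ gx] z [_ gz]; rewrite mx_norm_ball; exact: grid_dist gx gz mk.
rewrite (gridE K); apply: separated_bigcupA => //; first by move=> i; exact: gridI.
move=> i; have mKi := gridI K i mK; have [K0|/set0P[x Kx]] := eqVneq (K `&` grid m i) set0.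
  by rewrite K0; exact: separated0A.
rewrite (gridE P); apply: separated_bigcupl => //; first by move=> j; exact: gridI.
move=> j; have mPj := gridI P j mP; have [P0|/set0P[y0 Py]] := eqVneq (P `&` grid m j) set0.
  by rewrite P0; exact: separated0l.
rewrite (gridE Q); apply: separated_bigcupr => //; first by move=> l; exact: gridI.
move=> l; have mQl := gridI Q l mQ; have [Q0|/set0P[y1 Qy]] := eqVneq (Q `&` grid m l) set0.
  by rewrite Q0; apply: separatedC => //; exact: separated0l.
have sk := kE x y0 y1 Kx.1 Py.1 Qy.1.
by apply: separatedS sk => //; exact: sub.
Qed.

(** This is how a graph is expressed without constructing a map: for each open B, the source
    decides, up to a null set, whether the target lies in B. *)
Lemma separated_open (B : set X) : open B -> separated gamma setT B (~` B).
Proof.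
move=> oB; have [K [cK _ TK]] := @open_sigma_compact R n setT openT.
have [P [cP _ BP]] := open_sigma_compact oB.
have mK k := compact_measurable_rV (cK k).
have mP k := compact_measurable_rV (cP k).
have mB := open_measurable_rV oB; have mCB := measurableC mB.
have cQ k : compact (K k `&` ~` B).
  apply: (subclosed_compact _ (cK k)); last by move=> x [].
  apply: closedI; last exact: open_closedC.
  by apply: compact_closed => //; exact: norm_hausdorff.
have mQ k := compact_measurable_rV (cQ k).
rewrite TK; apply: separated_bigcupA => // i.
rewrite [in X in separated _ _ X _]BP; apply: separated_bigcupl => // j.
have -> : ~` B = \bigcup_k (K k `&` ~` B) by rewrite -setI_bigcupl -TK setTI.
apply: separated_bigcupr => // k; apply: separated_compact => //.
apply/seteqP; split => // x [Px [_ nBx]]; apply: nBx; rewrite BP; exists j => //.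
Qed.

End graph.

(** * Uniqueness *)

Lemma eq_prod_measure_open (R : realType) n
    (m m' : {finite_measure set ('rV[R]_n * 'rV[R]_n)%type -> \bar R}) :
  (forall A B, measurable A -> open B -> m (A `*` B) = m' (A `*` B)) ->
  forall C, measurable C -> m C = m' C.
Proof.
move=> mm'.
have rect (A B : set 'rV[R]_n) : measurable A -> measurable B ->
    m (A `*` B) = m' (A `*` B).
  move=> mA mB; have mAT : measurable (A `*` [set: 'rV[R]_n]) by exact: measurableX.
  have slice (k : {finite_measure set ('rV[R]_n * 'rV[R]_n)%type -> \bar R}) :
      exists p : {measure set 'rV[R]_n -> \bar R}, forall D, p D = k (A `*` D).
    have [r rE] := finite_restriction k mAT.
    have [p pE] := measure_pushforward r (@measurable_snd _ _ 'rV[R]_n 'rV[R]_n).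
    exists p => D; apply: etrans (pE D) _; apply: etrans (rE _) _.
    by congr (k _); apply/seteqP; split => -[x y] /= => [[Dy [Ax _]]|[Ax Dy]].
  have [p pE] := slice m; have [p' pE'] := slice m'.
  rewrite -pE -pE'.
  apply: (measure_unique [set U : set 'rV[R]_n | open U] (fun=> setT)) => //.
  - by move=> U V; exact: openI.
  - by move=> _; exact: openT.
  - by rewrite bigcup_const.
  - by move=> U oU; apply: etrans (pE U) (etrans (mm' A U mA oU) (esym (pE' U))).
  - move=> k; rewrite pE -ge0_fin_numE// fin_num_measure//.
move=> C; apply: (measure_unique
  [set A `*` B | A in @measurable _ 'rV[R]_n & B in @measurable _ 'rV[R]_n]
  (fun=> setT)) => //.
- exact: measurable_prod_measurableType.
- move=> _ _ [A1 mA1 [A2 mA2 <-]] [B1 mB1 [B2 mB2 <-]].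
  exists (A1 `&` B1); first exact: measurableI.
  exists (A2 `&` B2); first exact: measurableI.
  by rewrite setXI.
- by move=> _; exists setT => //; exists setT => //; rewrite setXTT.
- by rewrite bigcup_const.
- by move=> _ [A mA [B mB <-]]; exact: rect.
- by move=> _; rewrite -ge0_fin_numE// fin_num_measure.
Qed.

Lemma probability_average d (T : measurableType d) (R : realType)
    (P Q : probability T R) : exists G : probability T R,
  (forall A, 2%:E * G A = P A + Q A)%E /\
  (forall f : T -> \bar R, measurable_fun setT f -> (forall x, 0 <= f x)%E ->
    2%:E * \int[G]_x f x = \int[P]_x f x + \int[Q]_x f x)%E.
Proof.
have half0 : 0 <= (2^-1 : R) by rewrite invr_ge0.
pose half := NngNum half0.
pose m : {measure set T -> \bar R} := mscale half (measure_add P Q).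
have mE A : m A = ((2^-1)%:E * (P A + Q A))%E.
  by apply: (congr1 (mule (2^-1)%:E)); exact: measure_addE.
have hK (x : \bar R) : (2%:E * ((2^-1)%:E * x) = x)%E.
  by rewrite muleA -EFinM mulfV// mul1e.
have mT : m setT = 1%E.
  by rewrite mE !probability_setT -EFinD -EFinM mulVf.
have [G GE] := probability_of_measure mT; exists G; split => [A|f mf f0].
  by rewrite GE mE hK.
rewrite (@eq_measure_integral _ _ _ _ m); last by move=> A _ _; exact: GE.
by rewrite ge0_integral_mscale// ge0_integral_measure_add// hK.
Qed.

(** Measures agreeing on measurable sets have the same densities; where there is none, both
    entropies are infinite. *)
Lemma DKL_ext d (T : measurableType d) (R : realType)
    (alpha alpha' beta : {finite_measure set T -> \bar R}) :
  (forall A, measurable A -> alpha A = alpha' A) ->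
  DKL alpha beta = DKL alpha' beta.
Proof.
move=> aE; have [[g dg]|no] := pselect (exists g, density beta alpha g).
  rewrite (DKL_density dg); apply/esym/DKL_density.
  by case: dg => mg g0 gE; split => // A mA; rewrite -aE// gE.
have infty (a : {finite_measure set T -> \bar R}) :
    (forall A, measurable A -> alpha A = a A) -> DKL a beta = +oo%E.
  move=> aaE; apply/eqP; rewrite -leye_eq leNgt; apply/negP => /DKL_lty_density[g].
  move=> [mg g0 gE]; apply: no; exists g; split => // A mA.
  by rewrite aaE// gE.
by rewrite !infty.
Qed.

Section average_optimal.
Context (R : realType) (n : nat).
Notation X := 'rV[R]_n.
Variables (mu nu : probability X R) (c : X -> X -> R) (Lambda : R).
Hypotheses (c0 : forall x y, 0 <= c x y).
Hypotheses (cc : continuous (fun z : X * X => c z.1 z.2)).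
Hypothesis (Lambda_gt0 : 0 < Lambda).
Let J := entropy_transport c Lambda mu nu.
Let I0 := ereal_inf (range J).

(** The cost is affine and both entropies are convex, so minimality of the average leaves no slack
    in any term; for the first entropy this is the equality case [DKL_midpoint_eq]. *)
Lemma average_optimal (gamma gamma' G : probability (X * X)%type R) :
  J gamma = I0 -> J gamma' = I0 ->
  (forall A, 2%:E * G A = gamma A + gamma' A)%E ->
  (forall f : X * X -> \bar R, measurable_fun setT f -> (forall x, 0 <= f x)%E ->
    2%:E * \int[G]_x f x = \int[gamma]_x f x + \int[gamma']_x f x)%E ->
  J G = I0 /\ forall A, measurable A -> gamma (A `*` setT) = gamma' (A `*` setT).
Proof.
move=> Jg Jg' GE Gint; have mc := measurable_cost cc.
have cpos (z : X * X) : (0 <= (c z.1 z.2)%:E)%E by rewrite lee_fin.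
have I0fin : I0 \is a fin_num := entropy_transport_inf_fin mu nu c0 cc Lambda_gt0.
have JI g : (I0 <= J g)%E by apply: ereal_inf_lbound; exists g.
have parts (g : probability (X * X)%type R) : J g = I0 ->
    [/\ (\int[g]_z (c z.1 z.2)%:E < +oo)%E,
        (DKL (distribution g fst) mu < +oo)%E &
        (DKL (distribution g snd) nu < +oo)%E].
  move=> gI; have gC : (J g <= (fine I0)%:E)%E by rewrite gI fineK.
  have [p1 p2 p3] := entropy_transport_parts c0 Lambda_gt0 gC.
  by split; [apply: le_lt_trans p1 _|apply: le_lt_trans p2 _|
    apply: le_lt_trans p3 _]; rewrite ltry.
have real_parts (g : probability (X * X)%type R) : (\int[g]_z (c z.1 z.2)%:E < +oo)%E ->
    (DKL (distribution g fst) mu < +oo)%E ->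
    (DKL (distribution g snd) nu < +oo)%E -> exists k a b : R,
    [/\ (\int[g]_z (c z.1 z.2)%:E = k%:E)%E, DKL (distribution g fst) mu = a%:E,
     DKL (distribution g snd) nu = b%:E & J g = (k + Lambda * a + Lambda * b)%:E].
  move=> kf af bf.
  have kE : (\int[g]_z (c z.1 z.2)%:E)%E \is a fin_num.
    by rewrite ge0_fin_numE//; apply: integral_ge0.
  have aE : DKL (distribution g fst) mu \is a fin_num.
    by rewrite ge0_fin_numE//; exact: DKL_ge0.
  have bE : DKL (distribution g snd) nu \is a fin_num.
    by rewrite ge0_fin_numE//; exact: DKL_ge0.
  exists (fine (\int[g]_z (c z.1 z.2)%:E)), (fine (DKL (distribution g fst) mu)).
  exists (fine (DKL (distribution g snd) nu)).
  by rewrite !EFinD !EFinM !fineK.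
have [kf af bf] := parts _ Jg; have [kf' af' bf'] := parts _ Jg'.
have [k [a [b [kE aE bE JE]]]] := real_parts _ kf af bf.
have [k' [a' [b' [kE' aE' bE' JE']]]] := real_parts _ kf' af' bf'.
have Gk := Gint _ mc cpos.
have Gfst A : measurable A -> (2%:E * distribution G fst A =
    distribution gamma fst A + distribution gamma' fst A)%E.
  by move=> _; exact: GE.
have Gsnd A : measurable A -> (2%:E * distribution G snd A =
    distribution gamma snd A + distribution gamma' snd A)%E.
  by move=> _; exact: GE.
have Ga : (2%:E * DKL (distribution G fst) mu <= (a + a')%:E)%E.
  by rewrite [(a + a')%:E]EFinD -aE -aE'; exact: (DKL_midpoint mu Gfst).
have Gb : (2%:E * DKL (distribution G snd) nu <= (b + b')%:E)%E.
  by rewrite [(b + b')%:E]EFinD -bE -bE'; exact: (DKL_midpoint nu Gsnd).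
have half_lty (x : \bar R) (r : R) : (2%:E * x <= r%:E)%E -> (x < +oo)%E.
  by case: x => [s _|/=|//]; [rewrite ltry|rewrite gt0_muley// ?lte_fin].
have [kg [ag [bg [kgE agE bgE JGE]]]] : exists k a b : R,
    [/\ (\int[G]_z (c z.1 z.2)%:E = k%:E)%E, DKL (distribution G fst) mu = a%:E,
     DKL (distribution G snd) nu = b%:E & J G = (k + Lambda * a + Lambda * b)%:E].
  apply: real_parts.
  - by apply: (half_lty _ (k + k')); rewrite Gk kE kE'.
  - by exact: half_lty Ga.
  - by exact: half_lty Gb.
have gk : 2 * kg = k + k' by move: Gk; rewrite kgE kE kE' -EFinM -EFinD => -[].
have ga : 2 * ag <= a + a' by move: Ga; rewrite agE -EFinM lee_fin.
have gb : 2 * bg <= b + b' by move: Gb; rewrite bgE -EFinM lee_fin.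
have IE : k + Lambda * a + Lambda * b = k' + Lambda * a' + Lambda * b'.
  by apply: EFin_inj; rewrite -JE -JE' Jg' -Jg.
have IG : k + Lambda * a + Lambda * b <= kg + Lambda * ag + Lambda * bg.
  by rewrite -lee_fin -JE -JGE Jg; exact: JI.
have La : Lambda * (a + a') >= Lambda * (2 * ag) by rewrite ler_pM2l.
have Lb : Lambda * (b + b') >= Lambda * (2 * bg) by rewrite ler_pM2l.
have ga' : a + a' <= 2 * ag by rewrite -(ler_pM2l Lambda_gt0); lra.
have JG : J G = I0 by rewrite JGE -Jg JE; congr EFin; lra.
split => // A mA.
rewrite -!distribution_fstE; move: A mA.
apply: (DKL_midpoint_eq Gfst af af').
suff : (DKL (distribution gamma fst) mu + DKL (distribution gamma' fst) mu <=
    2%:E * DKL (distribution G fst) mu)%E by [].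
by rewrite aE aE' agE -EFinM -EFinD lee_fin.
Qed.

End average_optimal.

Theorem corollary1 (R : realType) (d : nat)
    (mu nu : probability 'rV[R]_d R)
    (mu_ac : mu `<< lebesgue_rV d) (nu_ac : nu `<< lebesgue_rV d)
    (h : 'rV[R]_d -> R) (h_ge0 : forall x, 0 <= h x)
    (h_convex : strictly_convex h)
    (c : 'rV[R]_d -> 'rV[R]_d -> R) (cE : forall x y, c x y = h (x - y))
    (Lambda : R) (Lambda_gt0 : 0 < Lambda) :
  exists gamma : probability ('rV[R]_d * 'rV[R]_d)%type R,
    optimal_solution c Lambda mu nu gamma /\
    forall gamma' : probability ('rV[R]_d * 'rV[R]_d)%type R,
      optimal_solution c Lambda mu nu gamma' ->
      forall A : set ('rV[R]_d * 'rV[R]_d), measurable A -> gamma' A = gamma A.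
Proof.
have c0 x y : 0 <= c x y by rewrite cE.
have cEz : (fun z : 'rV[R]_d * 'rV[R]_d => c z.1 z.2) = fun z => h (z.1 - z.2).
  by apply/funext => z; rewrite cE.
have cc : continuous (fun z : 'rV[R]_d * 'rV[R]_d => c z.1 z.2).
  by rewrite cEz; exact: continuous_diff_cost.
have [gamma Jg] := optimal_exists mu nu c0 cc Lambda_gt0.
exists gamma; split => // gamma' Jg'.
have [G [GE Gint]] := probability_average gamma gamma'.
have [JG fst_eq] := average_optimal c0 cc Lambda_gt0 Jg Jg' GE Gint.
have gC : (entropy_transport c Lambda mu nu G <=
    (fine (ereal_inf (range (entropy_transport c Lambda mu nu))))%:E)%E.
  by rewrite JG fineK//; exact: entropy_transport_inf_fin.
have [Gc Ga Gb] := entropy_transport_parts c0 Lambda_gt0 gC.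
have G_fin : (\int[G]_z (h (z.1 - z.2))%:E < +oo)%E.
  by under eq_integral do rewrite -cE; apply: le_lt_trans Gc _; rewrite ltry.
have G_ac (A : set 'rV[R]_d) : measurable A -> lebesgue_rV d A = 0%E ->
    G (A `*` setT) = 0%E.
  move=> mA A0; rewrite -distribution_fstE.
  have Gmu : distribution G fst `<< mu.
    by apply: DKL_dominates; apply: le_lt_trans Ga _; rewrite ltry.
  move/null_content_dominatesP: Gmu; apply => //.
  by move/null_content_dominatesP: mu_ac; apply.
(* Equal marginals give equal entropies, which are finite and cancel from the comparison of total
   energies. *)
have G_opt (g : probability ('rV[R]_d * 'rV[R]_d)%type R) :
    (forall A, measurable A -> g (A `*` setT) = G (A `*` setT)) ->
    (forall B, measurable B -> g (setT `*` B) = G (setT `*` B)) ->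
    (\int[G]_z (h (z.1 - z.2))%:E <= \int[g]_z (h (z.1 - z.2))%:E)%E.
  move=> g1 g2.
  have e1 : DKL (distribution g fst) mu = DKL (distribution G fst) mu.
    apply: DKL_ext => A mA; apply: etrans (distribution_fstE _ _) _.
    by rewrite g1//; exact: esym (distribution_fstE _ _).
  have e2 : DKL (distribution g snd) nu = DKL (distribution G snd) nu.
    apply: DKL_ext => A mA; apply: etrans (distribution_sndE _ _) _.
    by rewrite g2//; exact: esym (distribution_sndE _ _).
  have : (entropy_transport c Lambda mu nu G <= entropy_transport c Lambda mu nu g)%E.
    by rewrite JG; apply: ereal_inf_lbound; exists g.
  have fin_dkl (P Q : probability 'rV[R]_d R) (r : R) : (DKL P Q <= r%:E)%E ->
      (Lambda%:E * DKL P Q)%E \is a fin_num.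
    move=> Pr; rewrite fin_numM// ge0_fin_numE ?DKL_ge0//.
    by apply: le_lt_trans Pr _; rewrite ltry.
  rewrite /entropy_transport e1 e2.
  rewrite !leeD2rE; try exact: fin_dkl Gb; try exact: fin_dkl Ga.
  by under eq_integral do rewrite cE; under [leRHS]eq_integral do rewrite cE.
move=> C mC; apply/esym; apply: eq_prod_measure_open mC => A B mA oB.
have mB := open_measurable_rV oB; have mCB := measurableC mB.
have [N mN [N0 N1]] := separated_open h_ge0 h_convex G_ac G_fin G_opt oB.
(* A null set of the average is null for both minimizers, so a single N separates B for both of
   them. *)
have null (Z : set ('rV[R]_d * 'rV[R]_d)) : measurable Z -> G Z = 0%E ->
    gamma Z = 0%E /\ gamma' Z = 0%E.
  move=> mZ Z0; have := GE Z; rewrite Z0 mule0 => /esym/eqP.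
  by rewrite padde_eq0// => /andP[/eqP-> /eqP->].
have [g0 g0'] := null _ (measurableX (measurableI _ _ measurableT mN) mB) N0.
have [g1 g1'] := null _ (measurableX (measurableD measurableT mN) mCB) N1.
(* Off N almost all mass lands in B and over N almost none does, so the mass of [A x B] is read off
   the first marginal. *)
have slice (g : probability ('rV[R]_d * 'rV[R]_d)%type R) :
    g ((setT `&` N) `*` B) = 0%E -> g ((setT `\` N) `*` ~` B) = 0%E ->
    g (A `*` B) = g ((A `\` N) `*` setT).
  move=> n0 n1; rewrite setTI setTD in n0 n1.
  have mAN : measurable (A `\` N) by exact: measurableD.
  have ext (Y Z W : set ('rV[R]_d * 'rV[R]_d)) : measurable Y -> measurable Z ->
      measurable W -> g W = 0%E -> Y `<=` Z `|` W -> (g Y <= g Z)%E.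
    move=> mY mZ mW W0 YZW; rewrite -[leRHS]adde0 -W0.
    apply: le_trans (measureU2 _ mZ mW).
    by apply: le_measure; rewrite ?inE//; exact: measurableU.
  apply/eqP; rewrite eq_le; apply/andP; split.
    apply: ext n0 _; try exact: measurableX.
    by move=> [x y] [/= Ax By]; have [Nx|nNx] := pselect (N x); [right|left].
  apply: ext n1 _; try by apply: measurableX => //; exact: measurableC.
  by move=> [x y] [/= [Ax nNx] _]; have [Bx|nBx] := pselect (B y); [left|right].
apply: etrans (slice gamma g0 g1) _; apply: etrans _ (esym (slice gamma' g0' g1')).
by apply: fst_eq; exact: measurableD.
Qed.
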